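(* Let $\Omega\subseteq\mathbb{C}$ be a simply connected compact set (not a single point) with $\Omega=\Omega^*:=\{\overline{z}:z\in\Omega\}$, and let $\widetilde{\Phi}:\widehat{\mathbb{C}}\setminus\Omega\to\{w\in\widehat{\mathbb{C}}:|w|>1\}$ be its exterior Riemann map, normalized by $\widetilde{\Phi}(\infty)=\infty$ and $\widetilde{\Phi}'(\infty)>0$. Let $P(z)=\alpha z^n+\alpha_0$ with $\alpha>0$, $n\ge 2$ and $\alpha_0\in\mathbb{R}$, $\alpha_0<\min(\Omega\cap\mathbb{R})$, and let $E:=P^{-1}(\Omega)$. Set $\mu:=\left(\frac{1}{\alpha\widetilde{\Phi}'(\infty)}\right)^{1/n}>0$ and let $a_1,\ldots,a_n$ be the $n$ distinct roots of the polynomial $w^n+\mu^n\widetilde{\Phi}(P(0))$. Let $F_k$ denote the $k$th Faber polynomial for $\Omega$, and let $b_{k}$ denote the $k$th Faber--Walsh polynomial for $E$ and the sequence $(\alpha_j)_{j=1}^\infty=(a_1,a_2,\ldots,a_n,a_1,a_2,\ldots,a_n,\ldots)$. Then for all $k\ge 0$ $$b_{kn}(z)=\frac{1}{(\alpha\widetilde{\Phi}'(\infty))^k}\,F_k(P(z)).$$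
   Context: $\widehat{\mathbb{C}}=\mathbb{C}\cup\{\infty\}$. A ''simply connected compact set'' is a connected compact subset of $\mathbb{C}$ with connected complement. $\widetilde{\Phi}'(\infty):=\lim_{z\to\infty}\widetilde{\Phi}(z)/z$. Faber polynomials: $F_k$ is the polynomial part of the Laurent series at infinity of $(\widetilde{\Phi}(z))^k$; it has degree $k$ and leading coefficient $(\widetilde{\Phi}'(\infty))^k$ (so it is not necessarily monic). Lemniscatic domain: for $N\ge1$, pairwise distinct $a_1,\ldots,a_N\in\mathbb{C}$ (the foci), real $m_1,\ldots,m_N>0$ with $\sum_j m_j=1$, and $\mu>0$, the set $\mathcal{L}=\{w\in\widehat{\mathbb{C}}:|U(w)|>\mu\}$ with $U(w)=\prod_{j=1}^N(w-a_j)^{m_j}$. Lemniscatic map (theorem of Walsh): let $E=\bigcup_{j=1}^N E_j$ with $E_1,\ldots,E_N\subseteq\mathbb{C}$ mutually exterior (pairwise disjoint) simply connected compact sets, none a single point, and let $\mathcal{K}=\widehat{\mathbb{C}}\setminus E$. There exist a unique lemniscatic domain $\mathcal{L}=\{w\in\widehat{\mathbb{C}}:|U(w)|>\mu\}$, $U(w)=\prod_{j=1}^N(w-a_j)^{m_j}$, with $\mu$ equal to the logarithmic capacity of $E$, and a unique bijective conformal map $\Phi:\mathcal{K}\to\mathcal{L}$ with $\Phi(z)=z+\mathcal{O}(1/z)$ near infinity, called the lemniscatic map of $E$. Admissible sequences: a sequence $(\alpha_j)_{j\ge1}$ chosen from the foci $a_1,\ldots,a_N$ such that there is a constant $A>0$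 with $|N_{k,j}-km_j|\le A$ for all $k\ge1$ and $1\le j\le N$, where $N_{k,j}$ is the number of times $a_j$ appears among $\alpha_1,\ldots,\alpha_k$. Put $u_k(w)=\prod_{j=1}^k(w-\alpha_j)$, $u_0=1$. Faber--Walsh polynomials: with $g_{\mathcal{K}}(z)=\log|U(\Phi(z))|-\log\mu$ (the Green's function of $\mathcal{K}$ with pole at infinity) and $\Gamma_\lambda=\{z\in\mathcal{K}:g_{\mathcal{K}}(z)=\log\lambda\}$ for $\lambda>1$, the $k$th Faber--Walsh polynomial for $E$ and $(\alpha_j)$ is $$b_k(z)=\frac{1}{2\pi i}\int_{\Gamma_\lambda}\frac{u_k(\Phi(\zeta))}{\zeta-z}\,d\zeta,$$ for any $\lambda>1$ such that $z$ lies in the interior of the positively oriented $\Gamma_\lambda$; it is a monic polynomial of degree $k$ (independent of $\lambda$). Known facts in the present setting (recalled from earlier work of the authors): $E=P^{-1}(\Omega)$ is the disjoint union of $n$ simply connected compact sets; its lemniscatic domain is $\mathcal{L}=\{w\in\widehat{\mathbb{C}}:|U(w)|>\mu\}$ with $\mu=\left(\frac{1}{\alpha\widetilde{\Phi}'(\infty)}\right)^{1/n}$ and $U(w)=(w^n+\mu^n\widetilde{\Phi}(P(0)))^{1/n}$ (so the foci are $a_1,\ldots,a_n$, with all exponents equal to $1/n$); and its lemniscatic map is $\Phi(z)=z\left(\frac{\mu^n}{z^n}[\widetilde{\Phi}(P(z))-\widetilde{\Phi}(P(0))]\right)^{1/n}$ with the principal branch of the $n$th root. *)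

(* Defs.v *)
From Stdlib Require Import Reals List.
From Coquelicot Require Import Coquelicot.

Open Scope R_scope.
Open Scope C_scope.

(** * Topology of the plane *)

Definition connected_set {T : UniformSpace} (A : T -> Prop) : Prop :=
  forall U V : T -> Prop,
    open U -> open V ->
    (forall x, A x -> U x \/ V x) ->
    (exists x, A x /\ U x) -> (exists x, A x /\ V x) ->
    exists x, A x /\ U x /\ V x.

Definition compact_set {T : UniformSpace} (A : T -> Prop) : Prop :=
  forall (I : Type) (U : I -> T -> Prop),
    (forall i, open (U i)) ->
    (forall x, A x -> exists i, U i x) ->
    exists l : list I, forall x, A x -> exists i, In i l /\ U i x.

Definition bounded_set (A : C -> Prop) : Prop :=
  exists M : R, forall z, A z -> (Cmod z <= M)%R.

Definition simply_connected_compact (A : C -> Prop) : Prop :=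
  connected_set A /\ compact_set A /\ connected_set (fun z => ~ A z).

(* Neither a single point nor empty. *)
Definition nondegenerate (A : C -> Prop) : Prop :=
  exists z1 z2, A z1 /\ A z2 /\ z1 <> z2.

(* Neighbourhoods of the point at infinity of the Riemann sphere. *)
Definition C_infty (A : C -> Prop) : Prop :=
  exists M : R, forall z, (M < Cmod z)%R -> A z.

(** * Conformal maps *)

Definition conformal_bijection (D D' : C -> Prop) (f : C -> C) : Prop :=
  (forall z, D z -> ex_derive (K := C_AbsRing) (V := C_NormedModule) f z
                    /\ C_derive f z <> 0) /\
  (forall z, D z -> D' (f z)) /\
  (forall z1 z2, D z1 -> D z2 -> f z1 = f z2 -> z1 = z2) /\
  (forall w, D' w -> exists z, D z /\ f z = w).

(* A conformal bijection between two domains of the sphere that contain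
   infinity, fixing infinity, is encoded by its restriction to the finite
   points together with its behaviour at infinity (a simple pole).
   Here Phi'(infinity) = d. *)
Definition exterior_riemann_map (Omega : C -> Prop) (Phi : C -> C) (d : R)
  : Prop :=
  conformal_bijection (fun z => ~ Omega z) (fun w => (1 < Cmod w)%R) Phi /\
  filterlim (fun z => Phi z / z) C_infty (locally (RtoC d)) /\
  (0 < d)%R.

(* F is the polynomial part of the Laurent series of Phi^k at infinity. *)
Definition is_faber_polynomial (Phi : C -> C) (k : nat) (F : C -> C) : Prop :=
  exists (N : nat) (c e : nat -> C) (M : R),
    (forall z, F z = sum_n (fun j => c j * z ^ j) N) /\
    (forall z, (M < Cmod z)%R ->
       is_series (K := C_AbsRing) (V := C_NormedModule)
         (fun j => e j * (/ z) ^ S j) (Phi z ^ k - F z)).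

(** * Integration over systems of closed curves *)

Definition curve_derive (gamma : R -> C) (t : R) : C :=
  (Derive (fun s => Re (gamma s)) t, Derive (fun s => Im (gamma s)) t).

(* The parameter interval is [0,1]; the two-sided conditions at the end points
   cost nothing, since a C^1 function on [0,1] extends to a C^1 function
   on the line. *)
Definition C1_arc (gamma : R -> C) : Prop :=
  forall t : R, (0 <= t <= 1)%R ->
    ex_derive (V := C_R_NormedModule) gamma t /\
    continuous (curve_derive gamma) t.

(* A closed piecewise C^1 curve, given by its consecutive arcs. *)
Definition closed_curve (l : list (R -> C)) : Prop :=
  l <> nil /\
  (forall gamma, In gamma l -> C1_arc gamma) /\
  (forall i : nat, (i < length l)%nat ->
     nth i l (fun _ => 0) 1%R =
     nth (Nat.modulo (S i) (length l)) l (fun _ => 0) 0%R).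

Definition arc_integral (f : C -> C) (gamma : R -> C) : C :=
  RInt (V := C_R_CompleteNormedModule)
    (fun t => f (gamma t) * curve_derive gamma t) 0 1.

(* A cycle is a finite system of closed curves. *)
Definition cycle_integral (cyc : list (list (R -> C))) (f : C -> C) : C :=
  fold_right Cplus 0 (map (arc_integral f) (concat cyc)).

Definition winding_number (cyc : list (list (R -> C))) (z : C) : C :=
  / (2 * PI * Ci) * cycle_integral cyc (fun zeta => / (zeta - z)).

Definition trace (cyc : list (list (R -> C))) (z : C) : Prop :=
  exists gamma t, In gamma (concat cyc) /\ (0 <= t <= 1)%R /\ gamma t = z.

(* The union of the bounded components of the complement of Gamma. *)
Definition interior_of (Gamma : C -> Prop) (z : C) : Prop :=
  ~ Gamma z /\
  forall S : C -> Prop,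
    connected_set S -> S z -> (forall x, S x -> ~ Gamma x) -> bounded_set S.

Definition positively_oriented (Gamma : C -> Prop)
  (cyc : list (list (R -> C))) : Prop :=
  (forall l, In l cyc -> closed_curve l) /\
  (forall z, trace cyc z <-> Gamma z) /\
  (forall z, interior_of Gamma z -> winding_number cyc z = 1) /\
  (forall z, ~ Gamma z -> ~ interior_of Gamma z -> winding_number cyc z = 0).

(* I is the integral of f over the positively oriented set of curves Gamma.
   For f holomorphic in a neighbourhood of Gamma, it does not depend on the
   parametrization, by the homology form of Cauchy's theorem. *)
Definition is_contour_integral (Gamma : C -> Prop) (f : C -> C) (I : C)
  : Prop :=
  exists cyc, positively_oriented Gamma cyc /\ I = cycle_integral cyc f.

(** * Lemniscatic domains and maps *)

(* [Rpower 0 m] is not 0, hence the case distinction. *)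
Definition abs_pow (x m : R) : R :=
  if Req_dec_T x 0 then 0%R else Rpower x m.

(* |U(w)| for U(w) = (w - a_1)^{m_1} ... (w - a_N)^{m_N}; only the modulus of
   this multivalued function is ever needed. *)
Definition abs_U (N : nat) (a : nat -> C) (m : nat -> R) (w : C) : R :=
  fold_right Rmult 1%R
    (map (fun j => abs_pow (Cmod (w - a j)) (m j)) (seq 1 N)).

Definition lemniscatic_data (N : nat) (a : nat -> C) (m : nat -> R) (mu : R)
  : Prop :=
  (1 <= N)%nat /\
  (forall i j : nat, (1 <= i <= N)%nat -> (1 <= j <= N)%nat ->
     a i = a j -> i = j) /\
  (forall j : nat, (1 <= j <= N)%nat -> (0 < m j)%R) /\
  sum_n_m m 1 N = 1%R /\
  (0 < mu)%R.

Definition walsh_compact (N : nat) (E : C -> Prop) : Prop :=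
  exists Ej : nat -> C -> Prop,
    (forall z, E z <-> exists j : nat, (1 <= j <= N)%nat /\ Ej j z) /\
    (forall j : nat, (1 <= j <= N)%nat ->
       simply_connected_compact (Ej j) /\ nondegenerate (Ej j)) /\
    (forall i j : nat, (1 <= i <= N)%nat -> (1 <= j <= N)%nat -> i <> j ->
       forall z, ~ (Ej i z /\ Ej j z)).

(* The last clause is the normalization Phi(z) = z + O(1/z); as above, the
   finite points encode the map of the sphere. *)
Definition is_lemniscatic_map (E : C -> Prop)
  (N : nat) (a : nat -> C) (m : nat -> R) (mu : R) (Phi : C -> C) : Prop :=
  walsh_compact N E /\
  lemniscatic_data N a m mu /\
  conformal_bijection (fun z => ~ E z) (fun w => (mu < abs_U N a m w)%R) Phi /\
  exists M c : R, forall z, (M < Cmod z)%R ->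
    (Cmod (Phi z - z) <= c / Cmod z)%R.

(** * Faber--Walsh polynomials *)

Definition admissible (N : nat) (a : nat -> C) (m : nat -> R)
  (alpha : nat -> C) : Prop :=
  (forall j : nat, (1 <= j)%nat ->
     exists i : nat, (1 <= i <= N)%nat /\ alpha j = a i) /\
  exists A : R, (0 < A)%R /\
    forall k j : nat, (1 <= k)%nat -> (1 <= j <= N)%nat ->
      (Rabs (INR (count_occ Ceq_dec (map alpha (seq 1 k)) (a j))
             - INR k * m j) <= A)%R.

Definition u_poly (alpha : nat -> C) (k : nat) (w : C) : C :=
  fold_right Cmult 1 (map (fun j => w - alpha j) (seq 1 k)).

Definition green (N : nat) (a : nat -> C) (m : nat -> R) (mu : R)
  (Phi : C -> C) (z : C) : R :=
  (ln (abs_U N a m (Phi z)) - ln mu)%R.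

Definition level_curve (E : C -> Prop) (N : nat) (a : nat -> C)
  (m : nat -> R) (mu : R) (Phi : C -> C) (lambda : R) (z : C) : Prop :=
  ~ E z /\ green N a m mu Phi z = ln lambda.

Definition is_faber_walsh_polynomial (E : C -> Prop) (alpha : nat -> C)
  (k : nat) (b : C -> C) : Prop :=
  exists (N : nat) (a : nat -> C) (m : nat -> R) (mu : R) (Phi : C -> C),
    is_lemniscatic_map E N a m mu Phi /\
    admissible N a m alpha /\
    forall (lambda : R) (z : C),
      (1 < lambda)%R ->
      interior_of (level_curve E N a m mu Phi lambda) z ->
      is_contour_integral (level_curve E N a m mu Phi lambda)
        (fun zeta => u_poly alpha k (Phi zeta) / (zeta - z))
        (2 * PI * Ci * b z).

(* Main.v *)
Require Import Defs.
From Stdlib Require Import Reals List Lra Lia Classical ClassicalEpsilon FunctionalExtensionality.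
From Coquelicot Require Import Coquelicot.

Open Scope R_scope.
Open Scope C_scope.

(** Let [T = Phit o P], a holomorphic function outside [E = P^-1(Omega)] with
    [|T| > 1], and let [X = u_n o Phi], where [Phi] is the lemniscatic map of [E]
    and [u_n] is the product of the factors [w - alpha_j] over one period of the
    sequence of foci. The theorem follows from the identity

      [X = L T] near infinity, where [L = 1 / (alpha d)],

    because [u_(k n)(Phi) = X ^ k = L ^ k Phit(P) ^ k], and by definition
    [Phit ^ k = F + h], where [h] is a Laurent tail in [1 / z]. On a level curve
    far out, the polynomial [F o P] contributes [F(P(z))] by Cauchy's formula,
    and [h(P(y)) / (y - z) = O(1 / y ^ 2)] contributes nothing
    ([cauchy_formula_poly], [laurent_tail_integral]). The level parameter is free,
    so the curve may be taken where the Laurent expansion converges.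

    For the identity, the admissibility of the periodic sequence forces the
    exponents to be the frequencies of the foci within a period, so that
    [|X| = |U(Phi)| ^ n] ([Cmod_u_poly_period]). A conformal bijection is proper,
    hence [|T|] tends to [1] and [|X|] to [mu ^ n] at the boundary of [E]
    ([injective_proper]). The two functions have poles of the same order at
    infinity and no zeros. The maximum principle, applied to [X / T] and to
    [T / X], makes [|X / T|] constant; so [X / T] has derivative zero and equals
    its value [L] at infinity ([proportional_near_infinity]).

    Since differentiability is only assumed pointwise, the maximum principle and
    the open mapping property are derived from Goursat's theorem: a bisection
    argument ([square_induction], [goursat]), transported to annuli by the
    exponential function, gives the mean value property ([mean_value]). *)

(** * Complex differentiability *)

(** The derivative is taken in the normed module that [C] is over itself, where
    the product and chain rules of the general theory apply. *)
Definition Cderivable (f : C -> C) (z : C) : Prop :=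
  ex_derive (K := C_AbsRing) (V := AbsRing_NormedModule C_AbsRing) f z.

Lemma Cderivable_of_ex_derive (f : C -> C) (z : C) :
  ex_derive (K := C_AbsRing) (V := C_NormedModule) f z -> Cderivable f z.
Proof.
  intros [l [[Hp Hs Hn] Hd]]; exists l; split.
  - split; [exact Hp | exact Hs | exact Hn].
  - exact Hd.
Qed.

Definition has_Cderivative (f : C -> C) (z l : C) : Prop :=
  is_derive (K := C_AbsRing) (V := AbsRing_NormedModule C_AbsRing) f z l.

Lemma has_Cderivative_eps (f : C -> C) (z l : C) :
  has_Cderivative f z l <->
  forall eps, (0 < eps)%R -> exists delta, (0 < delta)%R /\
    forall y, (Cmod (y - z) < delta)%R ->
      (Cmod (f y - f z - l * (y - z)) <= eps * Cmod (y - z))%R.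
Proof.
  split.
  - intros [_ Hd] eps Heps.
    destruct (Hd z (fun P H => H) (mkposreal eps Heps)) as [delta Hdelta].
    exists delta; split; [apply cond_pos |].
    intros y Hy; specialize (Hdelta y Hy).
    change (Cmod ((f y - f z) - (y - z) * l) <= eps * Cmod (y - z))%R in Hdelta.
    now rewrite (Cmult_comm l).
  - intros Hl; split.
    + apply (is_linear_scal_l (K := C_AbsRing) (V := AbsRing_NormedModule C_AbsRing)).
    + intros x Hx eps.
      rewrite <- (is_filter_lim_locally_unique _ _ Hx).
      destruct (Hl eps (cond_pos eps)) as [delta [Hd H]].
      exists (mkposreal delta Hd); intros y Hy; specialize (H y Hy).
      change (Cmod ((f y - f z) - (y - z) * l) <= eps * Cmod (y - z))%R.
      now rewrite (Cmult_comm _ l).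
Qed.

Lemma Cderivable_eps (f : C -> C) (z : C) :
  Cderivable f z <->
  exists l, forall eps, (0 < eps)%R -> exists delta, (0 < delta)%R /\
    forall y, (Cmod (y - z) < delta)%R ->
      (Cmod (f y - f z - l * (y - z)) <= eps * Cmod (y - z))%R.
Proof.
  split; intros [l Hl]; exists l; now apply has_Cderivative_eps.
Qed.

Lemma Cderivable_const (c z : C) : Cderivable (fun _ => c) z.
Proof. apply ex_derive_const. Qed.

Lemma Cderivable_id (z : C) : Cderivable (fun y => y) z.
Proof. apply ex_derive_id. Qed.

Lemma Cderivable_plus (f g : C -> C) (z : C) :
  Cderivable f z -> Cderivable g z -> Cderivable (fun y => f y + g y) z.
Proof. apply (ex_derive_plus (V := AbsRing_NormedModule C_AbsRing)). Qed.

Lemma Cderivable_minus (f g : C -> C) (z : C) :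
  Cderivable f z -> Cderivable g z -> Cderivable (fun y => f y - g y) z.
Proof. apply (ex_derive_minus (V := AbsRing_NormedModule C_AbsRing)). Qed.

Lemma Cderivable_mult (f g : C -> C) (z : C) :
  Cderivable f z -> Cderivable g z -> Cderivable (fun y => f y * g y) z.
Proof.
  intros [a Ha] [b Hb].
  eexists.
  apply (is_derive_mult (K := C_AbsRing) f g z a b Ha Hb Cmult_comm).
Qed.

Lemma Cderivable_comp (f g : C -> C) (z : C) :
  Cderivable f (g z) -> Cderivable g z -> Cderivable (fun y => f (g y)) z.
Proof. apply (ex_derive_comp (V := AbsRing_NormedModule C_AbsRing)). Qed.

Lemma Cderivable_pow (f : C -> C) (k : nat) (z : C) :
  Cderivable f z -> Cderivable (fun y => f y ^ k) z.
Proof.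
  intros Hf; induction k as [|k IH]; simpl.
  - apply Cderivable_const.
  - now apply Cderivable_mult.
Qed.

Lemma Cmod_triangle_minus (x y : C) : (Cmod (x - y) <= Cmod x + Cmod y)%R.
Proof. unfold Cminus; rewrite <- (Cmod_opp y); apply Cmod_triangle. Qed.

Lemma Cmod_minus_sym (x y : C) : Cmod (x - y) = Cmod (y - x).
Proof. now rewrite <- Cmod_opp, Copp_minus_distr. Qed.

Lemma Cmod_reverse_triangle (x y : C) : (Cmod x - Cmod y <= Cmod (x - y))%R.
Proof.
  generalize (Cmod_triangle (x - y) y).
  replace (x - y + y) with x by ring; lra.
Qed.

Lemma has_Cderivative_inv (z : C) : z <> 0 -> has_Cderivative Cinv z (- / (z * z)).
Proof.
  intros Hz; apply has_Cderivative_eps; intros eps Heps.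
  assert (Hm := proj1 (Cmod_gt_0 z) Hz).
  set (m := Cmod z) in *.
  exists (Rmin (m / 2) (eps * m ^ 3 / 2)); split.
  { apply Rmin_glb_lt; [lra |].
    assert (0 < m ^ 3)%R by now apply pow_lt.
    assert (0 < eps * m ^ 3)%R by now apply Rmult_lt_0_compat.
    lra. }
  intros y Hy.
  assert (Hy1 : (Cmod (y - z) < m / 2)%R) by (eapply Rlt_le_trans; [exact Hy | apply Rmin_l]).
  assert (Hy2 : (Cmod (y - z) < eps * m ^ 3 / 2)%R) by (eapply Rlt_le_trans; [exact Hy | apply Rmin_r]).
  assert (Hly : (m / 2 <= Cmod y)%R).
  { generalize (Cmod_reverse_triangle z y); rewrite Cmod_minus_sym; fold m; lra. }
  assert (Hy0 : y <> 0) by (apply Cmod_gt_0; lra).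
  replace (/ y - / z - - / (z * z) * (y - z))
    with ((y - z) * ((y - z) * / (z * z * y))) by (field; auto).
  rewrite Cmod_mult, Rmult_comm.
  apply Rmult_le_compat_r; [apply Cmod_ge_0 |].
  assert (Hzzy : z * z * y <> 0) by (repeat apply Cmult_neq_0; auto).
  rewrite Cmod_mult, Cmod_inv, !Cmod_mult by exact Hzzy.
  fold m.
  apply (Rmult_le_reg_r (m * m * Cmod y)).
  { apply Rmult_lt_0_compat; [apply Rmult_lt_0_compat; lra | lra]. }
  rewrite Rmult_assoc, Rinv_l, Rmult_1_r.
  2: { apply Rgt_not_eq. apply Rmult_lt_0_compat; [apply Rmult_lt_0_compat; lra | lra]. }
  apply Rlt_le, Rlt_le_trans with (1 := Hy2).
  replace (eps * m ^ 3 / 2)%R with ((eps * (m * m)) * (m / 2))%R by field.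
  replace (eps * (m * m * Cmod y))%R with ((eps * (m * m)) * Cmod y)%R by ring.
  apply Rmult_le_compat_l; [| exact Hly].
  apply Rlt_le; repeat apply Rmult_lt_0_compat; lra.
Qed.

Lemma Cderivable_inv (f : C -> C) (z : C) :
  Cderivable f z -> f z <> 0 -> Cderivable (fun y => / f y) z.
Proof.
  intros Hf H0; apply (Cderivable_comp Cinv f); [| exact Hf].
  eexists; now apply has_Cderivative_inv.
Qed.

Lemma Cderivable_div (f g : C -> C) (z : C) :
  Cderivable f z -> Cderivable g z -> g z <> 0 -> Cderivable (fun y => f y / g y) z.
Proof. intros Hf Hg H0; apply Cderivable_mult; [exact Hf | now apply Cderivable_inv]. Qed.

(** * Limits and open sets of the plane through the modulus *)

Definition Ccontinuous (f : C -> C) (z : C) : Prop :=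
  forall eps, (0 < eps)%R -> exists delta, (0 < delta)%R /\
    forall y, (Cmod (y - z) < delta)%R -> (Cmod (f y - f z) < eps)%R.

Lemma locally_Cmod (z : C) (Q : C -> Prop) :
  locally z Q <->
  exists delta, (0 < delta)%R /\ forall y, (Cmod (y - z) < delta)%R -> Q y.
Proof.
  rewrite locally_C; split.
  - intros [d Hd]; exists d; split; [apply cond_pos | exact Hd].
  - intros [d [Hd H]]; exists (mkposreal d Hd); exact H.
Qed.

Lemma Ccontinuous_continuous (f : C -> C) (z : C) :
  Ccontinuous f z -> continuous f z.
Proof.
  intros Hf Q HQ.
  apply locally_Cmod in HQ; destruct HQ as [e [He HQ]].
  destruct (Hf e He) as [d [Hd H]].
  apply locally_Cmod; exists d; split; [exact Hd |].
  intros y Hy; apply HQ, H, Hy.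
Qed.

Lemma open_Cmod (U : C -> Prop) :
  open U <-> forall z, U z -> exists delta, (0 < delta)%R /\
    forall y, (Cmod (y - z) < delta)%R -> U y.
Proof.
  split; intros H z Hz.
  - apply locally_Cmod, H, Hz.
  - apply locally_Cmod, H, Hz.
Qed.

Lemma Cderivable_continuous (f : C -> C) (z : C) :
  Cderivable f z -> Ccontinuous f z.
Proof.
  intros Hf eps Heps.
  apply Cderivable_eps in Hf; destruct Hf as [l Hl].
  destruct (Hl 1%R Rlt_0_1) as [d [Hd H]].
  assert (Hl0 := Cmod_ge_0 l).
  exists (Rmin d (eps / (2 + Cmod l))); split.
  { apply Rmin_glb_lt; [exact Hd | apply Rdiv_lt_0_compat; lra]. }
  intros y Hy.
  assert (Hy1 : (Cmod (y - z) < d)%R) by (eapply Rlt_le_trans; [exact Hy | apply Rmin_l]).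
  assert (Hy2 : (Cmod (y - z) < eps / (2 + Cmod l))%R) by (eapply Rlt_le_trans; [exact Hy | apply Rmin_r]).
  specialize (H y Hy1).
  replace (f y - f z) with ((f y - f z - l * (y - z)) + l * (y - z)) by ring.
  eapply Rle_lt_trans; [apply Cmod_triangle |].
  rewrite Cmod_mult.
  apply (Rmult_lt_compat_r (2 + Cmod l)) in Hy2; [| lra].
  unfold Rdiv in Hy2; rewrite Rmult_assoc, Rinv_l, Rmult_1_r in Hy2 by lra.
  generalize (Cmod_ge_0 (y - z)); nra.
Qed.

Lemma Ccontinuous_Cmod (f : C -> C) (z : C) (eps : R) :
  Ccontinuous f z -> (0 < eps)%R -> exists delta, (0 < delta)%R /\
    forall y, (Cmod (y - z) < delta)%R -> (Rabs (Cmod (f y) - Cmod (f z)) < eps)%R.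
Proof.
  intros Hf Heps; destruct (Hf eps Heps) as [d [Hd H]].
  exists d; split; [exact Hd |]; intros y Hy; specialize (H y Hy).
  generalize (Cmod_reverse_triangle (f y) (f z)) (Cmod_reverse_triangle (f z) (f y)).
  rewrite (Cmod_minus_sym (f z)); intros; apply Rabs_def1; lra.
Qed.

(** * Bisection of squares *)

(** Were [Q] false for one square, it would be false for one of its quarters,
    and so on; the nested squares shrink to a point, near which [Q] holds. The
    lemma stands for the compactness of the square and proves both Goursat's
    theorem and the extreme value theorem. *)
Lemma square_induction (Q : R -> R -> R -> Prop) :
  (forall x y s, (0 < s)%R ->
     Q x y (s / 2)%R -> Q (x + s / 2)%R y (s / 2)%R ->
     Q x (y + s / 2)%R (s / 2)%R -> Q (x + s / 2)%R (y + s / 2)%R (s / 2)%R ->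
     Q x y s) ->
  (forall a b, exists delta, (0 < delta)%R /\
     forall x y s, (0 < s < delta)%R -> (x <= a <= x + s)%R -> (y <= b <= y + s)%R ->
       Q x y s) ->
  forall x y s, (0 < s)%R -> Q x y s.
Proof.
  intros Hquarter Hlocal x y s Hs.
  apply NNPP; intros Hnot.
  set (bad := fun p : R * R * R => (0 < snd p)%R /\ ~ Q (fst (fst p)) (snd (fst p)) (snd p)).
  set (sub := fun p q : R * R * R =>
    (fst (fst p) <= fst (fst q) <= fst (fst p) + snd p / 2)%R /\
    (snd (fst p) <= snd (fst q) <= snd (fst p) + snd p / 2)%R /\
    snd q = (snd p / 2)%R).
  assert (Hstep : forall p, bad p -> exists q, bad q /\ sub p q).
  { intros [[a b] t] [Ht HQ]; simpl in Ht, HQ.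
    apply NNPP; intros Hno; apply HQ.
    apply Hquarter; [exact Ht | | | |]; apply NNPP; intros HQ'; apply Hno;
      [exists (a, b, t / 2)%R | exists (a + t / 2, b, t / 2)%R
       | exists (a, b + t / 2, t / 2)%R | exists (a + t / 2, b + t / 2, t / 2)%R];
      (split; [split; simpl; [lra | exact HQ'] | unfold sub; simpl; lra]). }
  set (next := fun p => match excluded_middle_informative (bad p) with
    | left H => proj1_sig (constructive_indefinite_description _ (Hstep p H))
    | right _ => p end).
  set (p := fix p (m : nat) := match m with O => (x, y, s) | S m => next (p m) end).
  assert (Hbad : forall m, bad (p m)).
  { intros m; induction m as [|m IH]; simpl; [split; [exact Hs | exact Hnot] |].
    unfold next; destruct excluded_middle_informative as [H|H]; [| contradiction].
    destruct constructive_indefinite_description as [q [Hq1 Hq2]]; exact Hq1. }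
  assert (Hsub : forall m, sub (p m) (p (S m))).
  { intros m; simpl; unfold next.
    destruct excluded_middle_informative as [H|H]; [| destruct (H (Hbad m))].
    destruct constructive_indefinite_description as [q [Hq1 Hq2]]; exact Hq2. }
  assert (Hsize : forall m, snd (p m) = (s * (/ 2) ^ m)%R).
  { intros m; induction m as [|m IH]; [simpl; ring |].
    destruct (Hsub m) as [_ [_ ->]]; rewrite IH; simpl; field. }
  assert (Hmono : forall c : R * R * R -> R,
    (forall q q', sub q q' -> (c q <= c q' <= c q + snd q / 2)%R) ->
    exists l, forall m, (c (p m) <= l <= c (p m) + snd (p m))%R).
  { intros c Hc.
    assert (Hle : forall m j, (c (p m) <= c (p (j + m)%nat) /\
                   c (p (j + m)%nat) + snd (p (j + m)%nat) <= c (p m) + snd (p m))%R).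
    { intros m j; induction j as [|j IH]; [split; apply Rle_refl | change (S j + m)%nat with (S (j + m))].
      generalize (Hc _ _ (Hsub (j + m)%nat)).
      destruct (Hsub (j + m)%nat) as [_ [_ H]]; rewrite H.
      lra. }
    assert (Hub : forall m j, (c (p j) <= c (p m) + snd (p m))%R).
    { intros m j; destruct (Nat.le_ge_cases m j) as [H|H].
      - replace j with ((j - m) + m)%nat by lia.
        destruct (Hle m (j - m)%nat) as [H1 H2].
        destruct (Hbad (j - m + m)%nat) as [H3 _]; lra.
      - replace m with ((m - j) + j)%nat by lia.
        destruct (Hle j (m - j)%nat) as [H1 H2].
        destruct (Hbad (m - j + j)%nat) as [H3 _]; lra. }
    destruct (completeness (fun r => exists m, r = c (p m))) as [l [Hl1 Hl2]].
    - exists (c (p 0%nat) + snd (p 0%nat))%R; intros r [m ->]; apply Hub.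
    - exists (c (p 0%nat)), 0%nat; reflexivity.
    - exists l; intros m; split; [apply Hl1; now exists m |].
      apply Hl2; intros r [j ->]; apply Hub. }
  destruct (Hmono (fun q => fst (fst q))) as [a Ha]; [now intros q q' [H _] |].
  destruct (Hmono (fun q => snd (fst q))) as [b Hb]; [now intros q q' [_ [H _]] |].
  destruct (Hlocal a b) as [delta [Hdelta H]].
  destruct (pow_lt_1_zero (/ 2)) with (y := (delta / s)%R) as [m Hm].
  { rewrite Rabs_pos_eq; lra. }
  { now apply Rdiv_lt_0_compat. }
  destruct (Hbad m) as [Hpos HQ]; apply HQ, H; [split; [exact Hpos |] | apply Ha | apply Hb].
  rewrite Hsize.
  specialize (Hm m (Nat.le_refl m)); rewrite Rabs_pos_eq in Hm by (apply pow_le; lra).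
  apply (Rmult_lt_compat_l s) in Hm; [| exact Hs].
  replace (s * (delta / s))%R with delta in Hm by (field; lra).
  exact Hm.
Qed.
(** * Complex-valued integrals *)

Notation CInt f a b := (RInt (V := C_R_CompleteNormedModule) f a b : C).

Lemma norm_C_R (z : C) : norm (V := C_R_NormedModule) z = Cmod z.
Proof. symmetry; apply Cmod_norm. Qed.

Lemma Cmod_le_Rabs (a b : R) : (Cmod (a, b) <= Rabs a + Rabs b)%R.
Proof.
  replace (a, b) with (RtoC a + Ci * RtoC b) by (unfold RtoC, Ci, Cplus, Cmult; simpl; f_equal; ring).
  eapply Rle_trans; [apply Cmod_triangle |].
  rewrite Cmod_mult, Cmod_Ci, !Cmod_R; lra.
Qed.

Lemma CInt_bound (f : R -> C) (a b M : R) :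
  (a <= b)%R -> ex_RInt (V := C_R_NormedModule) f a b ->
  (forall t, (a <= t <= b)%R -> (Cmod (f t) <= M)%R) ->
  (Cmod (CInt f a b) <= (b - a) * M)%R.
Proof.
  intros Hab Hf HM; rewrite <- norm_C_R.
  apply (norm_RInt_le_const (V := C_R_NormedModule) f a b); [exact Hab | |].
  - intros t Ht; rewrite norm_C_R; now apply HM.
  - apply (RInt_correct (V := C_R_CompleteNormedModule)), Hf.
Qed.

Lemma ex_CInt_continuous (f : R -> C) (a b : R) :
  (a <= b)%R -> (forall t, (a <= t <= b)%R -> continuous f t) ->
  ex_RInt (V := C_R_NormedModule) f a b.
Proof.
  intros Hab Hf; apply (ex_RInt_continuous (V := C_R_CompleteNormedModule)).
  rewrite Rmin_left, Rmax_right by exact Hab; exact Hf.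
Qed.

Lemma CInt_ext (f g : R -> C) (a b : R) :
  (a <= b)%R -> (forall t, (a <= t <= b)%R -> f t = g t) -> CInt f a b = CInt g a b.
Proof.
  intros Hab Hfg; apply (RInt_ext (V := C_R_CompleteNormedModule)).
  rewrite Rmin_left, Rmax_right by exact Hab; intros t Ht; apply Hfg; lra.
Qed.

Lemma CInt_plus (f g : R -> C) (a b : R) :
  ex_RInt (V := C_R_NormedModule) f a b -> ex_RInt (V := C_R_NormedModule) g a b ->
  CInt (fun t => f t + g t) a b = CInt f a b + CInt g a b.
Proof. apply (RInt_plus (V := C_R_CompleteNormedModule)). Qed.

Lemma CInt_minus (f g : R -> C) (a b : R) :
  ex_RInt (V := C_R_NormedModule) f a b -> ex_RInt (V := C_R_NormedModule) g a b ->
  CInt (fun t => f t - g t) a b = CInt f a b - CInt g a b.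
Proof. apply (RInt_minus (V := C_R_CompleteNormedModule)). Qed.

Lemma CInt_Chasles (f : R -> C) (a b c : R) :
  ex_RInt (V := C_R_NormedModule) f a b -> ex_RInt (V := C_R_NormedModule) f b c ->
  CInt f a b + CInt f b c = CInt f a c.
Proof. apply (RInt_Chasles (V := C_R_CompleteNormedModule)). Qed.

Lemma CInt_shift (f : R -> C) (a b c : R) :
  ex_RInt (V := C_R_NormedModule) f (a + c) (b + c) ->
  CInt (fun t => f (t + c)%R) a b = CInt f (a + c) (b + c).
Proof.
  intros Hf.
  assert (H := RInt_comp_lin (V := C_R_CompleteNormedModule) f 1 c a b).
  rewrite !Rmult_1_l in H; rewrite <- (H Hf).
  apply (RInt_ext (V := C_R_CompleteNormedModule)); intros t _.
  rewrite Rmult_1_l; symmetry; apply (scal_one (V := C_R_ModuleSpace)).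
Qed.

Lemma continuous_pair_R (u v : R -> R) (t : R) :
  continuous u t -> continuous v t -> continuous (fun s => (u s, v s) : C) t.
Proof.
  intros Hu Hv; apply filterlim_locally; intros eps.
  generalize (proj1 (filterlim_locally u (u t)) Hu eps)
             (proj1 (filterlim_locally v (v t)) Hv eps); intros H1 H2.
  generalize (filter_and _ _ H1 H2); apply filter_imp.
  intros s [H3 H4]; split; assumption.
Qed.

Lemma continuous_Re (f : R -> C) (t : R) : continuous f t -> continuous (fun s => fst (f s)) t.
Proof. intros Hf; apply (continuous_comp f fst); [exact Hf | apply continuous_fst]. Qed.

Lemma continuous_Im (f : R -> C) (t : R) : continuous f t -> continuous (fun s => snd (f s)) t.
Proof. intros Hf; apply (continuous_comp f snd); [exact Hf | apply continuous_snd]. Qed.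

Lemma continuous_Cplus (f g : R -> C) (t : R) :
  continuous f t -> continuous g t -> continuous (fun s => f s + g s) t.
Proof. apply (continuous_plus (V := C_R_NormedModule)). Qed.

Lemma continuous_Cminus (f g : R -> C) (t : R) :
  continuous f t -> continuous g t -> continuous (fun s => f s - g s) t.
Proof. apply (continuous_minus (V := C_R_NormedModule)). Qed.

Lemma continuous_Cmult (f g : R -> C) (t : R) :
  continuous f t -> continuous g t -> continuous (fun s => f s * g s) t.
Proof.
  intros Hf Hg.
  assert (H1 := continuous_Re _ _ Hf); assert (H2 := continuous_Im _ _ Hf).
  assert (H3 := continuous_Re _ _ Hg); assert (H4 := continuous_Im _ _ Hg).
  apply continuous_pair_R.
  - apply (continuous_minus (V := R_NormedModule));
      apply (continuous_mult (K := R_AbsRing)); assumption.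
  - apply (continuous_plus (V := R_NormedModule));
      apply (continuous_mult (K := R_AbsRing)); assumption.
Qed.

Lemma continuous_Ccomp (f : C -> C) (c : R -> C) (t : R) :
  Ccontinuous f (c t) -> continuous c t -> continuous (fun s => f (c s)) t.
Proof.
  intros Hf Hc; apply (continuous_comp c f); [exact Hc | now apply Ccontinuous_continuous].
Qed.

Lemma CInt_Cmult (c : C) (f : R -> C) (a b : R) :
  ex_RInt (V := C_R_NormedModule) f a b ->
  is_RInt (V := C_R_NormedModule) (fun t => c * f t) a b (c * CInt f a b).
Proof.
  intros Hf; apply (RInt_correct (V := C_R_CompleteNormedModule)) in Hf.
  assert (H1 := is_RInt_fct_extend_fst (U := R_NormedModule) (V := R_NormedModule) _ _ _ _ Hf).
  assert (H2 := is_RInt_fct_extend_snd (U := R_NormedModule) (V := R_NormedModule) _ _ _ _ Hf).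
  apply (is_RInt_fct_extend_pair (U := R_NormedModule) (V := R_NormedModule)); simpl.
  - apply (is_RInt_minus (V := R_NormedModule));
      apply (is_RInt_scal (V := R_NormedModule)); assumption.
  - apply (is_RInt_plus (V := R_NormedModule));
      apply (is_RInt_scal (V := R_NormedModule)); assumption.
Qed.

(** * Goursat's theorem and the mean value property *)

(** The integral of this density over [t] in [[0, s]] is the integral of [g]
    along the positively oriented boundary of the square with lower left corner
    [(x, y)] and side [s]. With all four sides folded onto one parameter
    interval, the contributions of the inner sides cancel pointwise when the
    square is cut into quarters. *)
Definition boundary_density (g : C -> C) (x y s t : R) : C :=
  (g (x + t, y)%R - g (x + t, y + s)%R)
  + Ci * (g (x + s, y + t)%R - g (x, y + t)%R).

Definition derivable_on_square (g : C -> C) (x y s : R) : Prop :=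
  forall a b, (x <= a <= x + s)%R -> (y <= b <= y + s)%R -> Cderivable g (a, b).

Lemma boundary_density_continuous (g : C -> C) (x y s t : R) :
  derivable_on_square g x y s -> (0 <= t <= s)%R ->
  continuous (boundary_density g x y s) t.
Proof.
  intros Hg Ht.
  assert (Hshift : forall r, continuous (fun t => (r + t)%R) t).
  { intros r; apply (continuous_plus (V := R_NormedModule)); [apply continuous_const | apply continuous_id]. }
  assert (Hcurve : forall u v : R -> R, continuous u t -> continuous v t ->
    (x <= u t <= x + s)%R -> (y <= v t <= y + s)%R -> continuous (fun t => g (u t, v t)) t).
  { intros u v Hu Hv H1 H2.
    apply (continuous_Ccomp g (fun t => (u t, v t)));
      [apply Cderivable_continuous, Hg; assumption | now apply continuous_pair_R]. }
  unfold boundary_density.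
  apply continuous_Cplus; [| apply continuous_Cmult; [apply continuous_const |]];
    apply continuous_Cminus;
    (apply Hcurve; [try apply Hshift; apply continuous_const | try apply Hshift; apply continuous_const | lra | lra]).
Qed.

(** Subtracting from [g] its linear part at a point of a small square of side
    [s] leaves a remainder of order [eps * s] on a boundary of length [4 * s];
    the resulting bound [8 * eps * s ^ 2] is additive under quartering. *)
Theorem goursat (g : C -> C) (x y s : R) :
  (0 < s)%R -> derivable_on_square g x y s -> CInt (boundary_density g x y s) 0 s = 0.
Proof.
  intros Hs Hg; apply Cmod_eq_0, Rle_antisym; [| apply Cmod_ge_0].
  apply Rnot_lt_le; intros Hpos.
  set (J := Cmod (CInt (boundary_density g x y s) 0 s)) in *.
  set (eps := (J / (16 * (s * s)))%R).
  assert (Heps : (0 < eps)%R).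
  { apply Rdiv_lt_0_compat; [exact Hpos | nra]. }
  enough (H : (J <= 8 * eps * (s * s))%R).
  { replace (8 * eps * (s * s))%R with (J / 2)%R in H by (unfold eps; field; lra); lra. }
  unfold J; clearbody eps; clear J Hpos.
  apply (square_induction (fun a b r => derivable_on_square g a b r ->
    (Cmod (CInt (boundary_density g a b r) 0 r) <= 8 * eps * (r * r))%R)); [| | exact Hs | exact Hg].
  - clear - Heps. intros x y s Hs H00 H10 H01 H11 Hg.
    set (h := (s / 2)%R) in *.
    assert (Hsub : forall a b, (x <= a <= x + h)%R -> (y <= b <= y + h)%R ->
      derivable_on_square g a b h).
    { intros a b Ha Hb c d Hc Hd; apply Hg; unfold h in *; lra. }
    assert (G00 : derivable_on_square g x y h) by (apply Hsub; unfold h; lra).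
    assert (G10 : derivable_on_square g (x + h) y h) by (apply Hsub; unfold h; lra).
    assert (G01 : derivable_on_square g x (y + h) h) by (apply Hsub; unfold h; lra).
    assert (G11 : derivable_on_square g (x + h) (y + h) h) by (apply Hsub; unfold h; lra).
    specialize (H00 G00); specialize (H10 G10); specialize (H01 G01); specialize (H11 G11).
    assert (Hh : (0 < h)%R) by (unfold h; lra).
    assert (Hint : forall a b, derivable_on_square g a b h ->
      ex_RInt (V := C_R_NormedModule) (boundary_density g a b h) 0 h).
    { intros a b Hab; apply ex_CInt_continuous; [lra |].
      intros t Ht; now apply boundary_density_continuous. }
    assert (Hsum : CInt (boundary_density g x y s) 0 s =
      CInt (boundary_density g x y h) 0 h + CInt (boundary_density g (x + h) y h) 0 h
      + (CInt (boundary_density g x (y + h) h) 0 h + CInt (boundary_density g (x + h) (y + h) h) 0 h)).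
    { assert (Hall : forall a b, (0 <= a)%R -> (a <= b)%R -> (b <= s)%R ->
        ex_RInt (V := C_R_NormedModule) (boundary_density g x y s) a b).
      { intros a b Ha Hab Hb; apply ex_CInt_continuous; [lra |].
        intros t Ht; apply boundary_density_continuous; [exact Hg | lra]. }
      rewrite <- (CInt_Chasles _ 0 h s) by (apply Hall; unfold h; lra).
      assert (Hshift : CInt (boundary_density g x y s) h s =
        CInt (fun t => boundary_density g x y s (t + h)%R) 0 h).
      { assert (Hhs : s = (h + h)%R) by (unfold h; field).
        rewrite CInt_shift, Rplus_0_l, <- Hhs; [reflexivity |].
        rewrite Rplus_0_l, <- Hhs; apply Hall; lra. }
      rewrite Hshift.
      assert (Hshift' : ex_RInt (V := C_R_NormedModule) (fun t => boundary_density g x y s (t + h)%R) 0 h).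
      { apply ex_CInt_continuous; [lra |]; intros t Ht.
        apply (continuous_comp (fun t => (t + h)%R) (boundary_density g x y s)).
        - apply (continuous_plus (V := R_NormedModule)); [apply continuous_id | apply continuous_const].
        - apply boundary_density_continuous; [exact Hg | unfold h in *; lra]. }
      assert (Hhs : (h <= s)%R) by (unfold h; lra).
      assert (Hplus : forall f g, ex_RInt (V := C_R_NormedModule) f 0 h ->
        ex_RInt (V := C_R_NormedModule) g 0 h ->
        ex_RInt (V := C_R_NormedModule) (fun t => f t + g t) 0 h)
        by (intros f1 f2; apply (ex_RInt_plus (V := C_R_NormedModule))).
      rewrite <- (CInt_plus (boundary_density g x y h) (boundary_density g (x + h) y h)),
        <- (CInt_plus (boundary_density g x (y + h) h) (boundary_density g (x + h) (y + h) h)),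
        <- (CInt_plus (boundary_density g x y s) (fun t => boundary_density g x y s (t + h)%R)),
        <- CInt_plus by (auto; apply Hall; lra).
      apply CInt_ext; [lra |]; intros t _; unfold boundary_density.
      replace (y + h + h)%R with (y + s)%R by (unfold h; field).
      replace (x + h + h)%R with (x + s)%R by (unfold h; field).
      replace (x + h + t)%R with (x + (t + h))%R by ring.
      replace (y + h + t)%R with (y + (t + h))%R by ring.
      ring. }
    rewrite Hsum.
    replace (8 * eps * (s * s))%R with (4 * (8 * eps * (h * h)))%R by (unfold h; field).
    eapply Rle_trans; [apply Cmod_triangle |].
    eapply Rle_trans; [apply Rplus_le_compat; apply Cmod_triangle |].
    lra.
  - intros a b.
    destruct (classic (Cderivable g (a, b))) as [Hab | Hab].
    + destruct (proj1 (Cderivable_eps g (a, b)) Hab) as [l Hl].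
      destruct (Hl eps Heps) as [d [Hd H]].
      exists (d / 2)%R; split; [lra |].
      intros x' y' r Hr Ha' Hb' Hg'.
      set (rem := fun p => g p - g (a, b) - l * (p - (a, b))).
      assert (Hrem : forall u v, (x' <= u <= x' + r)%R -> (y' <= v <= y' + r)%R ->
        (Cmod (rem (u, v)) <= eps * (2 * r))%R).
      { intros u v Hu Hv.
        assert (Hdist : (Cmod ((u, v) - (a, b)) <= 2 * r)%R).
        { unfold Cminus, Cplus, Copp; simpl.
          eapply Rle_trans; [apply Cmod_le_Rabs |].
          assert (Rabs (u + - a) <= r)%R by (apply Rabs_le; lra).
          assert (Rabs (v + - b) <= r)%R by (apply Rabs_le; lra).
          lra. }
        eapply Rle_trans; [apply H; lra |].
        apply Rmult_le_compat_l; lra. }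
      eapply Rle_trans; [apply (CInt_bound _ 0 r (8 * eps * r)) |].
      * lra.
      * apply ex_CInt_continuous; [lra |]; intros t Ht; now apply boundary_density_continuous.
      * intros t Ht.
        replace (boundary_density g x' y' r t) with
          ((rem (x' + t, y')%R - rem (x' + t, y' + r)%R)
            + Ci * (rem (x' + r, y' + t)%R - rem (x', y' + t)%R)).
        2: { unfold boundary_density, rem.
             replace (x' + t, y' + r)%R with ((x' + t, y')%R + Ci * RtoC r)
               by (unfold Ci, RtoC, Cmult, Cplus; simpl; f_equal; ring).
             replace (x' + r, y' + t)%R with ((x', y' + t)%R + RtoC r)
               by (unfold RtoC, Cplus; simpl; f_equal; ring).
             ring. }
        eapply Rle_trans; [apply Cmod_triangle |].
        rewrite Cmod_mult, Cmod_Ci, Rmult_1_l.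
        eapply Rle_trans; [apply Rplus_le_compat; apply Cmod_triangle_minus |].
        assert (H1 := Hrem (x' + t)%R y'); assert (H2 := Hrem (x' + t)%R (y' + r)%R).
        assert (H3 := Hrem (x' + r)%R (y' + t)%R); assert (H4 := Hrem x' (y' + t)%R).
        lra.
      * apply Req_le; ring.
    + exists 1%R; split; [lra |]; intros x' y' r Hr Ha' Hb' Hg'.
      destruct Hab; now apply Hg'.
Qed.

Definition Cexp (z : C) : C := RtoC (exp (fst z)) * (cos (snd z), sin (snd z)).

Lemma Cexp_plus (z w : C) : Cexp (z + w) = Cexp z * Cexp w.
Proof.
  unfold Cexp, Cplus, Cmult, RtoC; simpl.
  rewrite exp_plus, cos_plus, sin_plus; f_equal; ring.
Qed.

Lemma Cmod_cos_sin (t : R) : Cmod (cos t, sin t) = 1%R.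
Proof.
  unfold Cmod; simpl.
  replace (cos t * (cos t * 1) + sin t * (sin t * 1))%R with (Rsqr (sin t) + Rsqr (cos t))%R
    by (unfold Rsqr; ring).
  rewrite sin2_cos2; apply sqrt_1.
Qed.

Lemma Cmod_Cexp (z : C) : Cmod (Cexp z) = exp (fst z).
Proof.
  unfold Cexp; rewrite Cmod_mult, Cmod_cos_sin, Cmod_R, Rabs_pos_eq, Rmult_1_r;
    [reflexivity | apply Rlt_le, exp_pos].
Qed.

Lemma derivable_pt_lim_0_linear (f : R -> R) (l eps : R) :
  derivable_pt_lim f 0 l -> (0 < eps)%R -> exists delta, (0 < delta)%R /\
    forall h, (Rabs h < delta)%R -> (Rabs (f h - f 0 - l * h) <= eps * Rabs h)%R.
Proof.
  intros Hf Heps; destruct (Hf eps Heps) as [d Hd].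
  exists d; split; [apply cond_pos |]; intros h Hh.
  destruct (Req_dec h 0) as [-> | H0].
  - replace (f 0 - f 0 - l * 0)%R with 0%R by ring; rewrite Rabs_R0; lra.
  - specialize (Hd h H0 Hh); rewrite Rplus_0_l in Hd.
    replace (f h - f 0 - l * h)%R with (((f h - f 0) / h - l) * h)%R by (field; exact H0).
    rewrite Rabs_mult; apply Rmult_le_compat_r; [apply Rabs_pos | lra].
Qed.

Lemma Cexp_at_0 (eps : R) :
  (0 < eps)%R -> exists delta, (0 < delta)%R /\
    forall h, (Cmod h < delta)%R -> (Cmod (Cexp h - 1 - h) <= eps * Cmod h)%R.
Proof.
  intros Heps.
  set (e := Rmin 1 (eps / 7)).
  assert (He : (0 < e)%R) by (apply Rmin_glb_lt; lra).
  assert (He1 : (e <= 1)%R) by apply Rmin_l.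
  assert (He7 : (7 * e <= eps)%R) by (generalize (Rmin_r 1 (eps / 7)); fold e; lra).
  clearbody e.
  assert (Dexp := derivable_pt_lim_exp 0); rewrite exp_0 in Dexp.
  assert (Dcos := derivable_pt_lim_cos 0); rewrite sin_0, Ropp_0 in Dcos.
  assert (Dsin := derivable_pt_lim_sin 0); rewrite cos_0 in Dsin.
  destruct (derivable_pt_lim_0_linear _ _ _ Dexp He) as [d1 [Hd1 H1]].
  destruct (derivable_pt_lim_0_linear _ _ _ Dcos He) as [d2 [Hd2 H2]].
  destruct (derivable_pt_lim_0_linear _ _ _ Dsin He) as [d3 [Hd3 H3]].
  exists (Rmin (Rmin d1 d2) (Rmin d3 e)); split; [repeat apply Rmin_glb_lt; assumption |].
  intros [x y] Hh.
  assert (Hxy := Rmax_Cmod (x, y)); simpl in Hxy.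
  assert (Hx := Rle_trans _ _ _ (Rmax_l _ _) Hxy).
  assert (Hy := Rle_trans _ _ _ (Rmax_r _ _) Hxy).
  assert (Hmin := Rmin_l (Rmin d1 d2) (Rmin d3 e)).
  assert (Hmin' := Rmin_r (Rmin d1 d2) (Rmin d3 e)).
  generalize (Rmin_l d1 d2) (Rmin_r d1 d2) (Rmin_l d3 e) (Rmin_r d3 e); intros M1 M2 M3 M4.
  specialize (H1 x ltac:(lra)); specialize (H2 y ltac:(lra)); specialize (H3 y ltac:(lra)).
  rewrite exp_0 in H1; rewrite cos_0 in H2; rewrite sin_0 in H3.
  assert (Hxe : (Rabs x <= e)%R) by lra.
  set (a := (exp x - 1 - 1 * x)%R) in *; set (b := (cos y - 1 - 0 * y)%R) in *;
    set (c := (sin y - 0 - 1 * y)%R) in *.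
  replace (Cexp (x, y) - 1 - (x, y))
    with ((a * cos y + (1 + x) * b)%R, ((1 + x) * c + x * y + a * sin y)%R)
    by (unfold Cexp, Cminus, Copp, Cplus, Cmult, RtoC, a, b, c; simpl; f_equal; ring).
  assert (Hcos : (Rabs (cos y) <= 1)%R) by (apply Rabs_le, COS_bound).
  assert (Hsin : (Rabs (sin y) <= 1)%R) by (apply Rabs_le, SIN_bound).
  assert (H1x : (Rabs (1 + x) <= 2)%R).
  { eapply Rle_trans; [apply Rabs_triang |]; rewrite Rabs_R1; lra. }
  eapply Rle_trans; [apply Cmod_le_Rabs |].
  assert (T1 := Rabs_triang (a * cos y) ((1 + x) * b)).
  assert (T2 := Rabs_triang ((1 + x) * c + x * y) (a * sin y)).
  assert (T3 := Rabs_triang ((1 + x) * c) (x * y)).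
  rewrite (Rabs_mult a), (Rabs_mult (1 + x)) in T1.
  rewrite (Rabs_mult a) in T2.
  rewrite (Rabs_mult (1 + x)), (Rabs_mult x) in T3.
  generalize (Rabs_pos a) (Rabs_pos b) (Rabs_pos c) (Rabs_pos x) (Rabs_pos y); intros.
  assert (K1 : (Rabs a * Rabs (cos y) <= e * Rabs x)%R) by (generalize (Rabs_pos (cos y)); nra).
  assert (K2 : (Rabs (1 + x) * Rabs b <= 2 * (e * Rabs y))%R) by (generalize (Rabs_pos (1 + x)); nra).
  assert (K3 : (Rabs (1 + x) * Rabs c <= 2 * (e * Rabs y))%R) by (generalize (Rabs_pos (1 + x)); nra).
  assert (K4 : (Rabs x * Rabs y <= e * Rabs y)%R) by nra.
  assert (K5 : (Rabs a * Rabs (sin y) <= e * Rabs x)%R) by (generalize (Rabs_pos (sin y)); nra).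
  assert (K6 : (e * Rabs x <= e * Cmod (x, y))%R) by (apply Rmult_le_compat_l; lra).
  assert (K7 : (e * Rabs y <= e * Cmod (x, y))%R) by (apply Rmult_le_compat_l; lra).
  assert (K8 : (7 * e * Cmod (x, y) <= eps * Cmod (x, y))%R)
    by (apply Rmult_le_compat_r; [apply Cmod_ge_0 | exact He7]).
  lra.
Qed.

Lemma Cderivable_Cexp (z : C) : Cderivable Cexp z.
Proof.
  apply Cderivable_eps; exists (Cexp z); intros eps Heps.
  assert (Hz : (0 < Cmod (Cexp z))%R) by (rewrite Cmod_Cexp; apply exp_pos).
  destruct (Cexp_at_0 (eps / Cmod (Cexp z))) as [d [Hd H]]; [now apply Rdiv_lt_0_compat |].
  exists d; split; [exact Hd |]; intros y Hy; specialize (H _ Hy).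
  replace (Cexp y) with (Cexp z * Cexp (y - z)) by (rewrite <- Cexp_plus; f_equal; ring).
  replace (Cexp z * Cexp (y - z) - Cexp z - Cexp z * (y - z))
    with (Cexp z * (Cexp (y - z) - 1 - (y - z))) by ring.
  rewrite Cmod_mult.
  apply (Rmult_le_compat_l (Cmod (Cexp z))) in H; [| lra].
  eapply Rle_trans; [exact H | apply Req_le; field; lra].
Qed.

Definition circle (z : C) (r t : R) : C := z + RtoC r * (cos t, sin t).

Lemma circle_dist (z : C) (r t : R) : (0 <= r)%R -> Cmod (circle z r t - z) = r.
Proof.
  intros Hr; unfold circle; replace (z + r * (cos t, sin t) - z) with (r * (cos t, sin t)) by ring.
  rewrite Cmod_mult, Cmod_cos_sin, Cmod_R, Rabs_pos_eq; [ring | exact Hr].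
Qed.

Lemma circle_continuous (z : C) (r t : R) : continuous (circle z r) t.
Proof.
  apply continuous_Cplus; [apply continuous_const |].
  apply continuous_Cmult; [apply continuous_const |].
  apply (continuous_pair_R cos sin); [apply continuous_cos | apply continuous_sin].
Qed.

Definition derivable_on_disc (f : C -> C) (z : C) (r : R) : Prop :=
  forall y, (Cmod (y - z) <= r)%R -> Cderivable f y.

Lemma continuous_on_circle (f : C -> C) (z : C) (r t : R) :
  (0 <= r)%R -> derivable_on_disc f z r -> continuous (fun t => f (circle z r t)) t.
Proof.
  intros Hr Hf; apply (continuous_Ccomp f (circle z r)); [| apply circle_continuous].
  apply Cderivable_continuous, Hf; rewrite circle_dist; lra.
Qed.

Lemma ex_CInt_circle (f : C -> C) (z : C) (r a b : R) :
  (0 <= r)%R -> (a <= b)%R -> derivable_on_disc f z r ->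
  ex_RInt (V := C_R_NormedModule) (fun t => f (circle z r t)) a b.
Proof.
  intros Hr Hab Hf; apply ex_CInt_continuous; [exact Hab |].
  intros t _; now apply continuous_on_circle.
Qed.

(** In the coordinate [zeta] with [y = z + exp zeta], the annulus between the
    radii [r exp (- 2 PI)] and [r] becomes a square with side [2 PI], whose
    horizontal sides cancel by periodicity. *)
Lemma circle_mean_contract (f : C -> C) (z : C) (r : R) :
  (0 < r)%R -> derivable_on_disc f z r ->
  CInt (fun t => f (circle z r t)) 0 (2 * PI) =
  CInt (fun t => f (circle z (r * exp (- (2 * PI))) t)) 0 (2 * PI).
Proof.
  intros Hr Hf.
  assert (HPI : (0 < 2 * PI)%R) by (generalize PI_RGT_0; lra).
  assert (Hq : (0 < exp (- (2 * PI)) < 1)%R).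
  { split; [apply exp_pos |]; rewrite <- exp_0; apply exp_increasing; lra. }
  set (q := exp (- (2 * PI))) in *.
  set (x := (ln r - 2 * PI)%R).
  set (g := fun zeta => f (z + Cexp zeta)).
  assert (Hg : derivable_on_square g x 0 (2 * PI)).
  { intros a b Ha _.
    apply (Cderivable_comp f (fun zeta => z + Cexp zeta)).
    - apply Hf; replace (z + Cexp (a, b) - z) with (Cexp (a, b)) by ring.
      rewrite Cmod_Cexp; simpl; rewrite <- (exp_ln r Hr).
      destruct (Req_dec a (ln r)) as [-> | Hne]; [lra |].
      apply Rlt_le, exp_increasing; unfold x in Ha; lra.
    - apply Cderivable_plus; [apply Cderivable_const | apply Cderivable_Cexp]. }
  assert (HJ := goursat g x 0 (2 * PI) HPI Hg).
  assert (Hcirc : forall rho t, (0 < rho)%R -> g (ln rho, t) = f (circle z rho t)).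
  { intros rho t Hrho; unfold g, circle, Cexp; simpl; now rewrite exp_ln. }
  rewrite (CInt_ext _ (fun t => Ci * (f (circle z r t) - f (circle z (r * q) t)))) in HJ; [| lra |].
  2: { intros t _; unfold boundary_density.
       replace (g (x + t, 0 + 2 * PI)%R) with (g (x + t, 0)%R).
       2: { unfold g, Cexp; simpl; rewrite Rplus_0_l, sin_2PI, cos_2PI, sin_0, cos_0; reflexivity. }
       rewrite !Rplus_0_l.
       replace (x + 2 * PI)%R with (ln r) by (unfold x; ring).
       replace x with (ln (r * q)).
       2: { unfold x, q; rewrite ln_mult, ln_exp; [ring | exact Hr | apply exp_pos]. }
       rewrite !Hcirc by nra; ring. }
  assert (Hdisc : derivable_on_disc f z (r * q)) by (intros y Hy; apply Hf; nra).
  assert (E1 := ex_CInt_circle f z r 0 (2 * PI) ltac:(lra) ltac:(lra) Hf).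
  assert (E2 := ex_CInt_circle f z (r * q) 0 (2 * PI) ltac:(nra) ltac:(lra) Hdisc).
  assert (E3 : ex_RInt (V := C_R_NormedModule)
    (fun t => f (circle z r t) - f (circle z (r * q) t)) 0 (2 * PI))
    by exact (ex_RInt_minus (V := C_R_NormedModule) _ _ _ _ E1 E2).
  assert (HJ' := eq_trans (eq_sym (is_RInt_unique (V := C_R_CompleteNormedModule) _ _ _ _
    (CInt_Cmult Ci _ _ _ E3))) HJ); clear HJ; rename HJ' into HJ.
  rewrite (CInt_minus _ _ _ _ E1 E2) in HJ.
  apply Ceq_minus.
  destruct (Ceq_dec (CInt (fun t => f (circle z r t)) 0 (2 * PI)
    - CInt (fun t => f (circle z (r * q) t)) 0 (2 * PI)) 0) as [E | E]; [exact E |].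
  now destruct (Cmult_neq_0 _ _ Ci_nz E).
Qed.

Lemma CInt_const (c : C) (a b : R) : CInt (fun _ => c) a b = RtoC (b - a) * c.
Proof.
  rewrite <- scal_R_Cmult; apply (RInt_const (V := C_R_CompleteNormedModule)).
Qed.

(** The mean over the circle of radius [r] is the mean over arbitrarily small
    circles, which tends to the value at the centre by continuity. *)
Theorem mean_value (f : C -> C) (z : C) (r : R) :
  (0 < r)%R -> derivable_on_disc f z r ->
  CInt (fun t => f (circle z r t)) 0 (2 * PI) = RtoC (2 * PI) * f z.
Proof.
  intros Hr Hf.
  assert (HPI : (0 < 2 * PI)%R) by (generalize PI_RGT_0; lra).
  assert (Hq : (0 < exp (- (2 * PI)) < 1)%R).
  { split; [apply exp_pos |]; rewrite <- exp_0; apply exp_increasing; lra. }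
  set (q := exp (- (2 * PI))) in *.
  assert (Hqm : forall m, (0 < q ^ m <= 1)%R).
  { intros m; split; [apply pow_lt; lra |].
    rewrite <- (pow1 m); apply pow_incr; lra. }
  assert (Hdisc : forall m, derivable_on_disc f z (r * q ^ m)).
  { intros m y Hy; apply Hf; specialize (Hqm m); nra. }
  assert (Hiter : forall m, CInt (fun t => f (circle z r t)) 0 (2 * PI) =
    CInt (fun t => f (circle z (r * q ^ m) t)) 0 (2 * PI)).
  { intros m; induction m as [|m IH]; [now rewrite Rmult_1_r |].
    rewrite IH, circle_mean_contract; [| specialize (Hqm m); nra | apply Hdisc].
    fold q; replace (r * q ^ m * q)%R with (r * q ^ S m)%R by (simpl; ring); reflexivity. }
  apply Ceq_minus, Cmod_eq_0, Rle_antisym; [| apply Cmod_ge_0].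
  apply Rnot_lt_le; intros Hpos.
  set (e := Cmod _) in Hpos.
  destruct (Cderivable_continuous f z) with (eps := (e / (4 * PI))%R) as [d [Hd H]].
  { apply Hf; replace (z - z) with (RtoC 0) by ring; rewrite Cmod_0; lra. }
  { apply Rdiv_lt_0_compat; lra. }
  destruct (pow_lt_1_zero q) with (y := (d / r)%R) as [m Hm];
    [rewrite Rabs_pos_eq; lra | now apply Rdiv_lt_0_compat |].
  specialize (Hm m (Nat.le_refl m)); rewrite Rabs_pos_eq in Hm by (apply Rlt_le, Hqm).
  assert (Hrm : (0 < r * q ^ m < d)%R).
  { specialize (Hqm m); split; [nra |].
    apply (Rmult_lt_compat_l r) in Hm; [| exact Hr].
    replace (r * (d / r))%R with d in Hm by (field; lra); exact Hm. }
  assert (Hle : (e <= (2 * PI - 0) * (e / (4 * PI)))%R).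
  { unfold e at 1; rewrite (Hiter m).
    replace (RtoC (2 * PI) * f z) with (CInt (fun _ => f z) 0 (2 * PI))
      by (rewrite CInt_const; f_equal; f_equal; ring).
    assert (E1 := ex_CInt_circle f z (r * q ^ m) 0 (2 * PI) ltac:(lra) ltac:(lra) (Hdisc m)).
    assert (E2 := ex_RInt_const (V := C_R_NormedModule) 0 (2 * PI) (f z)).
    rewrite <- (CInt_minus _ _ _ _ E1 E2).
    apply CInt_bound; [lra | now apply (ex_RInt_minus (V := C_R_NormedModule)) |].
    intros t _; apply Rlt_le, H; rewrite circle_dist; lra. }
  replace ((2 * PI - 0) * (e / (4 * PI)))%R with (e / 2)%R in Hle by (field; lra).
  lra.
Qed.

(** * Compactness and the maximum principle *)

Definition closed_set (A : C -> Prop) : Prop :=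
  forall z, ~ A z -> exists delta, (0 < delta)%R /\ forall y, (Cmod (y - z) < delta)%R -> ~ A y.

Lemma square_diameter (a b x y s u v : R) :
  (x <= a <= x + s)%R -> (y <= b <= y + s)%R ->
  (x <= u <= x + s)%R -> (y <= v <= y + s)%R -> (Cmod ((u, v) - (a, b)) <= 2 * s)%R.
Proof.
  intros Ha Hb Hu Hv; unfold Cminus, Cplus, Copp; simpl.
  eapply Rle_trans; [apply Cmod_le_Rabs |].
  assert (Rabs (u + - a) <= s)%R by (apply Rabs_le; lra).
  assert (Rabs (v + - b) <= s)%R by (apply Rabs_le; lra).
  lra.
Qed.

(** If no value were maximal, each point of [T] would have a neighbourhood
    dominated by a single larger value, and so would every square. *)
Lemma extreme_value (T : C -> Prop) (phi : C -> R) :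
  closed_set T -> bounded_set T -> (exists z, T z) ->
  (forall z, T z -> forall eps, (0 < eps)%R -> exists delta, (0 < delta)%R /\
     forall y, (Cmod (y - z) < delta)%R -> (phi y < phi z + eps)%R) ->
  exists z, T z /\ forall y, T y -> (phi y <= phi z)%R.
Proof.
  intros Hclosed [M HM] [w Hw] Hphi.
  apply NNPP; intros Hno.
  assert (Hbig : forall z, T z -> exists y, T y /\ (phi z < phi y)%R).
  { intros z Hz; apply NNPP; intros H; apply Hno; exists z; split; [exact Hz |].
    intros y Hy; apply Rnot_lt_le; intros Hlt; apply H; now exists y. }
  set (Q := fun x y s : R => exists z, T z /\ forall u v, T (u, v) ->
    (x <= u <= x + s)%R -> (y <= v <= y + s)%R -> (phi (u, v) < phi z)%R).
  assert (HQ : forall x y s, (0 < s)%R -> Q x y s).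
  { apply square_induction.
    - intros x y s Hs [z1 [T1 H1]] [z2 [T2 H2]] [z3 [T3 H3]] [z4 [T4 H4]].
      assert (Hmax : forall p q, T p -> T q -> exists r, T r /\ (phi p <= phi r)%R /\ (phi q <= phi r)%R).
      { intros p q Hp Hq; destruct (Rle_lt_dec (phi p) (phi q)); [exists q | exists p];
          repeat split; auto; lra. }
      destruct (Hmax _ _ T1 T2) as [p [Tp [Hp1 Hp2]]].
      destruct (Hmax _ _ T3 T4) as [q [Tq [Hq3 Hq4]]].
      destruct (Hmax _ _ Tp Tq) as [r [Tr [Hr1 Hr2]]].
      exists r; split; [exact Tr |]; intros u v Huv Hu Hv.
      destruct (Rle_lt_dec u (x + s / 2)); destruct (Rle_lt_dec v (y + s / 2)).
      + eapply Rlt_le_trans; [apply (H1 u v Huv); lra | lra].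
      + eapply Rlt_le_trans; [apply (H3 u v Huv); lra | lra].
      + eapply Rlt_le_trans; [apply (H2 u v Huv); lra | lra].
      + eapply Rlt_le_trans; [apply (H4 u v Huv); lra | lra].
    - intros a b; destruct (classic (T (a, b))) as [Hab | Hab].
      + destruct (Hbig _ Hab) as [z [Hz Hlt]].
        destruct (Hphi _ Hab (phi z - phi (a, b))%R) as [d [Hd H]]; [lra |].
        exists (d / 2)%R; split; [lra |]; intros x y s Hs Hx Hy.
        exists z; split; [exact Hz |]; intros u v Huv Hu Hv.
        assert (Hdist := square_diameter a b x y s u v Hx Hy Hu Hv).
        specialize (H (u, v) ltac:(lra)); lra.
      + destruct (Hclosed _ Hab) as [d [Hd H]].
        exists (d / 2)%R; split; [lra |]; intros x y s Hs Hx Hy.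
        exists w; split; [exact Hw |]; intros u v Huv Hu Hv.
        destruct (H (u, v)); [| exact Huv].
        generalize (square_diameter a b x y s u v Hx Hy Hu Hv); lra. }
  assert (HM0 : (0 <= M)%R) by (eapply Rle_trans; [apply Cmod_ge_0 | apply (HM w Hw)]).
  destruct (HQ (- M - 1)%R (- M - 1)%R (2 * M + 2)%R) as [[u v] [Tz H]]; [lra |].
  assert (Hb := Rle_trans _ _ _ (Rmax_Cmod (u, v)) (HM _ Tz)); simpl in Hb.
  generalize (Rmax_l (Rabs u) (Rabs v)) (Rmax_r (Rabs u) (Rabs v)); intros.
  assert (Hu := proj1 (Rabs_le_between u M) ltac:(lra)).
  assert (Hv := proj1 (Rabs_le_between v M) ltac:(lra)).
  apply (Rlt_irrefl (phi (u, v))), H; [exact Tz | lra | lra].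
Qed.

Lemma Cmod_center_le (f : C -> C) (z : C) (r M : R) :
  (0 < r)%R -> derivable_on_disc f z r ->
  (forall y, Cmod (y - z) = r -> (Cmod (f y) <= M)%R) -> (Cmod (f z) <= M)%R.
Proof.
  intros Hr Hf HM.
  assert (HPI : (0 < 2 * PI)%R) by (generalize PI_RGT_0; lra).
  assert (H := CInt_bound (fun t => f (circle z r t)) 0 (2 * PI) M ltac:(lra)
    (ex_CInt_circle f z r 0 (2 * PI) ltac:(lra) ltac:(lra) Hf)
    (fun t _ => HM _ (circle_dist z r t ltac:(lra)))).
  rewrite mean_value, Cmod_mult, Cmod_R, Rabs_pos_eq, Rminus_0_r in H by (auto; lra).
  now apply (Rmult_le_reg_l (2 * PI)).
Qed.

(** Were the modulus smaller at one point of the circle, it would be smaller on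
    an arc, and the mean over the circle would be too small. *)
Lemma Cmod_max_spreads (f : C -> C) (z : C) (r : R) :
  (0 < r)%R -> derivable_on_disc f z r ->
  (forall y, Cmod (y - z) = r -> (Cmod (f y) <= Cmod (f z))%R) ->
  Cmod (f (z + RtoC r)) = Cmod (f z).
Proof.
  intros Hr Hf Hmax.
  assert (HPI := PI_RGT_0).
  assert (Hcirc : forall t, Cmod (circle z r t - z) = r) by (intros t; apply circle_dist; lra).
  assert (H0 : z + RtoC r = circle z r 0).
  { unfold circle; rewrite cos_0, sin_0; change (1%R, 0%R) with (RtoC 1); ring. }
  rewrite H0; apply Rle_antisym; [apply Hmax, Hcirc |].
  apply Rnot_lt_le; intros Hlt.
  set (s := Cmod (f z)) in *.
  set (k := ((s - Cmod (f (circle z r 0))) / 2)%R).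
  assert (Hk : (0 < k)%R) by (unfold k; lra).
  destruct (Ccontinuous_Cmod f (circle z r 0) k) as [d1 [Hd1 H1]];
    [apply Cderivable_continuous, Hf; rewrite Hcirc; lra | exact Hk |].
  destruct (proj1 (filterlim_locally _ _) (circle_continuous z r 0)
    (mkposreal (d1 / 2) ltac:(lra))) as [d2 H2].
  set (eta := Rmin (d2 / 2) PI).
  assert (Heta : (0 < eta <= PI)%R).
  { split; [apply Rmin_glb_lt; [generalize (cond_pos d2); lra | exact HPI] | apply Rmin_r]. }
  assert (Hsmall : forall t, (0 <= t <= eta)%R -> (Cmod (f (circle z r t)) <= s - k)%R).
  { intros t Ht.
    assert (Hball : ball 0%R d2 t).
    { change (Rabs (t - 0) < d2)%R; rewrite Rminus_0_r, Rabs_pos_eq by lra.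
      generalize (Rmin_l (d2 / 2) PI) (cond_pos d2); fold eta; lra. }
    destruct (H2 t Hball) as [Hb1 Hb2].
    change (Rabs (fst (circle z r t) - fst (circle z r 0)) < d1 / 2)%R in Hb1.
    change (Rabs (snd (circle z r t) - snd (circle z r 0)) < d1 / 2)%R in Hb2.
    specialize (H1 (circle z r t)).
    assert (Hd : (Cmod (circle z r t - circle z r 0) < d1)%R).
    { eapply Rle_lt_trans; [apply Cmod_le_Rabs |].
      unfold Rminus in Hb1, Hb2; simpl in *; lra. }
    specialize (H1 Hd); apply Rabs_def2 in H1; unfold k in *; lra. }
  assert (Hint : forall a b, (a <= b)%R ->
    ex_RInt (V := C_R_NormedModule) (fun t => f (circle z r t)) a b)
    by (intros a b Hab; apply ex_CInt_circle; auto; lra).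
  assert (HM := mean_value f z r Hr Hf).
  rewrite <- (CInt_Chasles _ 0 eta (2 * PI)) in HM by (apply Hint; lra).
  assert (B1 := CInt_bound (fun t => f (circle z r t)) 0 eta (s - k) ltac:(lra)
    (Hint 0%R eta ltac:(lra)) Hsmall).
  assert (B2 := CInt_bound (fun t => f (circle z r t)) eta (2 * PI) s ltac:(lra)
    (Hint eta (2 * PI)%R ltac:(lra)) (fun t _ => Hmax _ (Hcirc t))).
  apply (f_equal Cmod) in HM.
  rewrite Cmod_mult, Cmod_R, Rabs_pos_eq in HM by lra; fold s in HM.
  assert (B3 := Cmod_triangle (CInt (fun t => f (circle z r t)) 0 eta)
                              (CInt (fun t => f (circle z r t)) eta (2 * PI))).
  nra.
Qed.

(** The form in which limits at the boundary of [A] are stated, for functions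
    that are meaningful only outside [A]. *)
Definition near_boundary (A Q : C -> Prop) : Prop :=
  forall e, A e -> exists delta, (0 < delta)%R /\
    forall z, ~ A z -> (Cmod (z - e) < delta)%R -> Q z.

Lemma closed_superlevel (A : C -> Prop) (f : C -> C) (c c' : R) :
  closed_set A -> (forall z, ~ A z -> Ccontinuous f z) -> (c' < c)%R ->
  near_boundary A (fun z => (Cmod (f z) <= c')%R) ->
  closed_set (fun z => ~ A z /\ (c <= Cmod (f z))%R).
Proof.
  intros HA Hf Hc Hnear z Hz.
  destruct (classic (A z)) as [HAz | HAz].
  - destruct (Hnear z HAz) as [d [Hd H]].
    exists d; split; [exact Hd |]; intros y Hy [HAy Hcy].
    specialize (H y HAy Hy); lra.
  - assert (Hlt : (Cmod (f z) < c)%R) by (apply Rnot_le_lt; intros H; apply Hz; split; assumption).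
    destruct (Ccontinuous_Cmod f z (c - Cmod (f z))) as [d [Hd H]]; [now apply Hf | lra |].
    exists d; split; [exact Hd |]; intros y Hy [_ Hcy].
    specialize (H y Hy); apply Rabs_def2 in H; lra.
Qed.

Lemma closed_set_disc (A : C -> Prop) (z : C) :
  closed_set A -> ~ A z -> exists r, (0 < r)%R /\ forall y, (Cmod (y - z) <= r)%R -> ~ A y.
Proof.
  intros HA Hz; destruct (HA z Hz) as [d [Hd H]].
  exists (d / 2)%R; split; [lra |]; intros y Hy; apply H; lra.
Qed.

(** Among the points where the modulus is maximal take one with the largest
    real part: the maximum spreads over circles, hence also further right. *)
Theorem maximum_principle (A : C -> Prop) (f : C -> C) (M : R) :
  closed_set A -> (forall z, ~ A z -> Cderivable f z) -> (0 <= M)%R ->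
  (forall eps, (0 < eps)%R -> near_boundary A (fun z => (Cmod (f z) <= M + eps)%R)) ->
  (forall eps, (0 < eps)%R -> C_infty (fun z => ~ A z -> (Cmod (f z) <= eps)%R)) ->
  forall z, ~ A z -> (Cmod (f z) <= M)%R.
Proof.
  intros HA Hf HM Hnear Hinf z1 Hz1.
  apply Rnot_lt_le; intros Hlt.
  set (T := fun c z => ~ A z /\ (c <= Cmod (f z))%R).
  assert (Hclosed : forall c, (M < c)%R -> closed_set (T c)).
  { intros c Hc; apply (closed_superlevel A f c (M + (c - M) / 2)); [exact HA | | lra |].
    - intros z Hz; now apply Cderivable_continuous, Hf.
    - apply Hnear; lra. }
  assert (Hbounded : forall c, (M < c)%R -> bounded_set (T c)).
  { intros c Hc; destruct (Hinf (c / 2)%R) as [R HR]; [lra |].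
    exists R; intros z [Hz Hcz]; apply Rnot_lt_le; intros H.
    specialize (HR z H Hz); lra. }
  destruct (extreme_value (T (Cmod (f z1))) (fun z => Cmod (f z))) as [z2 [[Hz2 H12] Hmax]].
  { now apply Hclosed. } { now apply Hbounded. } { exists z1; split; [exact Hz1 | lra]. }
  { intros z [Hz _] eps Heps.
    destruct (Ccontinuous_Cmod f z eps) as [d [Hd H]]; [now apply Cderivable_continuous, Hf | exact Heps |].
    exists d; split; [exact Hd |]; intros y Hy; specialize (H y Hy); apply Rabs_def2 in H; lra. }
  set (s := Cmod (f z2)) in *.
  assert (Htop : forall y, ~ A y -> (Cmod (f y) <= s)%R).
  { intros y Hy; apply Rnot_lt_le; intros H.
    assert (Hy' : T (Cmod (f z1)) y) by (split; [exact Hy | lra]).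
    specialize (Hmax y Hy'); lra. }
  destruct (extreme_value (T s) (fun z => fst z)) as [z3 [[Hz3 H3] Hright]].
  { apply Hclosed; lra. } { apply Hbounded; lra. } { exists z2; split; [exact Hz2 | unfold s; lra]. }
  { intros z _ eps Heps; exists eps; split; [exact Heps |]; intros y Hy.
    generalize (re_le_Cmod (y - z)) (Rle_abs (Re (y - z))).
    replace (Re (y - z)) with (fst y - fst z)%R by reflexivity; lra. }
  destruct (closed_set_disc A z3 HA Hz3) as [r [Hr Hdisc]].
  assert (Hfz3 : Cmod (f z3) = s) by (apply Rle_antisym; [now apply Htop | exact H3]).
  assert (Hnext : Cmod (f (z3 + RtoC r)) = s).
  { rewrite <- Hfz3; apply Cmod_max_spreads; [exact Hr | |].
    - intros y Hy; apply Hf, Hdisc, Hy.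
    - intros y Hy; rewrite Hfz3; apply Htop, Hdisc; lra. }
  assert (Hnext' : ~ A (z3 + RtoC r)).
  { apply Hdisc; replace (z3 + r - z3) with (RtoC r) by ring.
    rewrite Cmod_R, Rabs_pos_eq; lra. }
  specialize (Hright _ (conj Hnext' (Req_le _ _ (eq_sym Hnext)))).
  unfold RtoC in Hright; simpl in Hright; lra.
Qed.

(** * Open mapping and properness *)

(** If the value were omitted, the maximum principle would fail for
    [1 / (f - w)]. *)
Lemma value_in_disc (f : C -> C) (z w : C) (r delta : R) :
  (0 < r)%R -> derivable_on_disc f z r -> (Cmod (f z - w) < delta)%R ->
  (forall y, Cmod (y - z) = r -> (delta <= Cmod (f y - w))%R) ->
  exists y, (Cmod (y - z) <= r)%R /\ f y = w.
Proof.
  intros Hr Hf Hz Hcirc.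
  apply NNPP; intros Hno.
  assert (Hne : forall y, (Cmod (y - z) <= r)%R -> f y - w <> 0).
  { intros y Hy E; apply Hno; exists y; split; [exact Hy | now apply Ceq_minus]. }
  assert (Hz0 : f z - w <> 0).
  { apply Hne; replace (z - z) with (RtoC 0) by ring; rewrite Cmod_0; lra. }
  assert (Hpos := proj1 (Cmod_gt_0 _) Hz0).
  assert (H : (Cmod (/ (f z - w)) <= / delta)%R).
  { apply (Cmod_center_le (fun y => / (f y - w)) z r); [exact Hr | |].
    - intros y Hy; apply Cderivable_inv; [| now apply Hne].
      apply Cderivable_minus; [now apply Hf | apply Cderivable_const].
    - intros y Hy; rewrite Cmod_inv by (apply Hne; lra).
      apply Rinv_le_contravar; [lra | now apply Hcirc]. }
  rewrite Cmod_inv in H by exact Hz0.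
  assert (Hlt := Rinv_lt_contravar _ _ (Rmult_lt_0_compat _ _ Hpos (Rlt_trans _ _ _ Hpos Hz)) Hz).
  lra.
Qed.

(** The minimum of [|f(y) - f(z)|] on the circle, positive by injectivity,
    gives the radius of a disc of values that are taken. *)
Lemma injective_open (f : C -> C) (z : C) (r : R) :
  (0 < r)%R -> derivable_on_disc f z r ->
  (forall y, Cmod (y - z) = r -> f y <> f z) ->
  exists delta, (0 < delta)%R /\ forall w, (Cmod (w - f z) < delta)%R ->
    exists y, (Cmod (y - z) <= r)%R /\ f y = w.
Proof.
  intros Hr Hf Hinj.
  destruct (extreme_value (fun y => Cmod (y - z) = r) (fun y => - Cmod (f y - f z))%R)
    as [m [Hm Hmin]].
  - intros y Hy.
    exists (Rabs (Cmod (y - z) - r)); split; [apply Rabs_pos_lt; lra |].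
    intros y' Hy' E.
    generalize (Cmod_reverse_triangle (y' - z) (y - z)) (Cmod_reverse_triangle (y - z) (y' - z)).
    replace (y' - z - (y - z)) with (y' - y) by ring.
    replace (y - z - (y' - z)) with (y - y') by ring.
    rewrite (Cmod_minus_sym y y').
    revert Hy'; unfold Rabs; destruct Rcase_abs; lra.
  - exists (Cmod z + r)%R; intros y Hy.
    generalize (Cmod_reverse_triangle y z); lra.
  - exists (circle z r 0); apply circle_dist; lra.
  - intros y Hy eps Heps.
    destruct (Ccontinuous_Cmod (fun y => f y - f z) y eps) as [d [Hd H]]; [| exact Heps |].
    + apply Cderivable_continuous, Cderivable_minus; [apply Hf; lra | apply Cderivable_const].
    + exists d; split; [exact Hd |]; intros y' Hy'.
      specialize (H y' Hy'); apply Rabs_def2 in H; lra.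
  - assert (Hpos : (0 < Cmod (f m - f z))%R).
    { apply Cmod_gt_0; intros E; apply (Hinj m Hm); now apply Ceq_minus. }
    exists (Cmod (f m - f z) / 2)%R; split; [lra |]; intros w Hw.
    apply (value_in_disc f z w r (Cmod (f m - f z) / 2)); [exact Hr | exact Hf | |].
    + now rewrite Cmod_minus_sym.
    + intros y Hy; specialize (Hmin y Hy).
      generalize (Cmod_reverse_triangle (f y - f z) (w - f z)).
      replace (f y - f z - (w - f z)) with (f y - w) by ring; lra.
Qed.

Definition simple_pole (f : C -> C) (d : R) : Prop :=
  forall eps, (0 < eps)%R -> C_infty (fun z => (Cmod (f z - RtoC d * z) <= eps * Cmod z)%R).

(** A large [w] is taken in the disc of radius [|w| / (2 * d)] about [w / d],
    where [f] is close to the linear map [z |-> d * z]. *)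
Lemma covers_infinity (A : C -> Prop) (f : C -> C) (d : R) :
  bounded_set A -> (forall z, ~ A z -> Cderivable f z) -> (0 < d)%R -> simple_pole f d ->
  forall R, C_infty (fun w => exists z, ~ A z /\ (R < Cmod z)%R /\ f z = w).
Proof.
  intros [MA HMA] Hf Hd Hpole R.
  destruct (Hpole (d / 8)%R) as [M HM]; [lra |].
  set (B := Rmax 0 (Rmax (Rmax M MA) R)).
  exists (2 * d * B)%R; intros w Hw.
  assert (HB : (0 <= B /\ M <= B /\ MA <= B /\ R <= B)%R).
  { generalize (Rmax_l 0 (Rmax (Rmax M MA) R)) (Rmax_r 0 (Rmax (Rmax M MA) R))
      (Rmax_l (Rmax M MA) R) (Rmax_r (Rmax M MA) R) (Rmax_l M MA) (Rmax_r M MA).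
    fold B; lra. }
  set (z0 := w / RtoC d).
  assert (Hd0 : RtoC d <> 0) by (intros E; apply RtoC_inj in E; lra).
  assert (Hw0 : w = RtoC d * z0) by (unfold z0; field; exact Hd0).
  assert (Hwm : Cmod w = (d * Cmod z0)%R).
  { rewrite Hw0, Cmod_mult, Cmod_R, Rabs_pos_eq; lra. }
  assert (Hz0 : (2 * B < Cmod z0)%R) by (rewrite Hwm in Hw; nra).
  set (m := Cmod z0) in *.
  assert (Hdisc : forall z, (Cmod (z - z0) <= m / 2)%R -> (B < Cmod z <= 3 / 2 * m)%R).
  { intros z Hz; generalize (Cmod_reverse_triangle z0 z) (Cmod_reverse_triangle z z0).
    rewrite (Cmod_minus_sym z0 z); fold m; lra. }
  assert (HnA : forall z, (B < Cmod z)%R -> ~ A z).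
  { intros z Hz HAz; specialize (HMA z HAz); lra. }
  destruct (value_in_disc f z0 w (m / 2) (d * m / 4)) as [z [Hz E]].
  - lra.
  - intros z Hz; apply Hf, HnA; now apply Hdisc.
  - rewrite Hw0; specialize (HM z0 ltac:(fold m; lra)); fold m in HM; nra.
  - intros z Hz.
    assert (Hz' := Hdisc z ltac:(lra)).
    specialize (HM z ltac:(lra)).
    rewrite Hw0; generalize (Cmod_reverse_triangle (RtoC d * (z - z0)) (RtoC d * z - f z)).
    replace (d * (z - z0) - (d * z - f z)) with (f z - d * z0) by ring.
    rewrite (Cmod_minus_sym (d * z)), Cmod_mult, Cmod_R, Rabs_pos_eq, Hz by lra.
    nra.
  - exists z; specialize (Hdisc z Hz); split; [apply HnA; lra |]; split; [lra | exact E].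
Qed.

Lemma injective_large_values (A : C -> Prop) (f : C -> C) (d : R) :
  bounded_set A -> (forall z, ~ A z -> Cderivable f z) -> (0 < d)%R -> simple_pole f d ->
  (forall z1 z2, ~ A z1 -> ~ A z2 -> f z1 = f z2 -> z1 = z2) ->
  forall R, exists R', forall z, ~ A z -> (R' < Cmod (f z))%R -> (R < Cmod z)%R.
Proof.
  intros HA Hf Hd Hpole Hinj R.
  destruct (covers_infinity A f d HA Hf Hd Hpole R) as [R' HR'].
  exists R'; intros z Hz Hfz.
  destruct (HR' (f z) Hfz) as [z' [Hz' [HR E]]].
  now rewrite <- (Hinj z' z Hz' Hz E).
Qed.

(** A compact subset of the range is the image of a compact subset of the
    domain, because the inverse map is continuous by the open mapping property;
    the part of [K] near infinity comes from points near infinity. *)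
Lemma injective_proper (A K : C -> Prop) (f : C -> C) (d : R) :
  closed_set A -> bounded_set A -> (forall z, ~ A z -> Cderivable f z) ->
  (0 < d)%R -> simple_pole f d ->
  (forall z1 z2, ~ A z1 -> ~ A z2 -> f z1 = f z2 -> z1 = z2) ->
  closed_set K -> (forall w, K w -> exists z, ~ A z /\ f z = w) ->
  near_boundary A (fun z => ~ K (f z)).
Proof.
  intros HA HA' Hf Hd Hpole Hinj HK Hsurj e He.
  destruct (injective_large_values A f d HA' Hf Hd Hpole Hinj (Cmod e + 1)) as [B0 HR].
  set (Q := fun x y s : R => exists delta, (0 < delta)%R /\
    forall z, ~ A z -> (Cmod (z - e) < delta)%R -> K (f z) ->
      ~ ((x <= fst (f z) <= x + s)%R /\ (y <= snd (f z) <= y + s)%R)).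
  assert (HQ : forall x y s, (0 < s)%R -> Q x y s).
  { apply square_induction.
    - intros x y s Hs [d1 [Hd1 H1]] [d2 [Hd2 H2]] [d3 [Hd3 H3]] [d4 [Hd4 H4]].
      exists (Rmin (Rmin d1 d2) (Rmin d3 d4)); split; [repeat apply Rmin_glb_lt; assumption |].
      intros z Hz Hze HKz [Hx Hy].
      generalize (Rmin_l (Rmin d1 d2) (Rmin d3 d4)) (Rmin_r (Rmin d1 d2) (Rmin d3 d4))
        (Rmin_l d1 d2) (Rmin_r d1 d2) (Rmin_l d3 d4) (Rmin_r d3 d4); intros.
      destruct (Rle_lt_dec (fst (f z)) (x + s / 2)); destruct (Rle_lt_dec (snd (f z)) (y + s / 2)).
      + apply (H1 z Hz ltac:(lra) HKz); lra.
      + apply (H3 z Hz ltac:(lra) HKz); lra.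
      + apply (H2 z Hz ltac:(lra) HKz); lra.
      + apply (H4 z Hz ltac:(lra) HKz); lra.
    - intros a b; destruct (classic (K (a, b))) as [Hab | Hab].
      + destruct (Hsurj _ Hab) as [p [Hp Hfp]].
        destruct (closed_set_disc A p HA Hp) as [r0 [Hr0 Hdisc0]].
        assert (Hpe : (0 < Cmod (p - e))%R).
        { apply Cmod_gt_0; intros E; apply Hp; apply Ceq_minus in E; now rewrite E. }
        set (r := Rmin r0 (Cmod (p - e) / 2)).
        assert (Hr : (0 < r)%R) by (apply Rmin_glb_lt; lra).
        assert (Hr1 : (r <= r0)%R) by apply Rmin_l.
        assert (Hr2 : (r <= Cmod (p - e) / 2)%R) by apply Rmin_r.
        assert (Hdisc : forall y, (Cmod (y - p) <= r)%R -> ~ A y) by (intros y Hy; apply Hdisc0; lra).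
        destruct (injective_open f p r Hr) as [d0 [Hd0 Hopen]].
        { intros y Hy; apply Hf, Hdisc, Hy. }
        { intros y Hy E; apply Hinj in E; [| apply Hdisc; lra | exact Hp].
          rewrite E in Hy; replace (p - p) with (RtoC 0) in Hy by ring; rewrite Cmod_0 in Hy; lra. }
        exists (d0 / 2)%R; split; [lra |]; intros x y s Hs Hx Hy.
        exists (Cmod (p - e) / 2)%R; split; [lra |]; intros z Hz Hze _ [Hu Hv].
        assert (Hdist := square_diameter a b x y s (fst (f z)) (snd (f z)) Hx Hy Hu Hv).
        rewrite <- surjective_pairing in Hdist.
        destruct (Hopen (f z)) as [z' [Hz' E]]; [rewrite Hfp; lra |].
        apply Hinj in E; [| now apply Hdisc | exact Hz].
        rewrite E in Hz'.
        generalize (Cmod_triangle (p - z) (z - e)).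
        replace (p - z + (z - e)) with (p - e) by ring.
        rewrite (Cmod_minus_sym p z); lra.
      + destruct (HK _ Hab) as [d0 [Hd0 Hfar]].
        exists (d0 / 2)%R; split; [lra |]; intros x y s Hs Hx Hy.
        exists 1%R; split; [lra |]; intros z Hz _ HKz [Hu Hv].
        assert (Hdist := square_diameter a b x y s (fst (f z)) (snd (f z)) Hx Hy Hu Hv).
        rewrite <- surjective_pairing in Hdist.
        apply (Hfar (f z)); [lra | exact HKz]. }
  assert (HR1 : (B0 <= Rmax B0 0)%R) by apply Rmax_l.
  assert (HR2 : (0 <= Rmax B0 0)%R) by apply Rmax_r.
  set (B := Rmax B0 0) in *.
  destruct (HQ (- B - 1)%R (- B - 1)%R (2 * B + 2)%R) as [d1 [Hd1 H1]]; [lra |].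
  exists (Rmin d1 1); split; [apply Rmin_glb_lt; lra |].
  intros z Hz Hze HKz.
  assert (Hz1 := Rlt_le_trans _ _ _ Hze (Rmin_l _ _)).
  assert (Hz2 := Rlt_le_trans _ _ _ Hze (Rmin_r _ _)).
  apply (H1 z Hz Hz1 HKz).
  assert (Hfz : (Cmod (f z) <= B0)%R).
  { apply Rnot_lt_le; intros H; specialize (HR z Hz H).
    generalize (Cmod_reverse_triangle z e); lra. }
  assert (Hb := Rmax_Cmod (f z)).
  generalize (Rmax_l (Rabs (fst (f z))) (Rabs (snd (f z)))) (Rmax_r (Rabs (fst (f z))) (Rabs (snd (f z)))); intros.
  assert (Hu := proj1 (Rabs_le_between (fst (f z)) B) ltac:(lra)).
  assert (Hv := proj1 (Rabs_le_between (snd (f z)) B) ltac:(lra)).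
  lra.
Qed.

(** * Functions with the same boundary modulus *)

Lemma C_infty_and (Q1 Q2 : C -> Prop) :
  C_infty Q1 -> C_infty Q2 -> C_infty (fun z => Q1 z /\ Q2 z).
Proof.
  intros [M1 H1] [M2 H2]; exists (Rmax M1 M2); intros z Hz.
  generalize (Rmax_l M1 M2) (Rmax_r M1 M2); intros.
  split; [apply H1 | apply H2]; lra.
Qed.

Lemma C_infty_imp (Q1 Q2 : C -> Prop) :
  (forall z, Q1 z -> Q2 z) -> C_infty Q1 -> C_infty Q2.
Proof. intros H [M HM]; exists M; intros z Hz; now apply H, HM. Qed.

Lemma C_infty_outside (A : C -> Prop) : bounded_set A -> C_infty (fun z => ~ A z).
Proof.
  intros [M HM]; exists M; intros z Hz HAz; specialize (HM z HAz); lra.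
Qed.

(** The quotient [X / Y] is only bounded at infinity, which the maximum
    principle does not tolerate. It is therefore applied to
    [X ^ q / Y ^ (q + 1)], which tends to [0] because [Y] has a pole; the extra
    factor [Y] disappears on taking [q]-th roots as [q] grows. *)
Lemma Cmod_quotient_le (A : C -> Prop) (X Y : C -> C) (x y c : R) :
  closed_set A -> (forall z, ~ A z -> Cderivable X z) -> (forall z, ~ A z -> Cderivable Y z) ->
  (0 < x)%R -> (0 < y)%R ->
  (forall x', (x < x')%R -> near_boundary A (fun z => (Cmod (X z) <= x')%R)) ->
  (forall z, ~ A z -> (y <= Cmod (Y z))%R) ->
  C_infty (fun z => (Cmod (X z) <= c * Cmod (Y z))%R) ->
  (forall B, C_infty (fun z => (B <= Cmod (Y z))%R)) ->
  forall z, ~ A z -> (y * Cmod (X z) <= x * Cmod (Y z))%R.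
Proof.
  intros HA HX HY Hx Hy HXb HYb Hc HYinf z Hz.
  assert (HYpos : forall z, ~ A z -> (0 < Cmod (Y z))%R) by (intros w Hw; specialize (HYb w Hw); lra).
  assert (HY0 : forall z, ~ A z -> Y z <> 0) by (intros w Hw; apply Cmod_gt_0; auto).
  assert (Hmod : forall q w, ~ A w ->
    Cmod (X w ^ q / Y w ^ S q) = (Cmod (X w) ^ q / Cmod (Y w) ^ S q)%R).
  { intros q w Hw; rewrite Cmod_div by (apply Cpow_nz, HY0, Hw); now rewrite !Cmod_pow. }
  assert (Hpow : forall x' q, (x < x')%R ->
    (Cmod (X z) ^ q / Cmod (Y z) ^ S q <= x' ^ q / y ^ S q)%R).
  { intros x' q Hx'; rewrite <- Hmod by exact Hz.
    apply (maximum_principle A (fun w => X w ^ q / Y w ^ S q)); [exact HA | | | | | exact Hz].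
    - intros w Hw; apply Cderivable_div;
        [apply Cderivable_pow; auto | apply Cderivable_pow; auto | apply Cpow_nz, HY0, Hw].
    - apply Rlt_le, Rdiv_lt_0_compat; apply pow_lt; lra.
    - intros eps Heps e He; destruct (HXb x' Hx' e He) as [d [Hd H]].
      exists d; split; [exact Hd |]; intros w Hw Hwe; specialize (H w Hw Hwe).
      rewrite Hmod by exact Hw.
      apply Rle_trans with (x' ^ q / y ^ S q)%R; [| lra].
      apply Rmult_le_compat.
      + apply pow_le, Cmod_ge_0.
      + apply Rlt_le, Rinv_0_lt_compat, pow_lt; auto.
      + apply pow_incr; split; [apply Cmod_ge_0 | exact H].
      + apply Rinv_le_contravar; [now apply pow_lt |].
        apply pow_incr; split; [lra | auto].
    - intros eps Heps.
      set (c' := Rmax c 0).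
      assert (Hc' : (0 <= c')%R) by apply Rmax_r.
      assert (Hcc : (c <= c')%R) by apply Rmax_l.
      generalize (C_infty_and _ _ Hc (HYinf (c' ^ q / eps)%R)); apply C_infty_imp.
      intros w [H1 H2] Hw; rewrite Hmod by exact Hw.
      assert (Hp := HYpos w Hw).
      apply (Rmult_le_compat_r eps) in H2; [| lra].
      replace (c' ^ q / eps * eps)%R with (c' ^ q)%R in H2 by (field; lra).
      assert (Hq : (0 < Cmod (Y w) ^ q)%R) by now apply pow_lt.
      apply (Rmult_le_reg_r (Cmod (Y w) ^ S q)); [now apply pow_lt |].
      unfold Rdiv; rewrite Rmult_assoc, Rinv_l, Rmult_1_r by (apply Rgt_not_eq; now apply pow_lt).
      apply Rle_trans with ((c' * Cmod (Y w)) ^ q)%R.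
      { apply pow_incr; split; [apply Cmod_ge_0 |]; nra. }
      rewrite Rpow_mult_distr; simpl; nra. }
  assert (Hx'all : forall x', (x < x')%R -> (y * Cmod (X z) <= x' * Cmod (Y z))%R).
  { intros x' Hx'; assert (Hp := HYpos z Hz).
    apply Rnot_lt_le; intros Hlt.
    set (rho := (y * Cmod (X z) / (x' * Cmod (Y z)))%R).
    assert (Hden : (0 < x' * Cmod (Y z))%R) by (apply Rmult_lt_0_compat; lra).
    assert (Hrho : (1 < rho)%R).
    { apply (Rmult_lt_reg_r (x' * Cmod (Y z))); [exact Hden |].
      unfold rho; rewrite Rmult_1_l; unfold Rdiv; rewrite Rmult_assoc, Rinv_l; lra. }
    destruct (Pow_x_infinity rho) with (b := (Cmod (Y z) / y + 1)%R) as [q Hq];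
      [rewrite Rabs_pos_eq; lra |].
    specialize (Hq q (Nat.le_refl q)).
    rewrite Rabs_pos_eq in Hq by (apply pow_le; lra).
    specialize (Hpow x' q Hx').
    apply (Rmult_le_compat_r (y ^ q * Cmod (Y z) / x' ^ q)) in Hpow.
    2: { apply Rlt_le, Rdiv_lt_0_compat; [apply Rmult_lt_0_compat; [now apply pow_lt | exact Hp] | apply pow_lt; lra]. }
    assert (Hx'q : (x' ^ q <> 0)%R) by (apply pow_nonzero; lra).
    assert (Hyq : (y ^ q <> 0)%R) by (apply pow_nonzero; lra).
    assert (HYq : (Cmod (Y z) ^ q <> 0)%R) by (apply pow_nonzero; lra).
    replace (x' ^ q / y ^ S q * (y ^ q * Cmod (Y z) / x' ^ q))%R with (Cmod (Y z) / y)%R in Hpow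
      by (simpl; field; repeat split; auto; lra).
    replace (Cmod (X z) ^ q / Cmod (Y z) ^ S q * (y ^ q * Cmod (Y z) / x' ^ q))%R
      with (rho ^ q)%R in Hpow.
    2: { unfold rho, Rdiv; rewrite !Rpow_mult_distr, pow_inv, Rpow_mult_distr; simpl; field; repeat split; auto; lra. }
    lra. }
  apply Rnot_lt_le; intros Hlt; assert (Hp := HYpos z Hz).
  set (e := ((y * Cmod (X z) - x * Cmod (Y z)) / (2 * Cmod (Y z)))%R).
  assert (He : (0 < e)%R) by (apply Rdiv_lt_0_compat; lra).
  specialize (Hx'all (x + e)%R ltac:(lra)).
  replace ((x + e) * Cmod (Y z))%R
    with (x * Cmod (Y z) + (y * Cmod (X z) - x * Cmod (Y z)) / 2)%R in Hx'all
    by (unfold e; field; lra).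
  lra.
Qed.

Definition zero_derivative (f : C -> C) (z : C) : Prop :=
  forall eps, (0 < eps)%R -> exists delta, (0 < delta)%R /\
    forall y, (Cmod (y - z) < delta)%R -> (Cmod (f y - f z) <= eps * Cmod (y - z))%R.

(** With [f'(z) = l] different from [0], moving [z] in the direction
    [f(z) / l] would increase the modulus. *)
Lemma zero_derivative_of_Cmod_const (f : C -> C) (z : C) (r : R) :
  Cderivable f z -> f z <> 0 -> (0 < r)%R ->
  (forall y, (Cmod (y - z) < r)%R -> Cmod (f y) = Cmod (f z)) -> zero_derivative f z.
Proof.
  intros Hf H0 Hr Hconst.
  apply Cderivable_eps in Hf; destruct Hf as [l Hl].
  destruct (Ceq_dec l 0) as [-> | Hl0].
  { intros eps Heps; destruct (Hl eps Heps) as [d [Hd H]]; exists d; split; [exact Hd |].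
    intros y Hy; specialize (H y Hy).
    now replace (f y - f z - 0 * (y - z)) with (f y - f z) in H by ring. }
  exfalso.
  assert (Hlm := proj1 (Cmod_gt_0 l) Hl0); assert (Hfm := proj1 (Cmod_gt_0 _) H0).
  destruct (Hl (Cmod l / 2)%R) as [d [Hd H]]; [lra |].
  set (k := (Cmod (f z) / Cmod l)%R).
  assert (Hk : (0 < k)%R) by now apply Rdiv_lt_0_compat.
  set (t := (Rmin r d / (2 * k))%R).
  assert (Hrd : (0 < Rmin r d)%R) by (apply Rmin_glb_lt; lra).
  assert (Ht : (0 < t)%R) by (apply Rdiv_lt_0_compat; lra).
  set (h := RtoC t * (f z / l)).
  assert (Hh : Cmod h = (t * k)%R).
  { unfold h, k; rewrite Cmod_mult, Cmod_div, Cmod_R, Rabs_pos_eq by (auto; lra); reflexivity. }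
  assert (Htk : (t * k = Rmin r d / 2)%R) by (unfold t; field; lra).
  assert (Hdist : Cmod (z + h - z) = (t * k)%R) by (rewrite <- Hh; f_equal; ring).
  generalize (Rmin_l r d) (Rmin_r r d); intros.
  specialize (Hconst (z + h) ltac:(lra)); specialize (H (z + h) ltac:(lra)).
  rewrite Hdist in H.
  replace (Cmod l / 2 * (t * k))%R with (t * Cmod (f z) / 2)%R in H by (unfold k; field; lra).
  replace (f (z + h) - f z - l * (z + h - z)) with (f (z + h) - RtoC (1 + t) * f z) in H
    by (unfold h; rewrite RtoC_plus; field; exact Hl0).
  generalize (Cmod_reverse_triangle (RtoC (1 + t) * f z) (f (z + h))).
  rewrite Cmod_minus_sym, Cmod_mult, Cmod_R, Rabs_pos_eq, Hconst by lra.
  nra.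
Qed.

(** Every point far out is joined to infinity by a ray, along which the function
    is constant. *)
Lemma zero_derivative_near_infinity (f : C -> C) (L : C) (M : R) :
  (forall z, (M < Cmod z)%R -> zero_derivative f z) ->
  (forall eps, (0 < eps)%R -> C_infty (fun z => (Cmod (f z - L) <= eps)%R)) ->
  forall z, (Rmax M 0 < Cmod z)%R -> f z = L.
Proof.
  intros Hf HL z Hz.
  assert (HzM := Rle_lt_trans _ _ _ (Rmax_l M 0) Hz).
  assert (Hz0 := Rle_lt_trans _ _ _ (Rmax_r M 0) Hz).
  assert (Hmod : forall t, (0 <= t)%R -> Cmod (RtoC t * z) = (t * Cmod z)%R).
  { intros t Ht; rewrite Cmod_mult, Cmod_R, Rabs_pos_eq; auto. }
  assert (Hray : forall T, (1 < T)%R -> f z = f (RtoC T * z)).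
  { intros T HT; replace (f z) with (f (RtoC 1 * z)) by (f_equal; ring).
    apply (eq_is_derive (V := C_R_NormedModule) (fun t => f (RtoC t * z))); [| exact HT].
    intros t Ht; split; [apply is_linear_scal_l |].
    intros t' Ht' eps; rewrite <- (is_filter_lim_locally_unique _ _ Ht').
    assert (Heps : (0 < eps / Cmod z)%R) by (apply Rdiv_lt_0_compat; [apply cond_pos | lra]).
    destruct (Hf (RtoC t * z)) with (eps := (eps / Cmod z)%R) as [d [Hd H]];
      [rewrite Hmod by lra; nra | exact Heps |].
    assert (Hdz : (0 < d / Cmod z)%R) by (apply Rdiv_lt_0_compat; lra).
    exists (mkposreal _ Hdz); intros s Hs.
    change (Rabs (s - t) < d / Cmod z)%R in Hs.
    assert (Hdist : Cmod (RtoC s * z - RtoC t * z) = (Rabs (s - t) * Cmod z)%R).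
    { rewrite <- Cmod_R, <- Cmod_mult, RtoC_minus; f_equal; ring. }
    specialize (H (RtoC s * z)); rewrite Hdist in H.
    change (norm (V := C_R_NormedModule)
      (f (RtoC s * z) - f (RtoC t * z) - scal (V := C_R_ModuleSpace) (s - t)%R (RtoC 0))%C
      <= eps * Rabs (s - t))%R.
    rewrite norm_C_R, scal_R_Cmult.
    replace (f (s * z) - f (t * z) - (s - t)%R * 0) with (f (s * z) - f (t * z)) by ring.
    eapply Rle_trans; [apply H |].
    - apply (Rmult_lt_compat_r (Cmod z)) in Hs; [| lra].
      now replace (d / Cmod z * Cmod z)%R with d in Hs by (field; lra).
    - apply Req_le; field; lra. }
  apply Ceq_minus, Cmod_eq_0, Rle_antisym; [| apply Cmod_ge_0].
  apply Rnot_lt_le; intros Hpos.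
  destruct (HL (Cmod (f z - L) / 2)%R) as [B HB]; [lra |].
  set (T := (Rmax 1 (B / Cmod z) + 1)%R).
  assert (HT1 := Rmax_l 1 (B / Cmod z)); assert (HT2 := Rmax_r 1 (B / Cmod z)).
  assert (HT : (1 < T)%R) by (unfold T; lra).
  specialize (HB (RtoC T * z)); rewrite <- (Hray T HT), Hmod in HB by lra.
  assert (HBT : (B < T * Cmod z)%R).
  { apply Rle_lt_trans with (B / Cmod z * Cmod z)%R; [apply Req_le; field; lra |].
    apply Rmult_lt_compat_r; unfold T; lra. }
  specialize (HB HBT); lra.
Qed.

(** The two comparisons of moduli make [|X / Y|] constant; then [X / Y] has
    derivative zero and equals its value at infinity. *)
Theorem proportional_near_infinity (A : C -> Prop) (X Y : C -> C) (x y : R) (L : C) :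
  closed_set A -> bounded_set A ->
  (forall z, ~ A z -> Cderivable X z) -> (forall z, ~ A z -> Cderivable Y z) ->
  (0 < x)%R -> (0 < y)%R ->
  (forall x', (x < x')%R -> near_boundary A (fun z => (Cmod (X z) <= x')%R)) ->
  (forall y', (y < y')%R -> near_boundary A (fun z => (Cmod (Y z) <= y')%R)) ->
  (forall z, ~ A z -> (x <= Cmod (X z))%R) -> (forall z, ~ A z -> (y <= Cmod (Y z))%R) ->
  L <> 0 ->
  (forall eps, (0 < eps)%R -> C_infty (fun z => (Cmod (X z / Y z - L) <= eps)%R)) ->
  (forall B, C_infty (fun z => (B <= Cmod (Y z))%R)) ->
  C_infty (fun z => X z = L * Y z).
Proof.
  intros HA HA' HX HY Hx Hy HXb HYb HXlo HYlo HL Hlim HYinf.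
  assert (HLm := proj1 (Cmod_gt_0 L) HL).
  assert (Hout := C_infty_outside A HA').
  assert (HYpos : forall z, ~ A z -> (0 < Cmod (Y z))%R) by (intros w Hw; specialize (HYlo w Hw); lra).
  assert (HY0 : forall z, ~ A z -> Y z <> 0) by (intros w Hw; apply Cmod_gt_0; auto).
  assert (Hratio : C_infty (fun z => (Cmod L / 2 * Cmod (Y z) <= Cmod (X z) <= 3 / 2 * Cmod L * Cmod (Y z))%R)).
  { generalize (C_infty_and _ _ Hout (Hlim (Cmod L / 2)%R ltac:(lra))); apply C_infty_imp.
    intros z [Hz H]; assert (Hp := HYpos z Hz).
    assert (Hdiv := Cmod_div (X z) (Y z) (HY0 z Hz)).
    generalize (Cmod_reverse_triangle (X z / Y z) L) (Cmod_reverse_triangle L (X z / Y z)).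
    rewrite (Cmod_minus_sym L), Hdiv; intros.
    replace (Cmod (X z)) with (Cmod (X z) / Cmod (Y z) * Cmod (Y z))%R by (field; lra).
    split; apply Rmult_le_compat_r; lra. }
  assert (HXinf : forall B, C_infty (fun z => (B <= Cmod (X z))%R)).
  { intros B; generalize (C_infty_and _ _ Hratio (HYinf (B / (Cmod L / 2))%R)); apply C_infty_imp.
    intros z [[H1 _] H2]; apply (Rmult_le_compat_l (Cmod L / 2)) in H2; [| lra].
    replace (Cmod L / 2 * (B / (Cmod L / 2)))%R with B in H2 by (field; lra); lra. }
  assert (Hle1 : forall z, ~ A z -> (y * Cmod (X z) <= x * Cmod (Y z))%R).
  { apply (Cmod_quotient_le A X Y x y (3 / 2 * Cmod L)); auto.
    revert Hratio; apply C_infty_imp; tauto. }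
  assert (Hle2 : forall z, ~ A z -> (x * Cmod (Y z) <= y * Cmod (X z))%R).
  { apply (Cmod_quotient_le A Y X y x (2 / Cmod L)); auto.
    revert Hratio; apply C_infty_imp; intros z [H _].
    apply (Rmult_le_compat_l (2 / Cmod L)) in H; [| apply Rlt_le, Rdiv_lt_0_compat; lra].
    eapply Rle_trans; [| exact H]; apply Req_le; field; lra. }
  set (H := fun z => X z / Y z).
  assert (Hmod : forall z, ~ A z -> Cmod (H z) = (x / y)%R).
  { intros z Hz; unfold H; rewrite Cmod_div by auto.
    assert (Hp := HYpos z Hz); specialize (Hle1 z Hz); specialize (Hle2 z Hz).
    apply (Rmult_eq_reg_r (y * Cmod (Y z))); [| apply Rgt_not_eq, Rmult_lt_0_compat; lra].
    field_simplify; lra. }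
  destruct Hout as [M HM].
  assert (Hzero : forall z, (M < Cmod z)%R -> zero_derivative H z).
  { intros z Hz; assert (HAz := HM z Hz).
    destruct (HA z HAz) as [r [Hr Hdisc]].
    apply (zero_derivative_of_Cmod_const H z r).
    - apply Cderivable_div; auto.
    - apply Cmod_gt_0; rewrite Hmod by exact HAz; now apply Rdiv_lt_0_compat.
    - exact Hr.
    - intros y' Hy'; rewrite !Hmod; auto. }
  exists (Rmax M 0); intros z Hz.
  rewrite <- (zero_derivative_near_infinity H L M Hzero Hlim z Hz).
  unfold H; field; apply HY0, HM.
  eapply Rle_lt_trans; [apply Rmax_l | exact Hz].
Qed.

(** * Contour integrals *)

Lemma is_derive_curve (gamma : R -> C) (t : R) :
  ex_derive (V := C_R_NormedModule) gamma t ->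
  is_derive (V := C_R_NormedModule) gamma t (curve_derive gamma t).
Proof.
  intros [l Hl].
  assert (H1 : is_derive (fun s => Re (gamma s)) t (Re l)).
  { apply (filterdiff_comp' gamma fst t (fun y => scal y l) fst Hl).
    apply (filterdiff_linear (U := prod_NormedModule R_AbsRing R_NormedModule R_NormedModule)), is_linear_fst. }
  assert (H2 : is_derive (fun s => Im (gamma s)) t (Im l)).
  { apply (filterdiff_comp' gamma snd t (fun y => scal y l) snd Hl).
    apply (filterdiff_linear (U := prod_NormedModule R_AbsRing R_NormedModule R_NormedModule)), is_linear_snd. }
  assert (E : curve_derive gamma t = l).
  { unfold curve_derive; rewrite (surjective_pairing l); f_equal; now apply is_derive_unique. }
  rewrite E; exact Hl.
Qed.

Lemma is_derive_along_curve (Phi : C -> C) (gamma : R -> C) (t : R) (l : C) :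
  has_Cderivative Phi (gamma t) l ->
  ex_derive (V := C_R_NormedModule) gamma t ->
  is_derive (V := C_R_NormedModule) (fun s => Phi (gamma s)) t (l * curve_derive gamma t).
Proof.
  intros HPhi Hg; apply is_derive_curve in Hg.
  set (g' := curve_derive gamma t) in *.
  assert (Heps : forall eps, (0 < eps)%R -> exists delta, (0 < delta)%R /\ forall s,
    (Rabs (s - t) < delta)%R ->
    (Cmod (gamma s - gamma t - RtoC (s - t) * g') <= eps * Rabs (s - t))%R).
  { intros eps Heps; destruct Hg as [_ Hg].
    destruct (Hg t (fun P H => H) (mkposreal eps Heps)) as [d Hd].
    exists d; split; [apply cond_pos |]; intros s Hs.
    specialize (Hd s Hs).
    change (norm (V := C_R_NormedModule) (gamma s - gamma t - scal (V := C_R_ModuleSpace) (s - t)%R g')%C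
      <= eps * Rabs (s - t))%R in Hd.
    now rewrite norm_C_R, scal_R_Cmult in Hd. }
  split; [apply is_linear_scal_l |].
  intros t' Ht' eps; rewrite <- (is_filter_lim_locally_unique _ _ Ht'); clear t' Ht'.
  assert (He := cond_pos eps).
  assert (Hg0 := Cmod_ge_0 g'); assert (Hl0 := Cmod_ge_0 l).
  set (e1 := (eps / (2 * (1 + Cmod g')))%R); set (e2 := (eps / (2 * (1 + Cmod l)))%R).
  assert (He1 : (0 < e1)%R) by (apply Rdiv_lt_0_compat; lra).
  assert (He2 : (0 < e2)%R) by (apply Rdiv_lt_0_compat; lra).
  destruct (proj1 (has_Cderivative_eps Phi (gamma t) l) HPhi e1 He1) as [d1 [Hd1 H1]].
  destruct (Heps 1%R Rlt_0_1) as [d2 [Hd2 H2]].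
  destruct (Heps e2 He2) as [d3 [Hd3 H3]].
  set (d4 := (d1 / (1 + Cmod g'))%R).
  assert (Hd4 : (0 < d4)%R) by (apply Rdiv_lt_0_compat; lra).
  exists (mkposreal (Rmin (Rmin d2 d3) d4) ltac:(repeat apply Rmin_glb_lt; assumption)).
  intros s Hs; change (Rabs (s - t) < Rmin (Rmin d2 d3) d4)%R in Hs.
  generalize (Rmin_l (Rmin d2 d3) d4) (Rmin_r (Rmin d2 d3) d4) (Rmin_l d2 d3) (Rmin_r d2 d3); intros.
  specialize (H2 s ltac:(lra)); specialize (H3 s ltac:(lra)).
  change (norm (V := C_R_NormedModule)
    (Phi (gamma s) - Phi (gamma t) - scal (V := C_R_ModuleSpace) (s - t)%R (l * g'))%C
    <= eps * Rabs (s - t))%R.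
  rewrite norm_C_R, scal_R_Cmult.
  assert (Hlip : (Cmod (gamma s - gamma t) <= (1 + Cmod g') * Rabs (s - t))%R).
  { replace (gamma s - gamma t)
      with ((gamma s - gamma t - RtoC (s - t) * g') + RtoC (s - t) * g') by ring.
    eapply Rle_trans; [apply Cmod_triangle |]; rewrite Cmod_mult, Cmod_R; lra. }
  assert (Hclose : (Cmod (gamma s - gamma t) < d1)%R).
  { eapply Rle_lt_trans; [exact Hlip |].
    replace d1 with ((1 + Cmod g') * d4)%R by (unfold d4; field; lra).
    apply Rmult_lt_compat_l; lra. }
  specialize (H1 (gamma s) Hclose).
  replace (Phi (gamma s) - Phi (gamma t) - (s - t)%R * (l * g'))
    with ((Phi (gamma s) - Phi (gamma t) - l * (gamma s - gamma t))
          + l * (gamma s - gamma t - (s - t)%R * g')) by ring.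
  eapply Rle_trans; [apply Cmod_triangle |]; rewrite Cmod_mult.
  assert (K1 : (e1 * Cmod (gamma s - gamma t) <= eps / 2 * Rabs (s - t))%R).
  { eapply Rle_trans; [apply Rmult_le_compat_l; [lra | exact Hlip] |].
    apply Req_le; unfold e1; field; lra. }
  assert (K2 : (Cmod l * Cmod (gamma s - gamma t - (s - t)%R * g') <= eps / 2 * Rabs (s - t))%R).
  { apply Rle_trans with ((1 + Cmod l) * (e2 * Rabs (s - t)))%R.
    - apply Rmult_le_compat; [exact Hl0 | apply Cmod_ge_0 | lra | exact H3].
    - apply Req_le; unfold e2; field; lra. }
  lra.
Qed.

Definition C1_cycle (cyc : list (list (R -> C))) : Prop :=
  forall l, In l cyc -> closed_curve l.

Definition continuous_on_trace (cyc : list (list (R -> C))) (f : C -> C) : Prop :=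
  forall z, trace cyc z -> Ccontinuous f z.

Lemma C1_cycle_arc (cyc : list (list (R -> C))) (gamma : R -> C) :
  C1_cycle cyc -> In gamma (concat cyc) -> C1_arc gamma.
Proof.
  intros Hcyc Hg; apply in_concat in Hg; destruct Hg as [l [Hl Hg]].
  now apply (Hcyc l Hl).
Qed.

Lemma arc_integrand_continuous (f : C -> C) (gamma : R -> C) (t : R) :
  C1_arc gamma -> (0 <= t <= 1)%R -> Ccontinuous f (gamma t) ->
  continuous (fun s => f (gamma s) * curve_derive gamma s) t.
Proof.
  intros Hg Ht Hf; destruct (Hg t Ht) as [Hd Hc].
  apply continuous_Cmult; [| exact Hc].
  apply (continuous_Ccomp f gamma); [exact Hf |].
  apply (ex_derive_continuous (V := C_R_NormedModule)), Hd.
Qed.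

Lemma cycle_integrable (cyc : list (list (R -> C))) (f : C -> C) (gamma : R -> C) :
  C1_cycle cyc -> continuous_on_trace cyc f -> In gamma (concat cyc) ->
  ex_RInt (V := C_R_NormedModule) (fun t => f (gamma t) * curve_derive gamma t) 0 1.
Proof.
  intros Hcyc Hf Hg; apply ex_CInt_continuous; [lra |]; intros t Ht.
  apply arc_integrand_continuous; [eapply C1_cycle_arc; eassumption | exact Ht |].
  apply Hf; exists gamma, t; auto.
Qed.

Lemma arcs_sum_ext (l : list (R -> C)) (I J : (R -> C) -> C) :
  (forall gamma, In gamma l -> I gamma = J gamma) ->
  fold_right Cplus 0 (map I l) = fold_right Cplus 0 (map J l).
Proof. intros H; f_equal; now apply map_ext_in. Qed.

Lemma cycle_integral_ext (cyc : list (list (R -> C))) (f g : C -> C) :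
  (forall z, trace cyc z -> f z = g z) -> cycle_integral cyc f = cycle_integral cyc g.
Proof.
  intros H; apply arcs_sum_ext; intros gamma Hg; apply CInt_ext; [lra |].
  intros t Ht; rewrite H; [reflexivity | exists gamma, t; auto].
Qed.

Lemma cycle_integral_plus (cyc : list (list (R -> C))) (f g : C -> C) :
  C1_cycle cyc -> continuous_on_trace cyc f -> continuous_on_trace cyc g ->
  cycle_integral cyc (fun z => f z + g z) = cycle_integral cyc f + cycle_integral cyc g.
Proof.
  intros Hcyc Hf Hg; unfold cycle_integral.
  rewrite (arcs_sum_ext _ _ (fun gamma => arc_integral f gamma + arc_integral g gamma)).
  - induction (concat cyc) as [|gamma l IH]; simpl; [ring | rewrite IH; ring].
  - intros gamma Hgamma; unfold arc_integral.
    transitivity (CInt (fun t => f (gamma t) * curve_derive gamma t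
                                 + g (gamma t) * curve_derive gamma t) 0 1).
    + apply CInt_ext; [lra |]; intros; ring.
    + apply CInt_plus; now apply (cycle_integrable cyc).
Qed.

Lemma cycle_integral_scal (cyc : list (list (R -> C))) (c : C) (f : C -> C) :
  C1_cycle cyc -> continuous_on_trace cyc f ->
  cycle_integral cyc (fun z => c * f z) = c * cycle_integral cyc f.
Proof.
  intros Hcyc Hf; unfold cycle_integral.
  rewrite (arcs_sum_ext _ _ (fun gamma => c * arc_integral f gamma)).
  - induction (concat cyc) as [|gamma l IH]; simpl; [ring | rewrite IH; ring].
  - intros gamma Hgamma; unfold arc_integral.
    transitivity (CInt (fun t => c * (f (gamma t) * curve_derive gamma t)) 0 1).
    + apply CInt_ext; [lra |]; intros; ring.
    + apply (is_RInt_unique (V := C_R_CompleteNormedModule)), CInt_Cmult.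
      now apply (cycle_integrable cyc).
Qed.

Lemma cycle_integral_bound (cyc : list (list (R -> C))) :
  C1_cycle cyc -> exists K, (0 <= K)%R /\ forall f eps, (0 <= eps)%R ->
    continuous_on_trace cyc f -> (forall z, trace cyc z -> (Cmod (f z) <= eps)%R) ->
    (Cmod (cycle_integral cyc f) <= eps * K)%R.
Proof.
  intros Hcyc.
  assert (Harc : forall gamma, In gamma (concat cyc) -> exists K, (0 <= K)%R /\
    forall f eps, (0 <= eps)%R -> continuous_on_trace cyc f ->
      (forall z, trace cyc z -> (Cmod (f z) <= eps)%R) ->
      (Cmod (arc_integral f gamma) <= eps * K)%R).
  { intros gamma Hg; assert (HC1 := C1_cycle_arc _ _ Hcyc Hg).
    assert (Hsp : ex_RInt (fun t => Cmod (curve_derive gamma t)) 0 1).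
    { apply (ex_RInt_continuous (V := R_CompleteNormedModule)).
      rewrite Rmin_left, Rmax_right by lra; intros t Ht.
      apply (continuous_ext (fun t => norm (V := C_R_NormedModule) (curve_derive gamma t)));
        [intros s; apply norm_C_R |].
      apply (continuous_comp (curve_derive gamma) (norm (V := C_R_NormedModule))).
      - apply (HC1 t Ht).
      - apply (filterlim_norm (V := C_R_NormedModule)). }
    exists (RInt (fun t => Cmod (curve_derive gamma t)) 0 1); split.
    { apply RInt_ge_0; [lra | exact Hsp | intros; apply Cmod_ge_0]. }
    intros f eps Heps Hf Hbound.
    rewrite <- norm_C_R.
    apply (norm_RInt_le (V := C_R_NormedModule) (fun t => f (gamma t) * curve_derive gamma t)
      (fun t => eps * Cmod (curve_derive gamma t))%R 0 1); [lra | | |].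
    - intros t Ht; rewrite norm_C_R, Cmod_mult.
      apply Rmult_le_compat_r; [apply Cmod_ge_0 | apply Hbound; exists gamma, t; auto].
    - apply (RInt_correct (V := C_R_CompleteNormedModule)); now apply (cycle_integrable cyc).
    - apply (is_RInt_scal (V := R_NormedModule)), (RInt_correct (V := R_CompleteNormedModule)), Hsp. }
  unfold cycle_integral; induction (concat cyc) as [|gamma l IH].
  - exists 0%R; split; [lra |]; intros f eps _ _ _; simpl; rewrite Cmod_0; lra.
  - destruct (Harc gamma (or_introl eq_refl)) as [K1 [HK1 H1]].
    destruct IH as [K2 [HK2 H2]]; [intros g Hg; apply Harc; now right |].
    exists (K1 + K2)%R; split; [lra |]; intros f eps Heps Hf Hb; simpl.
    eapply Rle_trans; [apply Cmod_triangle |].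
    specialize (H1 f eps Heps Hf Hb); specialize (H2 f eps Heps Hf Hb); lra.
Qed.

Lemma chain_telescopes (u v : (R -> C) -> C) (l : list (R -> C)) (g d : R -> C) :
  (forall i, (S i < length (g :: l))%nat -> v (nth i (g :: l) d) = u (nth (S i) (g :: l) d)) ->
  fold_right Cplus 0 (map (fun gamma => v gamma - u gamma) (g :: l)) =
  v (nth (length l) (g :: l) d) - u g.
Proof.
  revert g; induction l as [|h l IH]; intros g H; [simpl; ring |].
  change (fold_right Cplus 0 (map (fun gamma => v gamma - u gamma) (g :: h :: l)))
    with ((v g - u g) + fold_right Cplus 0 (map (fun gamma => v gamma - u gamma) (h :: l))).
  rewrite IH.
  - change (nth (length (h :: l)) (g :: h :: l) d) with (nth (length l) (h :: l) d).
    assert (H0 := H 0%nat ltac:(simpl; lia)); simpl in H0; rewrite H0; ring.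
  - intros i Hi; apply (H (S i)); simpl in *; lia.
Qed.

Lemma closed_curve_telescopes (Phi : C -> C) (l : list (R -> C)) :
  closed_curve l ->
  fold_right Cplus 0 (map (fun gamma => Phi (gamma 1%R) - Phi (gamma 0%R)) l) = 0.
Proof.
  intros [Hnil [_ Hclosed]]; destruct l as [|g l]; [now destruct Hnil |].
  rewrite (chain_telescopes (fun gamma => Phi (gamma 0%R)) (fun gamma => Phi (gamma 1%R)) l g (fun _ => 0)).
  - rewrite (Hclosed (length l)) by (simpl; lia).
    change (length (g :: l)) with (S (length l)); rewrite Nat.Div0.mod_same; simpl; ring.
  - intros i Hi; rewrite (Hclosed i) by lia; now rewrite Nat.mod_small.
Qed.

Lemma cycle_integral_primitive (cyc : list (list (R -> C))) (Phi phi : C -> C) :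
  C1_cycle cyc -> continuous_on_trace cyc phi ->
  (forall z, trace cyc z -> has_Cderivative Phi z (phi z)) -> cycle_integral cyc phi = 0.
Proof.
  intros Hcyc Hphi HPhi; unfold cycle_integral.
  rewrite (arcs_sum_ext _ _ (fun gamma => Phi (gamma 1%R) - Phi (gamma 0%R))).
  - clear Hphi HPhi; induction cyc as [|l cyc IH]; [reflexivity |].
    simpl; rewrite map_app, fold_right_app, IH by (intros l' Hl'; apply Hcyc; now right).
    apply closed_curve_telescopes, Hcyc; now left.
  - intros gamma Hg; assert (HC1 := C1_cycle_arc _ _ Hcyc Hg).
    apply (is_RInt_unique (V := C_R_CompleteNormedModule)).
    apply (is_RInt_derive (V := C_R_CompleteNormedModule) (fun t => Phi (gamma t)));
      rewrite Rmin_left, Rmax_right by lra; intros t Ht;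
      assert (Htr : trace cyc (gamma t)) by (exists gamma, t; auto).
    + apply is_derive_along_curve; [now apply HPhi | apply (HC1 t Ht)].
    + apply arc_integrand_continuous; [exact HC1 | exact Ht | now apply Hphi].
Qed.

(** * Polynomials *)

(** Polynomial functions in Horner form, for which every property below is a
    short induction. *)
Inductive poly_fun : (C -> C) -> Prop :=
| poly_const (c : C) (Q : C -> C) : (forall z, Q z = c) -> poly_fun Q
| poly_horner (c : C) (Q R : C -> C) :
    poly_fun Q -> (forall z, R z = c + z * Q z) -> poly_fun R.

Lemma poly_fun_plus (Q R : C -> C) :
  poly_fun Q -> poly_fun R -> poly_fun (fun z => Q z + R z).
Proof.
  intros HQ; revert R; induction HQ as [c Q HQ | c Q' Q HQ' IH HQ]; intros R HR;
    destruct HR as [b R HR | b R' R HR' HR].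
  - apply (poly_const (c + b)); intros z; rewrite HQ, HR; ring.
  - apply (poly_horner (c + b) R'); [exact HR' |]; intros z; rewrite HQ, HR; ring.
  - apply (poly_horner (c + b) Q'); [exact HQ' |]; intros z; rewrite HQ, HR; ring.
  - apply (poly_horner (c + b) (fun z => Q' z + R' z)); [now apply IH |].
    intros z; rewrite HQ, HR; ring.
Qed.

Lemma poly_fun_scal (b : C) (Q : C -> C) : poly_fun Q -> poly_fun (fun z => b * Q z).
Proof.
  induction 1 as [c Q HQ | c Q' Q HQ' IH HQ].
  - apply (poly_const (b * c)); intros z; now rewrite HQ.
  - apply (poly_horner (b * c) (fun z => b * Q' z)); [exact IH |]; intros z; rewrite HQ; ring.
Qed.

Lemma poly_fun_ext (Q R : C -> C) : (forall z, Q z = R z) -> poly_fun Q -> poly_fun R.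
Proof.
  intros E H; destruct H as [c Q HQ | c Q' Q HQ' HQ].
  - apply (poly_const c); intros z; now rewrite <- E.
  - apply (poly_horner c Q'); [exact HQ' |]; intros z; now rewrite <- E.
Qed.

Lemma poly_fun_mult (Q R : C -> C) :
  poly_fun Q -> poly_fun R -> poly_fun (fun z => Q z * R z).
Proof.
  intros HQ HR; induction HQ as [c Q HQ | c Q' Q HQ' IH HQ].
  - apply (poly_fun_ext (fun z => c * R z)); [intros z; now rewrite HQ | now apply poly_fun_scal].
  - apply (poly_fun_ext (fun z => c * R z + (0 + z * (Q' z * R z)))); [intros z; rewrite HQ; ring |].
    apply poly_fun_plus; [now apply poly_fun_scal |].
    now apply (poly_horner 0 (fun z => Q' z * R z)).
Qed.

Lemma poly_fun_comp (Q R : C -> C) :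
  poly_fun Q -> poly_fun R -> poly_fun (fun z => Q (R z)).
Proof.
  intros HQ HR; induction HQ as [c Q HQ | c Q' Q HQ' IH HQ].
  - apply (poly_const c); auto.
  - apply (poly_fun_ext (fun z => c + R z * Q' (R z))); [intros z; now rewrite HQ |].
    apply poly_fun_plus; [now apply (poly_const c) | now apply poly_fun_mult].
Qed.

Lemma poly_fun_pow (j : nat) : poly_fun (fun z => z ^ j).
Proof.
  induction j as [|j IH]; [now apply (poly_const 1) |].
  apply (poly_horner 0 (fun z => z ^ j)); [exact IH |]; intros z; simpl; ring.
Qed.

Lemma poly_fun_sum (c : nat -> C) (N : nat) : poly_fun (fun z => sum_n (fun j => c j * z ^ j) N).
Proof.
  assert (Hterm : forall j, poly_fun (fun z => c j * z ^ j)) by (intros j; apply poly_fun_scal, poly_fun_pow).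
  induction N as [|N IH].
  - apply (poly_fun_ext (fun z => c 0%nat * z ^ 0)); [intros z; now rewrite sum_O | apply Hterm].
  - apply (poly_fun_ext (fun z => sum_n (fun j => c j * z ^ j) N + c (S N) * z ^ S N)).
    + intros z; rewrite sum_Sn; reflexivity.
    + apply poly_fun_plus; [exact IH | apply Hterm].
Qed.

Lemma poly_fun_Cderivable (Q : C -> C) (z : C) : poly_fun Q -> Cderivable Q z.
Proof.
  intros HQ; revert z; induction HQ as [c Q HQ | c Q' Q HQ' IH HQ]; intros z.
  - apply (ex_derive_ext (V := AbsRing_NormedModule C_AbsRing) (fun _ => c));
      [intros y; symmetry; apply HQ | apply Cderivable_const].
  - apply (ex_derive_ext (V := AbsRing_NormedModule C_AbsRing) (fun y => c + y * Q' y));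
      [intros y; symmetry; apply HQ |].
    apply Cderivable_plus; [apply Cderivable_const |].
    apply Cderivable_mult; [apply Cderivable_id | apply IH].
Qed.

Lemma poly_fun_bounded (Q : C -> C) (r : R) :
  poly_fun Q -> exists K, forall z, (Cmod z <= r)%R -> (Cmod (Q z) <= K)%R.
Proof.
  induction 1 as [c Q HQ | c Q' Q HQ' [K HK] HQ].
  - exists (Cmod c); intros z _; rewrite HQ; lra.
  - exists (Cmod c + r * K)%R; intros z Hz; rewrite HQ.
    eapply Rle_trans; [apply Cmod_triangle |]; rewrite Cmod_mult.
    apply Rplus_le_compat_l, Rmult_le_compat; auto using Cmod_ge_0.
Qed.

Lemma has_Cderivative_pow (f : C -> C) (z l : C) (k : nat) :
  has_Cderivative f z l ->
  has_Cderivative (fun y => f y ^ S k) z (RtoC (INR (S k)) * f z ^ k * l).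
Proof.
  intros Hf; induction k as [|k IH].
  - assert (H := is_derive_mult (K := C_AbsRing) f (fun _ => RtoC 1) z l (RtoC 0) Hf
      (is_derive_const (V := AbsRing_NormedModule C_AbsRing) (1 : C) z) Cmult_comm).
    replace (RtoC (INR 1) * f z ^ 0 * l) with (l * 1 + f z * 0); [exact H |].
    simpl; ring.
  - assert (H := is_derive_mult (K := C_AbsRing) f (fun y => f y ^ S k) z _ _ Hf IH Cmult_comm).
    replace (RtoC (INR (S (S k))) * f z ^ S k * l)
      with (l * f z ^ S k + f z * (RtoC (INR (S k)) * f z ^ k * l)); [exact H |].
    rewrite (S_INR (S k)), RtoC_plus; simpl Cpow; ring.
Qed.

Lemma has_Cderivative_scal (c : C) (f : C -> C) (z l : C) :
  has_Cderivative f z l -> has_Cderivative (fun y => c * f y) z (c * l).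
Proof.
  intros Hf; assert (H := is_derive_mult (K := C_AbsRing) (fun _ => c) f z (RtoC 0) l
    (is_derive_const (V := AbsRing_NormedModule C_AbsRing) (c : C) z) Hf Cmult_comm).
  replace (c * l) with (0 * f z + c * l) by ring; exact H.
Qed.

Lemma INR_S_nonzero (k : nat) : RtoC (INR (S k)) <> 0.
Proof. intros E; apply RtoC_inj in E; now apply (not_0_INR (S k)). Qed.

(** The monomials have primitives. The factor [z ^ i] makes the Horner induction
    go through. *)
Lemma cycle_integral_pow_poly (cyc : list (list (R -> C))) (Q : C -> C) :
  C1_cycle cyc -> poly_fun Q -> forall i, cycle_integral cyc (fun z => z ^ i * Q z) = 0.
Proof.
  intros Hcyc HQ.
  assert (Hpow : forall i z, Ccontinuous (fun y => y ^ i) z)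
    by (intros i z; apply Cderivable_continuous, Cderivable_pow, Cderivable_id).
  assert (Hmono : forall i, cycle_integral cyc (fun z => z ^ i) = 0).
  { intros i; apply (cycle_integral_primitive cyc (fun z => / RtoC (INR (S i)) * z ^ S i));
      [exact Hcyc | intros z _; apply Hpow |].
    intros z _; assert (H := has_Cderivative_scal (/ RtoC (INR (S i))) _ z _
      (has_Cderivative_pow (fun y => y) z 1 i (is_derive_id z))).
    cbv beta in H.
    replace (/ RtoC (INR (S i)) * (RtoC (INR (S i)) * z ^ i * 1)) with (z ^ i) in H
      by (field; apply INR_S_nonzero).
    exact H. }
  induction HQ as [c Q HQ | c Q' Q HQ' IH HQ]; intros i.
  - rewrite (cycle_integral_ext _ _ (fun z => c * z ^ i)) by (intros z _; rewrite HQ; ring).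
    rewrite cycle_integral_scal, Hmono; [ring | exact Hcyc | intros z _; apply Hpow].
  - rewrite (cycle_integral_ext _ _ (fun z => c * z ^ i + z ^ S i * Q' z))
      by (intros z _; rewrite HQ; simpl; ring).
    rewrite cycle_integral_plus, cycle_integral_scal, Hmono, IH; [ring | exact Hcyc | | exact Hcyc | |].
    + intros z _; apply Hpow.
    + intros z _; apply Cderivable_continuous, Cderivable_mult;
        [apply Cderivable_const | apply Cderivable_pow, Cderivable_id].
    + intros z _; apply Cderivable_continuous, Cderivable_mult;
        [apply Cderivable_pow, Cderivable_id | now apply poly_fun_Cderivable].
Qed.

Lemma trace_ne (cyc : list (list (R -> C))) (z y : C) : ~ trace cyc z -> trace cyc y -> y - z <> 0.
Proof. intros Hz Hy E; apply Hz; apply Ceq_minus in E; now rewrite <- E. Qed.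

(** Cauchy's formula for polynomials is elementary: with [Q = c + y Q'],
    [Q(y) / (y - z) = c / (y - z) + z Q'(y) / (y - z) + Q'(y)], and the last term
    integrates to [0]. *)
Lemma cauchy_formula_poly (cyc : list (list (R -> C))) (Q : C -> C) (z : C) :
  C1_cycle cyc -> ~ trace cyc z -> poly_fun Q ->
  cycle_integral cyc (fun y => Q y / (y - z)) = Q z * cycle_integral cyc (fun y => / (y - z)).
Proof.
  intros Hcyc Hz HQ.
  assert (Hker : forall y, trace cyc y -> Cderivable (fun y => / (y - z)) y).
  { intros y Hy; apply Cderivable_inv; [| eapply trace_ne; eassumption].
    apply Cderivable_minus; [apply Cderivable_id | apply Cderivable_const]. }
  induction HQ as [c Q HQ | c Q' Q HQ' IH HQ].
  - rewrite (cycle_integral_ext _ _ (fun y => c * / (y - z))) by (intros y _; now rewrite HQ).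
    rewrite cycle_integral_scal, HQ; [reflexivity | exact Hcyc |].
    intros y Hy; now apply Cderivable_continuous, Hker.
  - rewrite (cycle_integral_ext _ _
      (fun y => (c * / (y - z) + z * (Q' y / (y - z))) + y ^ 0 * Q' y)).
    2: { intros y Hy; rewrite HQ; simpl; field; now apply (trace_ne cyc). }
    assert (C1 : continuous_on_trace cyc (fun y => / (y - z)))
      by (intros y Hy; now apply Cderivable_continuous, Hker).
    assert (C2 : continuous_on_trace cyc (fun y => Q' y / (y - z))).
    { intros y Hy; apply Cderivable_continuous, Cderivable_mult; [now apply poly_fun_Cderivable | now apply Hker]. }
    assert (C3 : forall c f, (forall y, trace cyc y -> Cderivable f y) ->
      continuous_on_trace cyc (fun y => c * f y)).
    { intros b f Hf y Hy; apply Cderivable_continuous, Cderivable_mult; [apply Cderivable_const | now apply Hf]. }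
    assert (C2' : forall y, trace cyc y -> Cderivable (fun y => Q' y / (y - z)) y).
    { intros y Hy; apply Cderivable_mult; [now apply poly_fun_Cderivable | now apply Hker]. }
    rewrite cycle_integral_plus, cycle_integral_plus, !cycle_integral_scal, IH,
      cycle_integral_pow_poly, HQ; auto; [ring | |].
    + intros y Hy; apply Cderivable_continuous, Cderivable_plus;
        apply Cderivable_mult; auto using Cderivable_const.
    + intros y Hy; apply Cderivable_continuous, Cderivable_mult;
        [apply Cderivable_pow, Cderivable_id | now apply poly_fun_Cderivable].
Qed.

(** * Uniform limits of polynomials in [1 / z] *)

(** Functions holomorphic in a neighbourhood of infinity, encoded through
    uniform approximation by polynomials in [1 / z]; this form passes directly to
    contour integrals and is stable under products and uniform limits. *)
Definition regular_at_infinity (r : R) (f : C -> C) : Prop :=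
  forall eps, (0 < eps)%R -> exists p, poly_fun p /\
    forall z, (r < Cmod z)%R -> (Cmod (f z - p (/ z)%C) <= eps)%R.

Lemma regular_poly_inv (r : R) (p : C -> C) :
  poly_fun p -> regular_at_infinity r (fun z => p (/ z)%C).
Proof.
  intros Hp eps Heps; exists p; split; [exact Hp |]; intros z _.
  replace (p (/ z)%C - p (/ z)%C) with (RtoC 0) by ring; rewrite Cmod_0; lra.
Qed.

Lemma regular_const (r : R) (c : C) : regular_at_infinity r (fun _ => c).
Proof. apply (regular_poly_inv r (fun _ => c)); now apply (poly_const c). Qed.

Lemma regular_ext (r : R) (f g : C -> C) :
  (forall z, (r < Cmod z)%R -> f z = g z) ->
  regular_at_infinity r f -> regular_at_infinity r g.
Proof.
  intros E Hf eps Heps; destruct (Hf eps Heps) as [p [Hp H]].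
  exists p; split; [exact Hp |]; intros z Hz; rewrite <- E; auto.
Qed.

Lemma regular_plus (r : R) (f g : C -> C) :
  regular_at_infinity r f -> regular_at_infinity r g ->
  regular_at_infinity r (fun z => f z + g z).
Proof.
  intros Hf Hg eps Heps.
  destruct (Hf (eps / 2)%R) as [p [Hp H1]]; [lra |].
  destruct (Hg (eps / 2)%R) as [q [Hq H2]]; [lra |].
  exists (fun s => p s + q s); split; [now apply poly_fun_plus |]; intros z Hz.
  specialize (H1 z Hz); specialize (H2 z Hz).
  replace (f z + g z - (p (/ z)%C + q (/ z)%C)) with ((f z - p (/ z)%C) + (g z - q (/ z)%C)) by ring.
  eapply Rle_trans; [apply Cmod_triangle | lra].
Qed.

Lemma Cmod_inv_le (r : R) (z : C) : (0 < r)%R -> (r < Cmod z)%R -> (Cmod (/ z) <= / r)%R.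
Proof.
  intros Hr Hz; rewrite Cmod_inv by (apply Cmod_gt_0; lra).
  apply Rinv_le_contravar; lra.
Qed.

Lemma regular_bounded (r : R) (f : C -> C) :
  (0 < r)%R -> regular_at_infinity r f ->
  exists K, (0 < K)%R /\ forall z, (r < Cmod z)%R -> (Cmod (f z) <= K)%R.
Proof.
  intros Hr Hf; destruct (Hf 1%R Rlt_0_1) as [p [Hp H]].
  destruct (poly_fun_bounded p (/ r) Hp) as [K HK].
  exists (Rmax K 0 + 1)%R; split; [generalize (Rmax_r K 0); lra |]; intros z Hz.
  specialize (H z Hz); specialize (HK (/ z) (Cmod_inv_le r z Hr Hz)).
  generalize (Cmod_reverse_triangle (f z) (p (/ z)%C)) (Rmax_l K 0); lra.
Qed.

Lemma regular_mult (r : R) (f g : C -> C) :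
  (0 < r)%R -> regular_at_infinity r f -> regular_at_infinity r g ->
  regular_at_infinity r (fun z => f z * g z).
Proof.
  intros Hr Hf Hg.
  destruct (regular_bounded r f Hr Hf) as [K1 [HK1 B1]].
  destruct (regular_bounded r g Hr Hg) as [K2 [HK2 B2]].
  intros eps Heps.
  set (e1 := Rmin 1 (eps / (2 * K2))).
  assert (He1 : (0 < e1)%R) by (apply Rmin_glb_lt; [lra | apply Rdiv_lt_0_compat; lra]).
  assert (He1' : (e1 <= 1)%R) by apply Rmin_l.
  assert (He1'' : (e1 * K2 <= eps / 2)%R).
  { apply Rle_trans with (eps / (2 * K2) * K2)%R; [apply Rmult_le_compat_r; [lra | apply Rmin_r] |].
    apply Req_le; field; lra. }
  destruct (Hf e1 He1) as [p [Hp H1]].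
  destruct (Hg (eps / (2 * (K1 + 1)))%R) as [q [Hq H2]]; [apply Rdiv_lt_0_compat; lra |].
  exists (fun s => p s * q s); split; [now apply poly_fun_mult |]; intros z Hz.
  specialize (H1 z Hz); specialize (H2 z Hz); specialize (B1 z Hz); specialize (B2 z Hz).
  assert (Hpz : (Cmod (p (/ z)%C) <= K1 + 1)%R).
  { generalize (Cmod_reverse_triangle (p (/ z)%C) (f z)); rewrite Cmod_minus_sym; lra. }
  replace (f z * g z - p (/ z)%C * q (/ z)%C)
    with ((f z - p (/ z)%C) * g z + p (/ z)%C * (g z - q (/ z)%C)) by ring.
  eapply Rle_trans; [apply Cmod_triangle |]; rewrite !Cmod_mult.
  assert (Cmod (f z - p (/ z)%C) * Cmod (g z) <= e1 * K2)%R
    by (apply Rmult_le_compat; auto using Cmod_ge_0).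
  assert (Cmod (p (/ z)%C) * Cmod (g z - q (/ z)%C) <= (K1 + 1) * (eps / (2 * (K1 + 1))))%R
    by (apply Rmult_le_compat; auto using Cmod_ge_0).
  replace ((K1 + 1) * (eps / (2 * (K1 + 1))))%R with (eps / 2)%R in * by (field; lra).
  lra.
Qed.

Lemma regular_poly (r : R) (p f : C -> C) :
  (0 < r)%R -> poly_fun p -> regular_at_infinity r f -> regular_at_infinity r (fun z => p (f z)).
Proof.
  intros Hr Hp Hf; induction Hp as [c Q HQ | c Q' Q HQ' IH HQ].
  - apply (regular_ext r (fun _ => c)); [intros z _; now rewrite HQ | apply regular_const].
  - apply (regular_ext r (fun z => c + f z * Q' (f z))); [intros z _; now rewrite HQ |].
    apply regular_plus; [apply regular_const | now apply regular_mult].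
Qed.

Lemma regular_limit (r : R) (f : C -> C) :
  (forall eps, (0 < eps)%R -> exists g, regular_at_infinity r g /\
     forall z, (r < Cmod z)%R -> (Cmod (f z - g z) <= eps)%R) ->
  regular_at_infinity r f.
Proof.
  intros Hf eps Heps.
  destruct (Hf (eps / 2)%R) as [g [Hg H1]]; [lra |].
  destruct (Hg (eps / 2)%R) as [p [Hp H2]]; [lra |].
  exists p; split; [exact Hp |]; intros z Hz; specialize (H1 z Hz); specialize (H2 z Hz).
  replace (f z - p (/ z)%C) with ((f z - g z) + (g z - p (/ z)%C)) by ring.
  eapply Rle_trans; [apply Cmod_triangle | lra].
Qed.

Lemma geometric_sum (s : C) (m : nat) :
  (1 - s) * sum_n (fun j => 1 * s ^ j) m = 1 - s ^ S m.
Proof.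
  induction m as [|m IH]; [rewrite sum_O; simpl; ring |].
  rewrite sum_Sn; change plus with Cplus.
  rewrite Cmult_plus_distr_l, IH; simpl; ring.
Qed.

Lemma half_pow_small (B eps : R) : (0 < B)%R -> (0 < eps)%R -> exists m, (B * (/ 2) ^ m <= eps)%R.
Proof.
  intros HB Heps.
  destruct (pow_lt_1_zero (/ 2)) with (y := (eps / B)%R) as [m Hm];
    [rewrite Rabs_pos_eq; lra | now apply Rdiv_lt_0_compat |].
  exists m; specialize (Hm m (Nat.le_refl m)).
  rewrite Rabs_pos_eq in Hm by (apply pow_le; lra).
  apply (Rmult_lt_compat_l B) in Hm; [| exact HB].
  replace (B * (eps / B))%R with eps in Hm by (field; lra); lra.
Qed.

Lemma regular_geometric (r : R) (f : C -> C) :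
  (0 < r)%R -> regular_at_infinity r f ->
  (forall z, (r < Cmod z)%R -> (Cmod (f z) <= / 2)%R) ->
  regular_at_infinity r (fun z => / (1 - f z)).
Proof.
  intros Hr Hf Hhalf; apply regular_limit; intros eps Heps.
  destruct (half_pow_small 1 eps Rlt_0_1 Heps) as [m Hm].
  exists (fun z => sum_n (fun j => 1 * f z ^ j) m); split.
  - apply (regular_poly r (fun s => sum_n (fun j => 1 * s ^ j) m)); [exact Hr | | exact Hf].
    apply (poly_fun_sum (fun _ => 1)).
  - intros z Hz; specialize (Hhalf z Hz).
    assert (Hden : (/ 2 <= Cmod (1 - f z))%R).
    { generalize (Cmod_reverse_triangle 1 (f z)); rewrite Cmod_1; lra. }
    assert (H0 : 1 - f z <> 0) by (apply Cmod_gt_0; lra).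
    replace (/ (1 - f z) - sum_n (fun j => 1 * f z ^ j) m)
      with (/ (1 - f z) * f z ^ S m).
    2: { replace (f z ^ S m) with (1 - (1 - f z) * sum_n (fun j => 1 * f z ^ j) m)
           by (rewrite geometric_sum; ring). field; exact H0. }
    rewrite Cmod_mult, Cmod_inv, Cmod_pow by exact H0.
    apply Rle_trans with (/ / 2 * (/ 2) ^ S m)%R.
    + apply Rmult_le_compat.
      * apply Rlt_le, Rinv_0_lt_compat; lra.
      * apply pow_le, Cmod_ge_0.
      * apply Rinv_le_contravar; lra.
      * apply pow_incr; split; [apply Cmod_ge_0 | exact Hhalf].
    + simpl; lra.
Qed.

(** Every [z ^ (- j - 2)] has a primitive, for only [1 / z] carries a residue;
    a uniform limit of such terms inherits the vanishing integral. *)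
Lemma cycle_integral_regular (cyc : list (list (R -> C))) (r : R) (f : C -> C) :
  C1_cycle cyc -> (0 < r)%R -> (forall z, trace cyc z -> (r < Cmod z)%R) ->
  regular_at_infinity r f -> (forall z, trace cyc z -> Cderivable f z) ->
  cycle_integral cyc (fun z => / z ^ 2 * f z) = 0.
Proof.
  intros Hcyc Hr Htr Hreg Hf.
  assert (H0 : forall z, trace cyc z -> z <> 0).
  { intros z Hz; apply Cmod_gt_0; specialize (Htr z Hz); lra. }
  assert (Hinv : forall z, trace cyc z -> Cderivable (fun y => / y) z)
    by (intros z Hz; apply Cderivable_inv; [apply Cderivable_id | now apply H0]).
  assert (Hinvpow : forall i z, trace cyc z -> Cderivable (fun y => (/ y) ^ i) z)
    by (intros i z Hz; now apply Cderivable_pow, Hinv).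
  assert (Hmono : forall i, cycle_integral cyc (fun z => (/ z) ^ S (S i)) = 0).
  { intros i; apply (cycle_integral_primitive cyc (fun z => - / RtoC (INR (S i)) * (/ z) ^ S i));
      [exact Hcyc | intros z Hz; now apply Cderivable_continuous, Hinvpow |].
    intros z Hz; assert (H := has_Cderivative_scal (- / RtoC (INR (S i))) _ z _
      (has_Cderivative_pow Cinv z _ i (has_Cderivative_inv z (H0 z Hz)))).
    replace ((/ z) ^ S (S i)) with (- / RtoC (INR (S i)) * (RtoC (INR (S i)) * (/ z) ^ i * - / (z * z)));
      [exact H |].
    simpl; field; split; [now apply H0 | apply INR_S_nonzero]. }
  assert (Hpoly : forall p, poly_fun p -> forall i, cycle_integral cyc (fun z => (/ z) ^ S (S i) * p (/ z)%C) = 0).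
  { intros p Hp; induction Hp as [c Q HQ | c Q' Q HQ' IH HQ]; intros i.
    - rewrite (cycle_integral_ext _ _ (fun z => c * (/ z) ^ S (S i))) by (intros z _; rewrite HQ; ring).
      rewrite cycle_integral_scal, Hmono; [ring | exact Hcyc |].
      intros z Hz; now apply Cderivable_continuous, Hinvpow.
    - rewrite (cycle_integral_ext _ _ (fun z => c * (/ z) ^ S (S i) + (/ z) ^ S (S (S i)) * Q' (/ z)%C))
        by (intros z _; rewrite HQ; simpl; ring).
      rewrite cycle_integral_plus, cycle_integral_scal, Hmono, IH; [ring | exact Hcyc | | exact Hcyc | |].
      + intros z Hz; now apply Cderivable_continuous, Hinvpow.
      + intros z Hz; apply Cderivable_continuous, Cderivable_mult;
          [apply Cderivable_const | now apply Hinvpow].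
      + intros z Hz; apply Cderivable_continuous, Cderivable_mult; [now apply Hinvpow |].
        apply (Cderivable_comp Q' (fun y => / y)); [now apply poly_fun_Cderivable | now apply Hinv]. }
  assert (HC2 : forall z, trace cyc z -> Cderivable (fun y => / y ^ 2) z).
  { intros z Hz; apply Cderivable_inv; [apply Cderivable_pow, Cderivable_id | now apply Cpow_nz, H0]. }
  destruct (cycle_integral_bound cyc Hcyc) as [K [HK Hbound]].
  apply Cmod_eq_0, Rle_antisym; [| apply Cmod_ge_0].
  apply Rnot_lt_le; intros Hpos.
  set (J := Cmod _) in Hpos.
  set (eps := (J * (r * r) / (2 * (K + 1)))%R).
  assert (Heps : (0 < eps)%R).
  { apply Rdiv_lt_0_compat; [| lra]; apply Rmult_lt_0_compat; [exact Hpos | nra]. }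
  destruct (Hreg eps Heps) as [p [Hp Happrox]].
  assert (Hp' : forall z, trace cyc z -> Cderivable (fun y => p (/ y)) z).
  { intros z Hz; apply (Cderivable_comp p (fun y => / y)); [now apply poly_fun_Cderivable | now apply Hinv]. }
  assert (C1 : continuous_on_trace cyc (fun z => / z ^ 2 * (f z - p (/ z)))).
  { intros z Hz; apply Cderivable_continuous, Cderivable_mult; [now apply HC2 |].
    apply Cderivable_minus; auto. }
  assert (C2 : continuous_on_trace cyc (fun z => (/ z) ^ 2 * p (/ z))).
  { intros z Hz; apply Cderivable_continuous, Cderivable_mult; [now apply Hinvpow | now apply Hp']. }
  assert (HJ : (J <= eps / (r * r) * K)%R).
  { unfold J; rewrite (cycle_integral_ext _ _
      (fun z => / z ^ 2 * (f z - p (/ z)) + (/ z) ^ 2 * p (/ z)))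
      by (intros z Hz; simpl; field; now apply H0).
    rewrite cycle_integral_plus, (Hpoly p Hp 0%nat), Cplus_0_r by assumption.
    apply Hbound; [apply Rlt_le, Rdiv_lt_0_compat; [exact Heps | nra] | exact C1 |].
    intros z Hz; specialize (Htr z Hz).
    rewrite Cmod_mult, Cmod_inv, Cmod_pow by (now apply Cpow_nz, H0).
    unfold Rdiv; rewrite Rmult_comm; apply Rmult_le_compat.
    - apply Cmod_ge_0.
    - apply Rlt_le, Rinv_0_lt_compat, pow_lt; lra.
    - now apply Happrox.
    - apply Rinv_le_contravar; nra. }
  replace (eps / (r * r) * K)%R with (J / 2 * (K / (K + 1)))%R in HJ by (unfold eps; field; split; nra).
  assert (K / (K + 1) <= 1)%R.
  { apply (Rmult_le_reg_r (K + 1)); [lra |]; unfold Rdiv; rewrite Rmult_assoc, Rinv_l; lra. }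
  nra.
Qed.

(** A Laurent tail convergent for large [z] converges geometrically, hence
    uniformly, from twice that modulus on. *)
Lemma regular_of_series (e : nat -> C) (M : R) (h : C -> C) :
  (forall z, (M < Cmod z)%R ->
     is_series (K := C_AbsRing) (V := C_NormedModule) (fun j => e j * (/ z) ^ S j)%C (h z)) ->
  exists r, (0 < r)%R /\ regular_at_infinity r (fun z => z * h z).
Proof.
  intros Hser.
  set (w0 := (Rabs M + 1)%R).
  assert (Hw0 : (0 < w0)%R) by (unfold w0; generalize (Rabs_pos M); lra).
  assert (HMw0 : (M < w0)%R) by (unfold w0; generalize (Rle_abs M); lra).
  assert (Hconv : forall z, (M < Cmod z)%R -> forall eps, (0 < eps)%R -> exists N, forall m, (N <= m)%nat ->
    (Cmod (sum_n (fun j => e j * (/ z) ^ S j)%C m - h z) < eps)%R).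
  { intros z Hz eps Heps.
    apply (Hser z Hz (fun y => (Cmod (y - h z) < eps)%R)), locally_Cmod.
    exists eps; split; [exact Heps | auto]. }
  assert (Hterms : exists B, (0 < B)%R /\ forall j, (Cmod (e j) <= B * w0 ^ S j)%R).
  { assert (Hw0C : (M < Cmod (RtoC w0))%R) by (rewrite Cmod_R, Rabs_pos_eq; lra).
    destruct (Hconv _ Hw0C 1%R Rlt_0_1) as [N HN].
    set (t := fun j => e j * (/ RtoC w0) ^ S j) in *.
    assert (Hfin : forall N, exists B, (0 < B)%R /\ forall j, (j <= N)%nat -> (Cmod (t j) <= B)%R).
    { intros N'; induction N' as [|N' [B [HB H]]].
      - exists (Cmod (t 0%nat) + 1)%R; split; [generalize (Cmod_ge_0 (t 0%nat)); lra |].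
        intros j Hj; replace j with 0%nat by lia; lra.
      - exists (B + Cmod (t (S N')))%R; split; [generalize (Cmod_ge_0 (t (S N'))); lra |].
        intros j Hj; destruct (Nat.eq_dec j (S N')) as [-> | Hne]; [lra |].
        generalize (H j ltac:(lia)) (Cmod_ge_0 (t (S N'))); lra. }
    destruct (Hfin N) as [B [HB HBj]].
    assert (Ht : forall j, (Cmod (t j) <= B + 2)%R).
    { intros j; destruct (Nat.le_gt_cases j N) as [Hj | Hj]; [generalize (HBj j Hj); lra |].
      destruct j as [|j]; [lia |].
      assert (H1 := HN j ltac:(lia)); assert (H2 := HN (S j) ltac:(lia)).
      rewrite sum_Sn in H2; change plus with Cplus in H2.
      replace (t (S j)) with ((sum_n t j + t (S j) - h (RtoC w0)) - (sum_n t j - h (RtoC w0))) by ring.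
      eapply Rle_trans; [apply Cmod_triangle_minus | lra]. }
    exists (B + 2)%R; split; [lra |]; intros j.
    assert (Hw0n : RtoC w0 <> 0) by (intros E; apply RtoC_inj in E; lra).
    replace (e j) with (t j * RtoC w0 ^ S j).
    2: { unfold t; rewrite Cpow_inv by exact Hw0n; field; now apply Cpow_nz. }
    rewrite Cmod_mult, Cmod_pow, Cmod_R, Rabs_pos_eq by lra.
    apply Rmult_le_compat_r; [apply pow_le; lra | apply Ht]. }
  destruct Hterms as [B [HB He]].
  exists (2 * w0)%R; split; [lra |].
  intros eps Heps.
  destruct (half_pow_small (B * w0) (eps / 2)) as [J HJ]; [nra | lra |].
  exists (fun s => sum_n (fun j => e j * s ^ j) J); split; [apply poly_fun_sum |].
  intros z Hz.
  assert (Hzpos : (0 < Cmod z)%R) by lra.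
  assert (Hz0 : z <> 0) by now apply Cmod_gt_0.
  assert (Hshift : forall m, z * sum_n (fun j => e j * (/ z) ^ S j)%C m = sum_n (fun j => e j * (/ z) ^ j)%C m).
  { intros m; induction m as [|m IH].
    - rewrite !sum_O; simpl; field; exact Hz0.
    - rewrite !sum_Sn; change plus with Cplus; rewrite <- IH; simpl.
      field; exact Hz0. }
  assert (Hterm : forall j, (Cmod (e j * (/ z) ^ j) <= B * w0 * (/ 2) ^ j)%R).
  { intros j; rewrite Cmod_mult, Cmod_pow, Cmod_inv by exact Hz0.
    assert (Hinv : (/ Cmod z <= / 2 * / w0)%R).
    { rewrite <- Rinv_mult; apply Rinv_le_contravar; lra. }
    apply Rle_trans with (B * w0 ^ S j * (/ 2 * / w0) ^ j)%R.
    - apply Rmult_le_compat; [apply Cmod_ge_0 | apply pow_le, Rlt_le, Rinv_0_lt_compat; lra | apply He |].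
      apply pow_incr; split; [apply Rlt_le, Rinv_0_lt_compat; lra | exact Hinv].
    - apply Req_le; rewrite Rpow_mult_distr, (pow_inv w0); simpl; generalize ((/ 2) ^ j)%R; intros t.
      field; apply pow_nonzero; lra. }
  assert (Htail : forall i, (Cmod (sum_n (fun j => e j * (/ z) ^ j)%C (i + J)
      - sum_n (fun j => e j * (/ z) ^ j)%C J) <= B * w0 * ((/ 2) ^ J - (/ 2) ^ (i + J)))%R).
  { intros i; induction i as [|i IH].
    - change (0 + J)%nat with J.
      replace (sum_n (fun j => e j * (/ z) ^ j)%C J - sum_n (fun j => e j * (/ z) ^ j)%C J) with (RtoC 0) by ring.
      rewrite Cmod_0; lra.
    - change (S i + J)%nat with (S (i + J)); rewrite sum_Sn; change plus with Cplus.
      specialize (Hterm (S (i + J))).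
      replace (sum_n (fun j => e j * (/ z) ^ j)%C (i + J) + e (S (i + J)) * (/ z) ^ S (i + J)
               - sum_n (fun j => e j * (/ z) ^ j)%C J)
        with ((sum_n (fun j => e j * (/ z) ^ j)%C (i + J) - sum_n (fun j => e j * (/ z) ^ j)%C J)
              + e (S (i + J)) * (/ z) ^ S (i + J)) by ring.
      eapply Rle_trans; [apply Cmod_triangle |].
      eapply Rle_trans; [apply Rplus_le_compat; [exact IH | exact Hterm] |].
      simpl; lra. }
  destruct (Hconv z ltac:(lra) (eps / 2 / Cmod z)%R) as [N HN]; [apply Rdiv_lt_0_compat; lra |].
  specialize (HN (N + J)%nat ltac:(lia)); specialize (Htail N).
  assert (Hhead : (Cmod (z * h z - sum_n (fun j => e j * (/ z) ^ j)%C (N + J)) <= eps / 2)%R).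
  { rewrite <- Hshift.
    replace (z * h z - z * sum_n (fun j => e j * (/ z) ^ S j)%C (N + J))
      with (z * (h z - sum_n (fun j => e j * (/ z) ^ S j)%C (N + J))) by ring.
    rewrite Cmod_mult, Cmod_minus_sym.
    apply Rle_trans with (Cmod z * (eps / 2 / Cmod z))%R; [apply Rmult_le_compat_l; lra |].
    apply Req_le; field; lra. }
  assert (Hpos : (0 <= B * w0 * (/ 2) ^ (N + J))%R).
  { apply Rmult_le_pos; [nra | apply pow_le; lra]. }
  replace (z * h z - sum_n (fun j => e j * (/ z) ^ j)%C J)
    with ((z * h z - sum_n (fun j => e j * (/ z) ^ j)%C (N + J))
          + (sum_n (fun j => e j * (/ z) ^ j)%C (N + J) - sum_n (fun j => e j * (/ z) ^ j)%C J)) by ring.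
  eapply Rle_trans; [apply Cmod_triangle | lra].
Qed.

(** * The polynomial preimage *)

Definition monomial_shift (alpha alpha0 : R) (n : nat) (z : C) : C :=
  RtoC alpha * z ^ n + RtoC alpha0.

Lemma monomial_shift_poly (alpha alpha0 : R) (n : nat) : poly_fun (monomial_shift alpha alpha0 n).
Proof.
  apply poly_fun_plus; [apply poly_fun_scal, poly_fun_pow | now apply (poly_const (RtoC alpha0))].
Qed.

Lemma pow_ge_base (x : R) (n : nat) : (1 <= x)%R -> (1 <= n)%nat -> (x <= x ^ n)%R.
Proof.
  intros Hx Hn; destruct n as [|n]; [lia |].
  generalize (pow_R1_Rle x n Hx); simpl; nra.
Qed.

Lemma monomial_shift_large (alpha alpha0 : R) (n : nat) (R : R) :
  (0 < alpha)%R -> (1 <= n)%nat ->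
  C_infty (fun z => (R < Cmod (monomial_shift alpha alpha0 n z))%R).
Proof.
  intros Ha Hn; exists (Rmax 1 ((Rabs R + Rabs alpha0) / alpha)); intros z Hz.
  generalize (Rmax_l 1 ((Rabs R + Rabs alpha0) / alpha)) (Rmax_r 1 ((Rabs R + Rabs alpha0) / alpha)); intros H1 H2.
  assert (Hpow := pow_ge_base (Cmod z) n ltac:(lra) Hn).
  assert (Hlt : (Rabs R + Rabs alpha0 < alpha * Cmod z ^ n)%R).
  { apply Rle_lt_trans with (alpha * ((Rabs R + Rabs alpha0) / alpha))%R;
      [apply Req_le; field; lra | apply Rmult_lt_compat_l; lra]. }
  generalize (Cmod_triangle_minus (monomial_shift alpha alpha0 n z) (RtoC alpha0)) (Rle_abs R).
  unfold monomial_shift at 1.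
  replace (alpha * z ^ n + alpha0 - alpha0) with (alpha * z ^ n) by ring.
  rewrite Cmod_mult, Cmod_pow, !Cmod_R, (Rabs_pos_eq alpha) by lra; lra.
Qed.

Lemma regular_inv_monomial_shift (alpha alpha0 : R) (n : nat) :
  (0 < alpha)%R -> (1 <= n)%nat ->
  exists r, (0 < r)%R /\ regular_at_infinity r (fun z => z / monomial_shift alpha alpha0 n z).
Proof.
  intros Ha Hn.
  set (r := Rmax 1 (2 * Rabs alpha0 / alpha)).
  assert (Hr1 : (1 <= r)%R) by apply Rmax_l.
  assert (Hr2 : (2 * Rabs alpha0 / alpha <= r)%R) by apply Rmax_r.
  assert (Ha0 : RtoC alpha <> 0) by (intros E; apply RtoC_inj in E; lra).
  exists r; split; [lra |].
  set (g := fun z : C => - (RtoC alpha0 / RtoC alpha) * (/ z) ^ n).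
  assert (Hg : regular_at_infinity r g).
  { apply (regular_poly_inv r (fun s => - (RtoC alpha0 / RtoC alpha) * s ^ n)).
    apply poly_fun_scal, poly_fun_pow. }
  assert (Hhalf : forall z, (r < Cmod z)%R -> (Cmod (g z) <= / 2)%R).
  { intros z Hz; unfold g.
    assert (Hz0 : z <> 0) by (apply Cmod_gt_0; lra).
    rewrite Cmod_mult, Cmod_opp, Cmod_pow, Cmod_inv, Cmod_div, !Cmod_R, (Rabs_pos_eq alpha) by (auto; lra).
    assert (Hpow := pow_ge_base (Cmod z) n ltac:(lra) Hn).
    rewrite pow_inv.
    apply (Rmult_le_reg_r (Cmod z ^ n)); [apply pow_lt; lra |].
    rewrite Rmult_assoc, Rinv_l, Rmult_1_r by (apply pow_nonzero; lra).
    unfold Rdiv in *; lra. }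
  apply (regular_ext r (fun z => (/ RtoC alpha * (/ z) ^ pred n) * / (1 - g z))).
  - intros z Hz; specialize (Hhalf z Hz).
    assert (Hz0 : z <> 0) by (apply Cmod_gt_0; lra).
    assert (Hden : 1 - g z <> 0).
    { apply Cmod_gt_0; generalize (Cmod_reverse_triangle 1 (g z)); rewrite Cmod_1; lra. }
    destruct n as [|n]; [lia |].
    assert (HP : monomial_shift alpha alpha0 (S n) z = RtoC alpha * z ^ S n * (1 - g z)).
    { unfold monomial_shift, g; rewrite Cpow_inv by exact Hz0; field.
      split; [now apply (Cpow_nz z (S n)) | exact Ha0]. }
    rewrite HP; simpl pred; rewrite Cpow_inv by exact Hz0; simpl Cpow; field.
    repeat split; auto using Cpow_nz.
  - apply regular_mult; [lra | | now apply regular_geometric; [lra | |]].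
    apply (regular_poly_inv r (fun s => / RtoC alpha * s ^ pred n)), poly_fun_scal, poly_fun_pow.
Qed.

Lemma regular_weaken (r r' : R) (f : C -> C) :
  (r <= r')%R -> regular_at_infinity r f -> regular_at_infinity r' f.
Proof.
  intros Hr Hf eps Heps; destruct (Hf eps Heps) as [p [Hp H]].
  exists p; split; [exact Hp |]; intros z Hz; apply H; lra.
Qed.

(** With [h] vanishing at infinity, the integrand is [O(1 / y ^ 2)]: it is
    [/ y ^ 2] times [(y / P(y)) (P(y) h(P(y))) / (1 - z / y)]. *)
Lemma laurent_tail_integral (e : nat -> C) (M : R) (h : C -> C) (alpha alpha0 : R) (n : nat) (z : C) :
  (0 < alpha)%R -> (1 <= n)%nat ->
  (forall w, (M < Cmod w)%R ->
     is_series (K := C_AbsRing) (V := C_NormedModule) (fun j => e j * (/ w) ^ S j) (h w)) ->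
  exists r, forall cyc, C1_cycle cyc -> (forall y, trace cyc y -> (r < Cmod y)%R) ->
    (forall y, trace cyc y -> Cderivable (fun y => h (monomial_shift alpha alpha0 n y)) y) ->
    cycle_integral cyc (fun y => h (monomial_shift alpha alpha0 n y) / (y - z)) = 0.
Proof.
  intros Ha Hn Hser; set (P := monomial_shift alpha alpha0 n).
  destruct (regular_of_series e M h Hser) as [r1 [Hr1 Hh]].
  destruct (regular_inv_monomial_shift alpha alpha0 n Ha Hn) as [r2 [Hr2 HP]].
  destruct (monomial_shift_large alpha alpha0 n r1 Ha Hn) as [r3 Hlarge].
  set (r := Rmax (Rmax r2 r3) (2 * Cmod z + 1)).
  assert (Hr : (r2 <= r /\ r3 <= r /\ 2 * Cmod z + 1 <= r)%R).
  { unfold r; generalize (Rmax_l (Rmax r2 r3) (2 * Cmod z + 1)) (Rmax_r (Rmax r2 r3) (2 * Cmod z + 1))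
      (Rmax_l r2 r3) (Rmax_r r2 r3); lra. }
  assert (Hz := Cmod_ge_0 z).
  assert (HP0 : forall y, (r < Cmod y)%R -> P y <> 0).
  { intros y Hy; apply Cmod_gt_0; specialize (Hlarge y ltac:(lra)); fold P in Hlarge; lra. }
  assert (Hy0 : forall y, (r < Cmod y)%R -> y <> 0) by (intros y Hy; apply Cmod_gt_0; lra).
  assert (Hyz : forall y, (r < Cmod y)%R -> y - z <> 0).
  { intros y Hy; apply Cmod_gt_0; generalize (Cmod_reverse_triangle y z); lra. }
  exists r; intros cyc Hcyc Htr Hder.
  set (f := fun y => (y / P y) * (P y * h (P y)) * / (1 - z * / y)).
  assert (HregP : regular_at_infinity r (fun y => y / P y)) by (apply (regular_weaken r2); [lra | exact HP]).
  assert (Hreg : regular_at_infinity r f).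
  { apply regular_mult; [lra | apply regular_mult; [lra | exact HregP |] |].
    - apply regular_limit; intros eps Heps; destruct (Hh eps Heps) as [p [Hp H]].
      exists (fun y => p (/ P y)); split.
      + apply (regular_poly r p (fun y => / P y)); [lra | exact Hp |].
        apply (regular_ext r (fun y => / y * (y / P y))).
        * intros y Hy; field; split; auto.
        * apply regular_mult; [lra | | exact HregP].
          apply (regular_poly_inv r (fun s => s)), (poly_fun_ext (fun s => s ^ 1)), poly_fun_pow.
          intros s; simpl; ring.
      + intros y Hy; apply H, Hlarge; lra.
    - apply (regular_geometric r (fun y => z * / y)); [lra | |].
      + apply (regular_poly_inv r (fun s => z * s)), poly_fun_scal, (poly_fun_ext (fun s => s ^ 1)), poly_fun_pow.
        intros s; simpl; ring.
      + intros y Hy; rewrite Cmod_mult, Cmod_inv by auto.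
        apply (Rmult_le_reg_r (Cmod y)); [lra |].
        rewrite Rmult_assoc, Rinv_l; lra. }
  rewrite (cycle_integral_ext _ _ (fun y => / y ^ 2 * f y)).
  - apply (cycle_integral_regular cyc r); [exact Hcyc | lra | exact Htr | exact Hreg |].
    intros y Hy; assert (Hy' := Htr y Hy).
    assert (HdP : Cderivable P y) by apply poly_fun_Cderivable, monomial_shift_poly.
    apply Cderivable_mult; [apply Cderivable_mult |].
    + apply Cderivable_div; [apply Cderivable_id | exact HdP | now apply HP0].
    + apply Cderivable_mult; [exact HdP | now apply Hder].
    + apply Cderivable_inv.
      * apply Cderivable_minus; [apply Cderivable_const |].
        apply Cderivable_mult; [apply Cderivable_const |].
        apply Cderivable_inv; [apply Cderivable_id | now apply Hy0].
      * specialize (Hyz y Hy'); intros E; apply Hyz.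
        replace (y - z) with (y * (1 - z * / y)) by (field; now apply Hy0); rewrite E; ring.
  - intros y Hy; specialize (Htr y Hy); unfold f; field; repeat split; auto.
Qed.

(** * Compact sets *)

Lemma list_nat_bounded (l : list nat) : exists N, forall i, In i l -> (i <= N)%nat.
Proof.
  induction l as [|i l [N HN]]; [exists 0%nat; intros i [] |].
  exists (max i N); intros j [<- | Hj]; [lia |]; specialize (HN j Hj); lia.
Qed.

Lemma compact_set_bounded (A : C -> Prop) : compact_set A -> bounded_set A.
Proof.
  intros HA; destruct (HA nat (fun i z => (Cmod z < INR i)%R)) as [l Hl].
  - intros i; apply open_Cmod; intros z Hz.
    exists (INR i - Cmod z)%R; split; [lra |]; intros y Hy.
    generalize (Cmod_reverse_triangle y z); lra.
  - intros z _; destruct (nfloor_ex (Cmod z) (Cmod_ge_0 z)) as [i Hi].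
    exists (S i); rewrite S_INR; lra.
  - destruct (list_nat_bounded l) as [N HN].
    exists (INR N); intros z Hz; destruct (Hl z Hz) as [i [Hi Hzi]].
    specialize (HN i Hi); apply le_INR in HN; lra.
Qed.

Lemma compact_set_closed (A : C -> Prop) : compact_set A -> closed_set A.
Proof.
  intros HA z Hz; destruct (HA nat (fun i y => (/ INR (S i) < Cmod (y - z))%R)) as [l Hl].
  - intros i; apply open_Cmod; intros y Hy.
    exists (Cmod (y - z) - / INR (S i))%R; split; [lra |]; intros y' Hy'.
    generalize (Cmod_reverse_triangle (y - z) (y' - z)).
    replace (y - z - (y' - z)) with (y - y') by ring; rewrite (Cmod_minus_sym y y'); lra.
  - intros y Hy.
    assert (Hpos : (0 < Cmod (y - z))%R).
    { apply Cmod_gt_0; intros E; apply Hz; apply Ceq_minus in E; now rewrite <- E. }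
    destruct (nfloor_ex (/ Cmod (y - z))) as [i Hi]; [now apply Rlt_le, Rinv_0_lt_compat |].
    exists i; rewrite <- (Rinv_inv (Cmod (y - z))); apply Rinv_lt_contravar; rewrite S_INR; [| lra].
    apply Rmult_lt_0_compat; [now apply Rinv_0_lt_compat | generalize (pos_INR i); lra].
  - destruct (list_nat_bounded l) as [N HN].
    assert (HNpos : (0 < INR (S N))%R) by (apply lt_0_INR; lia).
    exists (/ INR (S N))%R; split; [now apply Rinv_0_lt_compat |]; intros y Hy HAy.
    destruct (Hl y HAy) as [i [Hi Hyi]]; specialize (HN i Hi).
    assert (/ INR (S N) <= / INR (S i))%R.
    { apply Rinv_le_contravar; [apply lt_0_INR; lia | apply le_INR; lia]. }
    lra.
Qed.

(** * Periodic sequences of foci *)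

Definition periodic (n : nat) (beta : nat -> C) : Prop :=
  forall j, (1 <= j)%nat -> beta (j + n)%nat = beta j.

Lemma periodic_map_seq (n : nat) (beta : nat -> C) (k : nat) :
  periodic n beta ->
  map beta (seq 1 (S k * n)) = map beta (seq 1 n) ++ map beta (seq 1 (k * n)).
Proof.
  intros Hper; change (S k * n)%nat with (n + k * n)%nat.
  rewrite seq_app, map_app; f_equal.
  assert (Hshift : forall m s, (1 <= s)%nat -> map beta (seq (s + n) m) = map beta (seq s m)).
  { intros m; induction m as [|m IH]; intros s Hs; [reflexivity |].
    simpl; f_equal; [now apply Hper | apply (IH (S s)); lia]. }
  now apply Hshift.
Qed.

Lemma u_poly_periodic (n : nat) (beta : nat -> C) (k : nat) (w : C) :
  periodic n beta -> u_poly beta (k * n) w = u_poly beta n w ^ k.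
Proof.
  intros Hper; unfold u_poly.
  assert (Hmap : forall m, map (fun j => w - beta j) (seq 1 m) = map (fun b => w - b) (map beta (seq 1 m)))
    by (intros m; now rewrite map_map).
  rewrite !Hmap; induction k as [|k IH]; [reflexivity |].
  rewrite periodic_map_seq, map_app, fold_right_app, IH by exact Hper.
  rewrite Cpow_S; generalize (map (fun b => w - b) (map beta (seq 1 n))); intros l.
  assert (Hacc : forall x, fold_right Cmult x l = fold_right Cmult 1 l * x)
    by (intros x; induction l as [|y l IHl]; simpl; [ring | rewrite IHl; ring]).
  apply Hacc.
Qed.

Lemma count_occ_periodic (n : nat) (beta : nat -> C) (k : nat) (b : C) :
  periodic n beta ->
  count_occ Ceq_dec (map beta (seq 1 (k * n))) b = (k * count_occ Ceq_dec (map beta (seq 1 n)) b)%nat.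
Proof.
  intros Hper; induction k as [|k IH]; [reflexivity |].
  now rewrite periodic_map_seq, count_occ_app, IH by exact Hper.
Qed.

(** The bounded discrepancy determines the exponents from the frequencies. *)
Lemma admissible_periodic_exponents (N : nat) (a : nat -> C) (m : nat -> R) (n : nat) (beta : nat -> C) :
  (1 <= n)%nat -> periodic n beta -> admissible N a m beta ->
  forall j, (1 <= j <= N)%nat ->
    INR (count_occ Ceq_dec (map beta (seq 1 n)) (a j)) = (INR n * m j)%R.
Proof.
  intros Hn Hper [_ [A [HA Hadm]]] j Hj.
  set (nu := count_occ Ceq_dec (map beta (seq 1 n)) (a j)).
  assert (Hk : forall k, (1 <= k)%nat -> (INR k * Rabs (INR nu - INR n * m j) <= A)%R).
  { intros k Hk; specialize (Hadm (k * n)%nat j ltac:(nia) Hj).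
    rewrite count_occ_periodic in Hadm by exact Hper; fold nu in Hadm.
    rewrite !mult_INR in Hadm.
    replace (INR k * INR nu - INR k * INR n * m j)%R with (INR k * (INR nu - INR n * m j))%R in Hadm by ring.
    rewrite Rabs_mult, (Rabs_pos_eq (INR k)) in Hadm by apply pos_INR; exact Hadm. }
  apply Rminus_diag_uniq; destruct (Req_dec (INR nu - INR n * m j) 0) as [E | Hne]; [exact E |].
  assert (Hpos := Rabs_pos_lt _ Hne).
  destruct (nfloor_ex (A / Rabs (INR nu - INR n * m j))) as [k [_ Hlt]].
  { apply Rlt_le, Rdiv_lt_0_compat; lra. }
  specialize (Hk (S k) ltac:(lia)); rewrite S_INR in Hk.
  apply (Rmult_lt_compat_r (Rabs (INR nu - INR n * m j))) in Hlt; [| exact Hpos].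
  replace (A / Rabs (INR nu - INR n * m j) * Rabs (INR nu - INR n * m j))%R with A in Hlt by (field; lra).
  lra.
Qed.

Lemma prod_modify_one (f g : C -> R) (x : C) (J : list C) :
  NoDup J -> In x J -> (forall y, In y J -> y <> x -> g y = f y) ->
  forall c, g x = (c * f x)%R ->
  fold_right Rmult 1%R (map g J) = (c * fold_right Rmult 1%R (map f J))%R.
Proof.
  intros HJ Hx Hg c Hc; induction HJ as [|y J Hy HJ IH]; [destruct Hx |].
  simpl; destruct Hx as [-> | Hx].
  - rewrite Hc, (map_ext_in g f); [ring |].
    intros z Hz; apply Hg; [now right | intros ->; contradiction].
  - rewrite IH, Hg; [ring | now left | intros ->; contradiction | exact Hx |].
    intros z Hz; apply Hg; now right.
Qed.

Lemma prod_count_occ (phi : C -> R) (J l : list C) :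
  NoDup J -> incl l J ->
  fold_right Rmult 1%R (map phi l) =
  fold_right Rmult 1%R (map (fun y => (phi y ^ count_occ Ceq_dec l y)%R) J).
Proof.
  intros HJ; induction l as [|x l IH]; intros Hl.
  - simpl; clear HJ Hl; induction J as [|y J IHJ]; simpl; [reflexivity | rewrite <- IHJ; ring].
  - simpl map; simpl fold_right; rewrite IH by (intros y Hy; apply Hl; now right).
    symmetry; apply (prod_modify_one _ _ x); [exact HJ | apply Hl; now left | |].
    + intros y _ Hy; destruct (Ceq_dec x y); [congruence | reflexivity].
    + destruct (Ceq_dec x x); [reflexivity | congruence].
Qed.

Lemma abs_pow_pow (x m : R) (n nu : nat) :
  (0 <= x)%R -> (1 <= n)%nat -> (0 < m)%R -> INR nu = (INR n * m)%R ->
  (abs_pow x m ^ n = x ^ nu)%R.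
Proof.
  intros Hx Hn Hm Hnu; unfold abs_pow.
  destruct (Req_dec_T x 0) as [-> | Hx0].
  - assert (Hnu0 : (nu <> 0)%nat).
    { intros ->; simpl in Hnu; assert (0 < INR n)%R by (apply lt_0_INR; lia).
      assert (0 < INR n * m)%R by (apply Rmult_lt_0_compat; lra); lra. }
    rewrite !pow_i by lia; reflexivity.
  - assert (Hxp : (0 < x)%R) by lra.
    rewrite <- Rpower_pow by apply exp_pos.
    rewrite Rpower_mult, <- Rpower_pow by exact Hxp.
    f_equal; rewrite Hnu; ring.
Qed.

Lemma fold_right_Rmult_pow (l : list R) (n : nat) :
  (fold_right Rmult 1 l ^ n = fold_right Rmult 1 (map (fun x => x ^ n) l))%R.
Proof.
  induction l as [|x l IH]; simpl; [apply pow1 | now rewrite Rpow_mult_distr, IH].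
Qed.

Lemma Cmod_u_poly (beta : nat -> C) (n : nat) (w : C) :
  Cmod (u_poly beta n w) = fold_right Rmult 1%R (map (fun b => Cmod (w - b)) (map beta (seq 1 n))).
Proof.
  unfold u_poly; rewrite map_map; induction (seq 1 n) as [|j l IH]; simpl;
    [apply Cmod_1 | now rewrite Cmod_mult, IH].
Qed.

(** Over one period, each focus occurs [n] times its exponent, so the modulus of
    the product is the [n]-th power of the modulus that defines the lemniscatic
    domain, whatever foci and exponents describe it. *)
Lemma Cmod_u_poly_period (N : nat) (a : nat -> C) (m : nat -> R) (mu : R) (n : nat) (beta : nat -> C) (w : C) :
  (1 <= n)%nat -> periodic n beta -> lemniscatic_data N a m mu -> admissible N a m beta ->
  Cmod (u_poly beta n w) = (abs_U N a m w ^ n)%R.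
Proof.
  intros Hn Hper [_ [Hinj [Hm _]]] Hadm.
  assert (Hnu := admissible_periodic_exponents N a m n beta Hn Hper Hadm).
  rewrite Cmod_u_poly, (prod_count_occ _ (map a (seq 1 N))).
  - unfold abs_U; rewrite fold_right_Rmult_pow, !map_map; f_equal; apply map_ext_in.
    intros j Hj; apply in_seq in Hj; symmetry; apply abs_pow_pow;
      [apply Cmod_ge_0 | exact Hn | apply Hm; lia | apply Hnu; lia].
  - apply NoDup_map_NoDup_ForallPairs; [| apply seq_NoDup].
    intros i j Hi Hj; apply in_seq in Hi; apply in_seq in Hj; apply Hinj; lia.
  - intros b Hb; apply in_map_iff in Hb; destruct Hb as [j [<- Hj]]; apply in_seq in Hj.
    destruct Hadm as [Hval _]; destruct (Hval j ltac:(lia)) as [i [Hi ->]].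
    apply in_map, in_seq; lia.
Qed.

Lemma u_poly_poly_fun (beta : nat -> C) (k : nat) : poly_fun (u_poly beta k).
Proof.
  unfold u_poly; induction (seq 1 k) as [|j l IH]; [now apply (poly_const 1) |].
  apply (poly_fun_mult (fun w => w - beta j)); [| exact IH].
  apply (poly_horner (- beta j) (fun _ => 1)); [now apply (poly_const 1) |]; intros z; ring.
Qed.

(** * Limits at infinity *)

Definition limit_at_infinity (f : C -> C) (l : C) : Prop :=
  forall eps, (0 < eps)%R -> C_infty (fun z => (Cmod (f z - l) <= eps)%R).

Lemma limit_ext (f g : C -> C) (l : C) :
  C_infty (fun z => f z = g z) -> limit_at_infinity f l -> limit_at_infinity g l.
Proof.
  intros E Hf eps Heps; generalize (C_infty_and _ _ E (Hf eps Heps)); apply C_infty_imp.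
  intros z [<- H]; exact H.
Qed.

Lemma limit_mult (f g : C -> C) (l m : C) :
  limit_at_infinity f l -> limit_at_infinity g m ->
  limit_at_infinity (fun z => f z * g z) (l * m).
Proof.
  intros Hf Hg eps Heps.
  assert (Hl := Cmod_ge_0 l); assert (Hm := Cmod_ge_0 m).
  set (e := Rmin 1 (eps / (2 + Cmod l + Cmod m))).
  assert (He : (0 < e)%R) by (apply Rmin_glb_lt; [lra | apply Rdiv_lt_0_compat; lra]).
  assert (He1 : (e <= 1)%R) by apply Rmin_l.
  assert (He2 : (e * (2 + Cmod l + Cmod m) <= eps)%R).
  { apply Rle_trans with (eps / (2 + Cmod l + Cmod m) * (2 + Cmod l + Cmod m))%R.
    - apply Rmult_le_compat_r; [lra | apply Rmin_r].
    - apply Req_le; field; lra. }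
  generalize (C_infty_and _ _ (Hf e He) (Hg e He)); apply C_infty_imp.
  intros z [H1 H2].
  replace (f z * g z - l * m) with ((f z - l) * (g z - m) + ((f z - l) * m + l * (g z - m))) by ring.
  eapply Rle_trans; [apply Cmod_triangle |].
  eapply Rle_trans; [apply Rplus_le_compat_l, Cmod_triangle |].
  rewrite !Cmod_mult.
  assert (K1 : (Cmod (f z - l) * Cmod (g z - m) <= e * 1)%R)
    by (apply Rmult_le_compat; try apply Cmod_ge_0; lra).
  assert (K2 : (Cmod (f z - l) * Cmod m <= e * Cmod m)%R) by (apply Rmult_le_compat_r; lra).
  assert (K3 : (Cmod l * Cmod (g z - m) <= Cmod l * e)%R) by (apply Rmult_le_compat_l; lra).
  lra.
Qed.

Lemma limit_inv (f : C -> C) (l : C) :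
  l <> 0 -> limit_at_infinity f l -> limit_at_infinity (fun z => / f z) (/ l).
Proof.
  intros Hl0 Hf eps Heps.
  assert (Hl := proj1 (Cmod_gt_0 l) Hl0).
  set (e := Rmin (Cmod l / 2) (eps * (Cmod l * Cmod l) / 2)).
  assert (Hll : (0 < Cmod l * Cmod l)%R) by nra.
  assert (He : (0 < e)%R) by (apply Rmin_glb_lt; nra).
  assert (He1 : (e <= Cmod l / 2)%R) by apply Rmin_l.
  assert (He2 : (e <= eps * (Cmod l * Cmod l) / 2)%R) by apply Rmin_r.
  generalize (Hf e He); apply C_infty_imp; intros z H.
  assert (Hfz : (Cmod l / 2 <= Cmod (f z))%R).
  { generalize (Cmod_reverse_triangle l (f z)); rewrite Cmod_minus_sym; lra. }
  assert (Hf0 : f z <> 0) by (apply Cmod_gt_0; lra).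
  replace (/ f z - / l) with ((l - f z) / (f z * l)) by (field; auto).
  rewrite Cmod_div, Cmod_mult, Cmod_minus_sym by now apply Cmult_neq_0.
  apply (Rmult_le_reg_r (Cmod (f z) * Cmod l)); [nra |].
  unfold Rdiv; rewrite Rmult_assoc, Rinv_l, Rmult_1_r by (apply Rgt_not_eq; nra).
  assert (eps * (Cmod l / 2 * Cmod l) <= eps * (Cmod (f z) * Cmod l))%R
    by (apply Rmult_le_compat_l; [lra | apply Rmult_le_compat_r; lra]).
  lra.
Qed.

Lemma limit_inv_id (c : C) : limit_at_infinity (fun z => 1 - c / z) 1.
Proof.
  intros eps Heps; exists (Cmod c / eps)%R; intros z Hz.
  assert (Hz0 : (0 < Cmod z)%R).
  { eapply Rle_lt_trans; [| exact Hz]; apply Rdiv_le_0_compat; [apply Cmod_ge_0 | exact Heps]. }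
  replace (1 - c / z - 1) with (- (c / z)) by ring.
  rewrite Cmod_opp, Cmod_div by now apply Cmod_gt_0.
  apply (Rmult_le_reg_r (Cmod z)); [exact Hz0 |].
  unfold Rdiv at 1; rewrite Rmult_assoc, Rinv_l, Rmult_1_r by lra.
  apply (Rmult_lt_compat_l eps) in Hz; [| exact Heps].
  replace (eps * (Cmod c / eps))%R with (Cmod c) in Hz by (field; lra); lra.
Qed.

Lemma limit_const (c : C) : limit_at_infinity (fun _ => c) c.
Proof.
  intros eps Heps; exists 0%R; intros z _.
  replace (c - c) with (RtoC 0) by ring; rewrite Cmod_0; lra.
Qed.

Lemma limit_simple_pole (f : C -> C) (d : R) :
  limit_at_infinity (fun z => f z / z) (RtoC d) -> simple_pole f d.
Proof.
  intros Hf eps Heps; generalize (Hf eps Heps); intros [M HM].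
  exists (Rmax M 0); intros z Hz.
  assert (H1 := Rmax_l M 0); assert (H2 := Rmax_r M 0).
  assert (Hz0 : z <> 0) by (apply Cmod_gt_0; lra).
  specialize (HM z ltac:(lra)).
  replace (f z - RtoC d * z) with ((f z / z - RtoC d) * z) by (field; exact Hz0).
  rewrite Cmod_mult; apply Rmult_le_compat_r; [apply Cmod_ge_0 | exact HM].
Qed.

Lemma C_infty_nonzero : C_infty (fun z => z <> 0).
Proof. exists 0%R; intros z Hz; now apply Cmod_gt_0. Qed.

Lemma limit_u_poly (beta : nat -> C) (n : nat) (f : C -> C) :
  limit_at_infinity (fun z => f z / z) 1 ->
  limit_at_infinity (fun z => u_poly beta n (f z) / z ^ n) 1.
Proof.
  intros Hf.
  assert (Hlist : forall l : list nat, limit_at_infinity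
    (fun z => fold_right Cmult 1 (map (fun j => f z - beta j) l) / z ^ length l) 1).
  2: { generalize (Hlist (seq 1 n)); now rewrite length_seq. }
  intros l; induction l as [|j l IH].
  - apply (limit_ext (fun _ => 1)); [exists 0%R; intros; simpl; field | apply limit_const].
  - apply (limit_ext (fun z => (f z - beta j) / z * (fold_right Cmult 1 (map (fun j => f z - beta j) l) / z ^ length l))).
    + generalize C_infty_nonzero; apply C_infty_imp; intros z Hz; simpl.
      field; split; [now apply Cpow_nz | exact Hz].
    + refine (eq_ind (1 * 1) (limit_at_infinity _) _ 1 (Cmult_1_l 1)); apply limit_mult; [| exact IH].
      intros eps Heps.
      assert (H1 := Hf (eps / 2)%R ltac:(lra)); assert (H2 := limit_inv_id (beta j) (eps / 2)%R ltac:(lra)).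
      generalize (C_infty_and _ _ C_infty_nonzero (C_infty_and _ _ H1 H2)); apply C_infty_imp.
      intros z [Hz [K1 K2]].
      replace ((f z - beta j) / z - 1) with ((f z / z - 1) + (1 - beta j / z - 1)) by (field; exact Hz).
      eapply Rle_trans; [apply Cmod_triangle | lra].
Qed.

Lemma limit_monomial_shift (alpha alpha0 : R) (n : nat) :
  (1 <= n)%nat ->
  limit_at_infinity (fun z => monomial_shift alpha alpha0 n z / z ^ n) (RtoC alpha).
Proof.
  intros Hn eps Heps; exists (Rmax 1 (Rabs alpha0 / eps)); intros z Hz.
  generalize (Rmax_l 1 (Rabs alpha0 / eps)) (Rmax_r 1 (Rabs alpha0 / eps)); intros H1 H2.
  assert (Hz0 : z <> 0) by (apply Cmod_gt_0; lra).
  assert (Hzn : z ^ n <> 0) by now apply Cpow_nz.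
  assert (Hpow := pow_ge_base (Cmod z) n ltac:(lra) Hn).
  unfold monomial_shift.
  replace ((alpha * z ^ n + alpha0) / z ^ n - alpha) with (RtoC alpha0 / z ^ n) by (field; exact Hzn).
  rewrite Cmod_div, Cmod_pow, Cmod_R by exact Hzn.
  apply (Rmult_le_reg_r (Cmod z ^ n)); [lra |].
  unfold Rdiv; rewrite Rmult_assoc, Rinv_l, Rmult_1_r by lra.
  apply Rle_trans with (eps * (Rabs alpha0 / eps))%R; [apply Req_le; field; lra |].
  apply Rmult_le_compat_l; lra.
Qed.

(** * Level curves *)

(** A connected set through [z] that avoids the level curve stays in the
    sublevel set, which is open together with [E] because [|X| <= c' < c] near
    [E], and which is bounded because [X] is large near infinity. *)
Lemma interior_of_level (E : C -> Prop) (X : C -> C) (Gamma : C -> Prop) (c c' : R) (z : C) :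
  closed_set E -> (forall y, ~ E y -> Ccontinuous X y) ->
  (c' < c)%R -> near_boundary E (fun y => (Cmod (X y) <= c')%R) ->
  C_infty (fun y => ~ E y /\ (c < Cmod (X y))%R) ->
  (forall y, Gamma y <-> ~ E y /\ Cmod (X y) = c) ->
  (~ E z -> (Cmod (X z) < c)%R) ->
  interior_of Gamma z.
Proof.
  intros HE HX Hc Hnear [M HM] HGamma Hz.
  split; [rewrite HGamma; intros [HEz Ec]; specialize (Hz HEz); lra |].
  intros S HS HSz HSG.
  set (U := fun y => ~ (~ E y /\ (c <= Cmod (X y))%R)).
  set (V := fun y => ~ E y /\ (c < Cmod (X y))%R).
  assert (HU : open U) by (apply open_Cmod, (closed_superlevel E X c c'); assumption).
  assert (HV : open V).
  { apply open_Cmod; intros y [HEy Hy].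
    destruct (HE y HEy) as [d1 [Hd1 H1]].
    destruct (Ccontinuous_Cmod X y (Cmod (X y) - c)) as [d2 [Hd2 H2]]; [now apply HX | lra |].
    exists (Rmin d1 d2); split; [now apply Rmin_glb_lt |]; intros y' Hy'.
    generalize (Rmin_l d1 d2) (Rmin_r d1 d2); intros.
    split; [apply H1; lra |].
    specialize (H2 y' ltac:(lra)); apply Rabs_def2 in H2; lra. }
  assert (Hcover : forall y, S y -> U y \/ V y).
  { intros y HSy; destruct (classic (V y)) as [|HVy]; [now right |].
    left; intros [HEy Hcy].
    destruct (Rle_lt_or_eq_dec _ _ Hcy) as [Hlt | Heq]; [now apply HVy |].
    apply (HSG y HSy), HGamma; now split. }
  exists M; intros y HSy; apply Rnot_lt_le; intros HMy.
  destruct (HS U V HU HV Hcover) as [x [_ [HUx [HEx Hcx]]]].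
  - exists z; split; [exact HSz |]; intros [HEz Hcz]; specialize (Hz HEz); lra.
  - exists y; split; [exact HSy | now apply HM].
  - apply HUx; split; [exact HEx | lra].
Qed.

Lemma pow_lt_compat (x y : R) (n : nat) : (0 <= x < y)%R -> (1 <= n)%nat -> (x ^ n < y ^ n)%R.
Proof.
  intros Hxy Hn; destruct n as [|n]; [lia |]; clear Hn; induction n as [|n IH]; simpl in *; [lra |].
  apply Rmult_le_0_lt_compat; try lra; apply Rmult_le_pos; [lra | apply pow_le; lra].
Qed.

Lemma pow_inj_nonneg (x y : R) (n : nat) :
  (0 <= x)%R -> (0 <= y)%R -> (1 <= n)%nat -> (x ^ n = y ^ n)%R -> x = y.
Proof.
  intros Hx Hy Hn E; destruct (Rtotal_order x y) as [H | [H | H]]; [| exact H |].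
  - generalize (pow_lt_compat x y n ltac:(lra) Hn); lra.
  - generalize (pow_lt_compat y x n ltac:(lra) Hn); lra.
Qed.

(** * The two maps and their boundary behaviour *)

Lemma closed_superlevel_plane (f : C -> C) (c : R) :
  (forall w, Ccontinuous f w) -> closed_set (fun w => (c <= Cmod (f w))%R).
Proof.
  intros Hf w Hw.
  destruct (Ccontinuous_Cmod f w (c - Cmod (f w))) as [d [Hd H]]; [apply Hf | lra |].
  exists d; split; [exact Hd |]; intros y Hy Hc.
  specialize (H y Hy); apply Rabs_def2 in H; lra.
Qed.

Lemma near_boundary_le (A : C -> Prop) (f g : C -> C) (c : R) :
  near_boundary A (fun z => ~ (c <= Cmod (g (f z)))%R) ->
  near_boundary A (fun z => (Cmod (g (f z)) <= c)%R).
Proof.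
  intros H e He; destruct (H e He) as [d [Hd H']].
  exists d; split; [exact Hd |]; intros z Hz Hze; specialize (H' z Hz Hze); lra.
Qed.

Lemma exterior_map_limit (Omega : C -> Prop) (Phi : C -> C) (d : R) :
  exterior_riemann_map Omega Phi d -> limit_at_infinity (fun z => Phi z / z) (RtoC d).
Proof.
  intros [_ [Hlim _]] eps Heps.
  apply (Hlim (fun y => (Cmod (y - RtoC d) <= eps)%R)), locally_Cmod.
  exists eps; split; [exact Heps |]; intros y Hy; lra.
Qed.

(** Properness: the closed set where the modulus is at least [y] lies in the
    range of the map, so its preimage stays away from the boundary. *)
Lemma exterior_map_boundary (Omega : C -> Prop) (Phi : C -> C) (d : R) :
  closed_set Omega -> bounded_set Omega -> exterior_riemann_map Omega Phi d ->
  forall y, (1 < y)%R -> near_boundary Omega (fun z => (Cmod (Phi z) <= y)%R).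
Proof.
  intros HO HO' Hmap y Hy.
  assert (Hpole := limit_simple_pole _ _ (exterior_map_limit _ _ _ Hmap)).
  destruct Hmap as [[HD [_ [Hinj Hsurj]]] [_ Hd]].
  apply (near_boundary_le Omega Phi (fun w => w)).
  apply (injective_proper Omega (fun w => (y <= Cmod w)%R) Phi d); auto.
  - intros z Hz; apply Cderivable_of_ex_derive, HD, Hz.
  - apply (closed_superlevel_plane (fun w => w)).
    intros w; apply Cderivable_continuous, Cderivable_id.
  - intros w Hw; apply Hsurj; lra.
Qed.

Lemma lemniscatic_map_limit (E : C -> Prop) (N : nat) (a : nat -> C) (m : nat -> R) (mu : R) (Phi : C -> C) :
  is_lemniscatic_map E N a m mu Phi -> limit_at_infinity (fun z => Phi z / z) 1.
Proof.
  intros [_ [_ [_ [M [c H]]]]] eps Heps.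
  exists (Rmax (Rmax 1 M) (Rabs c / eps)); intros z Hz.
  generalize (Rmax_l (Rmax 1 M) (Rabs c / eps)) (Rmax_r (Rmax 1 M) (Rabs c / eps)) (Rmax_l 1 M) (Rmax_r 1 M);
    intros.
  assert (Hz0 : z <> 0) by (apply Cmod_gt_0; lra).
  specialize (H z ltac:(lra)).
  replace (Phi z / z - 1) with ((Phi z - z) / z) by (field; exact Hz0).
  rewrite Cmod_div by exact Hz0.
  apply (Rmult_le_reg_r (Cmod z)); [lra |].
  unfold Rdiv at 1; rewrite Rmult_assoc, Rinv_l, Rmult_1_r by lra.
  apply Rle_trans with (Rabs c).
  - eapply Rle_trans; [exact H |].
    apply (Rmult_le_reg_r (Cmod z)); [lra |].
    unfold Rdiv; rewrite Rmult_assoc, Rinv_l by lra.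
    generalize (Rle_abs c) (Rabs_pos c); nra.
  - apply Rle_trans with (eps * (Rabs c / eps))%R; [apply Req_le; field; lra |].
    apply Rmult_le_compat_l; lra.
Qed.

Lemma abs_pow_nonneg (x m : R) : (0 <= abs_pow x m)%R.
Proof. unfold abs_pow; destruct Req_dec_T; [lra | apply Rlt_le, exp_pos]. Qed.

Lemma abs_U_nonneg (N : nat) (a : nat -> C) (m : nat -> R) (w : C) : (0 <= abs_U N a m w)%R.
Proof.
  unfold abs_U; induction (seq 1 N) as [|j l IH]; simpl; [lra |].
  apply Rmult_le_pos; [apply abs_pow_nonneg | exact IH].
Qed.

(** In this section [X] is the product of the linear factors at the foci, over
    one period of the sequence, composed with the lemniscatic map. *)
Section LemniscaticMap.

Variables (E : C -> Prop) (N : nat) (a : nat -> C) (m : nat -> R) (mu : R) (Phi : C -> C).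
Variables (n : nat) (beta : nat -> C).
Hypothesis HE : closed_set E.
Hypothesis HE' : bounded_set E.
Hypothesis Hmap : is_lemniscatic_map E N a m mu Phi.
Hypothesis Hn : (1 <= n)%nat.
Hypothesis Hper : periodic n beta.
Hypothesis Hadm : admissible N a m beta.

Let X (z : C) : C := u_poly beta n (Phi z).

Lemma lemniscatic_mu_pos : (0 < mu)%R.
Proof. apply Hmap. Qed.

Lemma lemniscatic_Cderivable (z : C) : ~ E z -> Cderivable Phi z.
Proof.
  destruct Hmap as [_ [_ [[HD _] _]]]; intros Hz; apply Cderivable_of_ex_derive, HD, Hz.
Qed.

Lemma Cmod_X (z : C) : Cmod (X z) = (abs_U N a m (Phi z) ^ n)%R.
Proof. apply (Cmod_u_poly_period N a m mu); [exact Hn | exact Hper | apply Hmap | exact Hadm]. Qed.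

Lemma X_Cderivable (z : C) : ~ E z -> Cderivable X z.
Proof.
  intros Hz; apply (Cderivable_comp (u_poly beta n) Phi);
    [apply poly_fun_Cderivable, u_poly_poly_fun | now apply lemniscatic_Cderivable].
Qed.

Lemma X_lower_bound (z : C) : ~ E z -> (mu ^ n < Cmod (X z))%R.
Proof.
  intros Hz; rewrite Cmod_X; apply pow_lt_compat; [| exact Hn].
  generalize lemniscatic_mu_pos; destruct Hmap as [_ [_ [[_ [HR _]] _]]]; specialize (HR z Hz); lra.
Qed.

Lemma X_boundary (x : R) : (mu ^ n < x)%R -> near_boundary E (fun z => (Cmod (X z) <= x)%R).
Proof.
  intros Hx.
  assert (Hpole := limit_simple_pole _ 1 (lemniscatic_map_limit _ _ _ _ _ _ Hmap)).
  assert (Hmu := lemniscatic_mu_pos).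
  apply (near_boundary_le E Phi (u_poly beta n)).
  apply (injective_proper E (fun w => (x <= Cmod (u_poly beta n w))%R) Phi 1); auto.
  - exact lemniscatic_Cderivable.
  - lra.
  - destruct Hmap as [_ [_ [[_ [_ [Hinj _]]] _]]]; exact Hinj.
  - apply closed_superlevel_plane; intros w.
    apply Cderivable_continuous, poly_fun_Cderivable, u_poly_poly_fun.
  - intros w Hw.
    destruct Hmap as [_ [Hdata [[_ [_ [_ Hsurj]]] _]]]; apply Hsurj.
    rewrite (Cmod_u_poly_period N a m mu) in Hw by assumption.
    apply Rnot_le_lt; intros Hle.
    assert (abs_U N a m w ^ n <= mu ^ n)%R by (apply pow_incr; split; [apply abs_U_nonneg | exact Hle]).
    lra.
Qed.

Lemma level_curve_X (lambda : R) (z : C) :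
  (0 < lambda)%R ->
  level_curve E N a m mu Phi lambda z <-> ~ E z /\ Cmod (X z) = ((lambda * mu) ^ n)%R.
Proof.
  intros Hl; assert (Hmu := lemniscatic_mu_pos).
  assert (Hlm : (0 < lambda * mu)%R) by now apply Rmult_lt_0_compat.
  rewrite Cmod_X; unfold level_curve, green.
  split; intros [Hz H]; split; try exact Hz.
  - f_equal; apply ln_inv; [| exact Hlm | rewrite ln_mult; lra].
    destruct Hmap as [_ [_ [[_ [HR _]] _]]]; specialize (HR z Hz); lra.
  - apply pow_inj_nonneg in H; [| apply abs_U_nonneg | lra | exact Hn].
    rewrite H, ln_mult; lra.
Qed.

End LemniscaticMap.

Theorem theorem3p3
  (Omega : C -> Prop)
  (HOmega : simply_connected_compact Omega)
  (HOmega_nondeg : nondegenerate Omega)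
  (HOmega_conj : forall z, Omega z <-> Omega (Cconj z))
  (Phit : C -> C) (d : R)
  (HPhit : exterior_riemann_map Omega Phit d)
  (n : nat) (alpha alpha0 : R)
  (Hn : (2 <= n)%nat)
  (Halpha : (0 < alpha)%R)
  (x0 : R)
  (Hx0 : Omega (RtoC x0) /\ forall x : R, Omega (RtoC x) -> (x0 <= x)%R)
  (Halpha0 : (alpha0 < x0)%R)
  (P : C -> C)
  (HP : forall z, P z = RtoC alpha * z ^ n + RtoC alpha0)
  (mu : R)
  (Hmu : mu = Rpower (/ (alpha * d)) (/ INR n))
  (a : nat -> C)
  (Ha_distinct : forall i j : nat, (1 <= i <= n)%nat -> (1 <= j <= n)%nat ->
     a i = a j -> i = j)
  (Ha_roots : forall w, w ^ n + RtoC mu ^ n * Phit (P 0) = 0 <->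
     exists j : nat, (1 <= j <= n)%nat /\ w = a j)
  (k : nat)
  (F b : C -> C)
  (HF : is_faber_polynomial Phit k F)
  (Hb : is_faber_walsh_polynomial
          (fun z => Omega (P z))
          (fun j => a (S (Nat.modulo (j - 1) n)))
          (k * n) b) :
  forall z, b z = RtoC (/ (alpha * d) ^ k) * F (P z).
Proof.
  clear HOmega_nondeg HOmega_conj x0 Hx0 Halpha0 mu Hmu Ha_distinct Ha_roots.
  intros z.
  assert (EP : P = monomial_shift alpha alpha0 n) by (apply functional_extensionality; exact HP).
  clear HP.
  assert (Hn1 : (1 <= n)%nat) by lia; clear Hn.
  destruct HOmega as [_ [HOcomp _]].
  assert (HO := compact_set_closed Omega HOcomp).
  assert (HO' := compact_set_bounded Omega HOcomp); clear HOcomp.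
  assert (HPder : forall y, Cderivable P y)
    by (intros y; rewrite EP; apply poly_fun_Cderivable, monomial_shift_poly).
  assert (HPinf : forall r, C_infty (fun y => (r < Cmod (P y))%R))
    by (intros r; rewrite EP; now apply monomial_shift_large).
  set (E := fun y => Omega (P y)) in *.
  set (beta := fun j => a (S (Nat.modulo (j - 1) n))) in *.
  assert (Hper : periodic n beta).
  { intros j Hj; unfold beta; replace (j + n - 1)%nat with ((j - 1) + 1 * n)%nat by lia.
    now rewrite Nat.Div0.mod_add. }
  assert (HE : closed_set E).
  { intros y Hy; destruct (HO (P y) Hy) as [r [Hr H]].
    destruct (Cderivable_continuous P y (HPder y) r Hr) as [r' [Hr' H']].
    exists r'; split; [exact Hr' |]; intros y' Hy'; apply H, H', Hy'. }
  assert (HE' : bounded_set E).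
  { destruct HO' as [B HB]; destruct (HPinf B) as [M HM].
    exists M; intros y Hy; apply Rnot_lt_le; intros H.
    specialize (HM y H); specialize (HB _ Hy); lra. }
  destruct Hb as [N [a' [m' [mu' [Phi [Hmap [Hadm Hint]]]]]]].
  assert (Hmu' := lemniscatic_mu_pos E N a' m' mu' Phi Hmap).
  set (X := fun y => u_poly beta n (Phi y)).
  set (T := fun y => Phit (P y)).
  assert (Hd : (0 < d)%R) by apply HPhit.
  assert (Had : (0 < alpha * d)%R) by now apply Rmult_lt_0_compat.
  set (L := RtoC (/ (alpha * d))).
  assert (HL : L <> 0).
  { intros H; apply RtoC_inj in H; generalize (Rinv_0_lt_compat _ Had); lra. }
  assert (HTder : forall y, ~ E y -> Cderivable T y).
  { intros y Hy; apply (Cderivable_comp Phit P); [| apply HPder].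
    apply Cderivable_of_ex_derive, HPhit, Hy. }
  assert (HTlow : forall y, ~ E y -> (1 < Cmod (T y))%R) by (intros y Hy; apply HPhit, Hy).
  assert (HTlim : limit_at_infinity (fun y => T y / y ^ n) (RtoC d * RtoC alpha)).
  { apply (limit_ext (fun y => (Phit (P y) / P y) * (P y / y ^ n))).
    - generalize (C_infty_and _ _ C_infty_nonzero (HPinf 0%R)); apply C_infty_imp.
      intros y [Hy HPy]; unfold T; field; split; [now apply Cpow_nz | now apply Cmod_gt_0].
    - apply limit_mult; [| rewrite EP; now apply limit_monomial_shift].
      intros eps Heps; destruct (exterior_map_limit _ _ _ HPhit eps Heps) as [M HM].
      generalize (HPinf M); apply C_infty_imp; intros y; apply HM. }
  assert (HTinf : forall B, C_infty (fun y => (B <= Cmod (T y))%R)).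
  { intros B; destruct (HTlim (alpha * d / 2)%R ltac:(lra)) as [M HM].
    exists (Rmax (Rmax 1 M) (2 * B / (alpha * d))); intros y Hy.
    generalize (Rmax_l (Rmax 1 M) (2 * B / (alpha * d))) (Rmax_r (Rmax 1 M) (2 * B / (alpha * d)))
      (Rmax_l 1 M) (Rmax_r 1 M); intros.
    assert (Hyn : y ^ n <> 0) by (apply Cpow_nz, Cmod_gt_0; lra).
    specialize (HM y ltac:(lra)).
    assert (Hpow := pow_ge_base (Cmod y) n ltac:(lra) Hn1).
    generalize (Cmod_reverse_triangle (RtoC d * RtoC alpha) (T y / y ^ n)).
    rewrite Cmod_minus_sym, <- RtoC_mult, Cmod_R, Rabs_pos_eq, Cmod_div, Cmod_pow by (auto; lra).
    rewrite <- RtoC_mult in HM; intros Hlow.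
    assert (Hquot : (alpha * d / 2 <= Cmod (T y) / Cmod y ^ n)%R) by lra.
    apply (Rmult_le_compat_r (Cmod y ^ n)) in Hquot; [| lra].
    unfold Rdiv at 2 in Hquot; rewrite Rmult_assoc, Rinv_l, Rmult_1_r in Hquot by lra.
    apply Rle_trans with (alpha * d / 2 * (2 * B / (alpha * d)))%R; [apply Req_le; field; lra |].
    eapply Rle_trans; [apply Rmult_le_compat_l; [lra |] | exact Hquot]; lra. }
  (* Both functions have constant modulus on the boundary of [E] and a pole of
     order [n] at infinity, with leading coefficients [1] and [alpha * d]. *)
  assert (HXT : C_infty (fun y => X y = L * T y)).
  { apply (proportional_near_infinity E X T (mu' ^ n) 1 L); auto.
    - intros y Hy; now apply (X_Cderivable E N a' m' mu' Phi).
    - now apply pow_lt.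
    - lra.
    - intros x Hx; now apply (X_boundary E N a' m' mu' Phi).
    - intros y Hy e He.
      destruct (exterior_map_boundary Omega Phit d HO HO' HPhit y Hy (P e) He) as [r [Hr H]].
      destruct (Cderivable_continuous P e (HPder e) r Hr) as [r' [Hr' H']].
      exists r'; split; [exact Hr' |]; intros w Hw Hwe; apply H; [exact Hw | now apply H'].
    - intros y Hy; apply Rlt_le; now apply (X_lower_bound E N a' m' mu' Phi).
    - intros y Hy; apply Rlt_le; now apply HTlow.
    - assert (Hda : RtoC d * RtoC alpha <> 0) by (rewrite <- RtoC_mult; intros H; apply RtoC_inj in H; lra).
      assert (HLeq : L = 1 * / (RtoC d * RtoC alpha)).
      { unfold L; rewrite RtoC_inv, RtoC_mult by lra; rewrite Cmult_1_l; f_equal; ring. }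
      change (limit_at_infinity (fun y => X y / T y) L); rewrite HLeq.
      apply (limit_ext (fun y => (X y / y ^ n) * / (T y / y ^ n))).
      + generalize (C_infty_and _ _ C_infty_nonzero (HTinf 1%R)); apply C_infty_imp.
        intros y [Hy HTy]; field.
        split; [apply Cmod_gt_0; lra | now apply Cpow_nz].
      + apply limit_mult; [| now apply limit_inv].
        apply (limit_u_poly beta n Phi), (lemniscatic_map_limit _ _ _ _ _ _ Hmap). }
  destruct HF as [N0 [c0 [e [M [HFpoly HFser]]]]].
  set (h := fun w => Phit w ^ k - F w).
  destruct (laurent_tail_integral e M h alpha alpha0 n z Halpha Hn1 HFser) as [r Htail].
  rewrite <- EP in Htail.
  destruct HXT as [RX HXT].
  set (Rbig := Rmax r RX).
  assert (Hpole := limit_simple_pole _ 1 (lemniscatic_map_limit _ _ _ _ _ _ Hmap)).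
  destruct (injective_large_values E Phi 1 HE') with (R := Rbig) as [R' HR'].
  { intros y Hy; now apply (lemniscatic_Cderivable E N a' m' mu' Phi). }
  { lra. } { exact Hpole. } { apply Hmap. }
  destruct (poly_fun_bounded (u_poly beta n) R' (u_poly_poly_fun beta n)) as [K HK].
  set (K' := Rmax K 0).
  assert (HKK' : (K <= K')%R) by apply Rmax_l.
  assert (HK'0 : (0 <= K')%R) by apply Rmax_r.
  (* [lambda] is so large that the level curve encloses [z] and lies where both
     the Laurent expansion of [Phit ^ k] and [X = L * T] hold. The bound [K'] on
     [u_poly] over the disc of radius [R'] keeps the curve out of that disc. *)
  set (lambda := (1 + (K' + Cmod (X z) + 1) / mu')%R).
  set (c := ((lambda * mu') ^ n)%R).
  assert (HXz := Cmod_ge_0 (X z)).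
  assert (Hlm : (lambda * mu' = mu' + K' + Cmod (X z) + 1)%R) by (unfold lambda; field; lra).
  assert (Hlambda : (1 < lambda)%R).
  { assert (0 < (K' + Cmod (X z) + 1) / mu')%R by (apply Rdiv_lt_0_compat; lra).
    unfold lambda; lra. }
  assert (Hc : (mu' + K' + Cmod (X z) + 1 <= c)%R).
  { unfold c; rewrite <- Hlm; apply pow_ge_base; [lra | exact Hn1]. }
  assert (Hmuc : (mu' ^ n < c)%R) by (apply pow_lt_compat; [lra | exact Hn1]).
  set (Gamma := level_curve E N a' m' mu' Phi lambda).
  assert (HGamma : forall y, Gamma y <-> ~ E y /\ Cmod (X y) = c).
  { intros y; apply (level_curve_X E N a' m' mu' Phi n beta Hmap Hn1 Hper Hadm); lra. }
  assert (Hz : interior_of Gamma z).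
  { apply (interior_of_level E X Gamma c ((mu' ^ n + c) / 2)); auto; try lra.
    - intros y Hy; apply Cderivable_continuous; now apply (X_Cderivable E N a' m' mu' Phi).
    - apply (X_boundary E N a' m' mu' Phi n beta); auto; lra.
    - assert (HLm := proj1 (Cmod_gt_0 L) HL).
      generalize (C_infty_and _ _ (C_infty_outside E HE')
        (C_infty_and _ _ (ex_intro _ RX HXT) (HTinf ((c + 1) / Cmod L)%R))); apply C_infty_imp.
      intros y [Hy [HXy HTy]]; split; [exact Hy |].
      rewrite HXy, Cmod_mult.
      apply (Rmult_le_compat_l (Cmod L)) in HTy; [| lra].
      replace (Cmod L * ((c + 1) / Cmod L))%R with (c + 1)%R in HTy by (field; lra); lra. }
  destruct (Hint lambda z Hlambda Hz) as [cyc [[Hcyc [Htrace [Hwind _]]] Hbz]].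
  fold Gamma in Htrace, Hwind.
  assert (Hfar : forall y, trace cyc y -> ~ E y /\ (Rbig < Cmod y)%R).
  { intros y Hy; apply Htrace, HGamma in Hy; destruct Hy as [HEy HXy].
    split; [exact HEy |]; apply HR'; [exact HEy |].
    apply Rnot_le_lt; intros Hle; specialize (HK (Phi y) Hle).
    change (u_poly beta n (Phi y)) with (X y) in HK; lra. }
  assert (Hr : (r <= Rbig)%R) by apply Rmax_l.
  assert (HRX : (RX <= Rbig)%R) by apply Rmax_r.
  assert (Hztr : ~ trace cyc z) by (intros Hy; apply Htrace in Hy; now apply (proj1 Hz)).
  assert (HFP : poly_fun (fun y => F (P y))).
  { apply (poly_fun_comp F P); [| rewrite EP; apply monomial_shift_poly].
    apply (poly_fun_ext (fun y => sum_n (fun j => c0 j * y ^ j) N0)); [auto | apply poly_fun_sum]. }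
  assert (HhP : forall y, ~ E y -> Cderivable (fun y => h (P y)) y).
  { intros y Hy; apply (Cderivable_minus (fun y => T y ^ k) (fun y => F (P y)));
      [now apply Cderivable_pow, HTder | now apply poly_fun_Cderivable]. }
  assert (Hker : forall y, trace cyc y -> Cderivable (fun y => / (y - z)) y).
  { intros y Hy; apply Cderivable_inv; [| now apply (trace_ne cyc)].
    apply Cderivable_minus; [apply Cderivable_id | apply Cderivable_const]. }
  assert (H2pi : 2 * PI * Ci <> 0).
  { apply Cmult_neq_0; [| exact Ci_nz].
    rewrite <- RtoC_mult; intros H; apply RtoC_inj in H; generalize PI_RGT_0; lra. }
  assert (Hker1 : cycle_integral cyc (fun y => / (y - z)) = 2 * PI * Ci).
  { specialize (Hwind z Hz); unfold winding_number in Hwind.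
    rewrite <- (Cmult_1_r (2 * PI * Ci)), <- Hwind, Cmult_assoc, Cinv_r by exact H2pi; ring. }
  assert (HFPk : forall y, trace cyc y -> Cderivable (fun y => F (P y) / (y - z)) y).
  { intros y Hy; apply Cderivable_mult; [now apply poly_fun_Cderivable | now apply Hker]. }
  assert (HhPk : forall y, trace cyc y -> Cderivable (fun y => h (P y) / (y - z)) y).
  { intros y Hy; apply Cderivable_mult; [apply HhP, Hfar, Hy | now apply Hker]. }
  rewrite (cycle_integral_ext _ _ (fun y => L ^ k * (F (P y) / (y - z) + h (P y) / (y - z)))) in Hbz.
  2: { intros y Hy; destruct (Hfar y Hy) as [HEy Hyfar].
       rewrite u_poly_periodic by exact Hper.
       change (u_poly beta n (Phi y)) with (X y); rewrite HXT by lra.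
       rewrite Cpow_mult_l; unfold h, T; field; now apply (trace_ne cyc). }
  rewrite cycle_integral_scal, cycle_integral_plus, (cauchy_formula_poly cyc (fun y => F (P y))),
    Htail, Hker1 in Hbz; auto.
  - assert (HLk : RtoC (/ (alpha * d) ^ k) = L ^ k)
      by (unfold L; rewrite <- RtoC_pow, pow_inv; reflexivity).
    rewrite HLk, <- (Cmult_1_l (b z)), <- (Cinv_l (2 * PI * Ci) H2pi), <- Cmult_assoc, Hbz.
    transitivity ((/ (2 * PI * Ci) * (2 * PI * Ci)) * (L ^ k * F (P z))); [ring |].
    rewrite Cinv_l by exact H2pi; ring.
  - intros y Hy; destruct (Hfar y Hy); lra.
  - intros y Hy; apply HhP, Hfar, Hy.
  - intros y Hy; now apply Cderivable_continuous, HFPk.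
  - intros y Hy; now apply Cderivable_continuous, HhPk.
  - intros y Hy; apply Cderivable_continuous, Cderivable_plus; auto.
Qed.
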